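(* Let $X,Y,Z$ be Polish spaces, let $\rho=\rho(x,z)=\rho(x|z)\nu(z)\in P(X\times Z)$, and let $c\in C(X\times Y)$ be bounded below ($\inf c>-\infty$). Assume that: (A1) $c$ is locally uniformly coercive and $Y$ satisfies the Heine-Borel property; (A2) for all $\mu\in P(Y)$ and $\nu$-almost all $z$, the optimal coupling between $\rho(\cdot|z)$ and $\mu$ for the cost $c$ is unique and is a Monge solution, i.e. it is of the form $(\mathrm{Id},T_z)\#\rho(\cdot|z)$ for some transport map $T_z$. Then the barycenter problem has a Monge solution: the minimum total transport cost $$\min_{\mu \in P(Y)} \int_{Z} I_c(\rho(\cdot|z),\mu)\, d\nu(z)=\min_{\substack{\pi \in P(X\times Y\times Z)\\ \pi_{XZ} = \rho\\ \pi_{YZ} = \pi_Y \otimes \pi_Z}} \int c(x,y)\, d\pi(x,y,z)$$ equals $$\min_{\substack{T:X\times Z \to Y\\ \text{Borel measurable}}}\ \sup_{\substack{\psi_Y \in C_b(Y),\ \psi_Z \in C_b(Z)\\ \int \psi_Z\, d\nu = 0}} \int \big[c(x,T(x,z)) - \psi_Y(T(x,z))\,\psi_Z(z) \big]\, d\rho(x,z),$$ and every minimizer $T$ of the latter problem is a transport map from $\rho(x,z)$ to a barycenter $\mu$ of $\rho(x,z)$.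
   Context: $P(X)$ denotes the set of Borel probability measures on $X$ and $C_b$ the bounded continuous real functions. For a joint measure $\pi$, $\pi_{XZ},\pi_{YZ},\pi_Y,\pi_Z$ etc. denote its marginals. The conditionals $\rho(\cdot|z)$ are given by disintegration of $\rho$ with respect to its $Z$-marginal $\nu$. $T\#\rho$ denotes pushforward. For $\rho_1\in P(X)$, $\mu\in P(Y)$: $I_c(\rho_1,\mu)=\inf\{\int_{X\times Y} c\,d\pi:\ \pi\in P(X\times Y),\ \pi_X=\rho_1,\ \pi_Y=\mu\}$; a minimizing $\pi$ is called an optimal coupling. The total transport cost between $\rho(x,z)$ and $\mu$ is $\int_Z I_c(\rho(\cdot|z),\mu)\,d\nu(z)$, and a barycenter of $\rho(x,z)$ is a $\mu\in P(Y)$ attaining the infimum of the total transport cost over $P(Y)$. A map $T:X\times Z\to Y$ is a transport map from $\rho(x,z)$ to $\mu$ if $\tilde T\#\rho=\mu\otimes\nu$ where $\tilde T(x,z)=(T(x,z),z)$; equivalently $T(\cdot,z)\#\rho(\cdot|z)=\mu$ for $\nu$-almost all $z$. With $d$ the metric of $Y$: $c$ is locally uniformly coercive if for some (and thus every) $y_0\in Y$ and every compact $K\subseteq X$, $\lim_{d(y,y_0)\to\infty}\inf_{x\in K}c(x,y)=\infty$, the limit being taken over all sequences in $Y$. $Y$ satisfies the Heine-Borel property if every closed bounded subset of $Y$ is compact.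
   Formalization: The claim that every minimizer T is a transport map to a barycenter is stated only for minimizers with finite value; if the minimum is +∞, every Borel T is a minimizer and the claim fails. *)

(* Defs.v *)
From HB Require Import structures.
From mathcomp Require Import all_boot all_order all_algebra.
From mathcomp Require Import all_classical all_reals all_analysis.

Set Implicit Arguments.
Unset Strict Implicit.
Unset Printing Implicit Defensive.

Import Order.TTheory GRing.Theory Num.Theory.
Import numFieldNormedType.Exports.

Local Open Scope classical_set_scope.
Local Open Scope ring_scope.
Local Open Scope ereal_scope.

(* Pointed, hence nonempty, as are all complete spaces of the library. A Polish
   space is a separable one, with its metric [mdist] fixed. *)
#[short(type="completeMetricType")]
HB.structure Definition CompleteMetric (R : realType) :=
  {T of Complete T & Metric R T}.

Definition separable (T : topologicalType) : Prop :=
  exists2 A : set T, countable A & dense A.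

(* On Polish spaces the product sigma-algebra of [borel X * borel Y] is the
   Borel sigma-algebra of [X * Y]. *)
Notation borel X := (g_sigma_algebraType (@open X)).

(* A measure takes unspecified values on non-measurable sets, so measures are
   compared on measurable sets only. *)
Definition same_measure d (T : measurableType d) (R : realType)
    (m1 m2 : set T -> \bar R) : Prop :=
  forall A, measurable A -> m1 A = m2 A.

Definition is_min (R : realType) (S : set (\bar R)) (v : \bar R) : Prop :=
  S v /\ lbound S v.

Definition bounded_continuous (R : realType) (T : topologicalType)
    (f : T -> R) : Prop :=
  continuous f /\ bounded_fun f.

Definition heine_borel (R : realType) (Y : metricType R) : Prop :=
  forall A : set Y, closed A ->
    (exists (y0 : Y) (r : R), A `<=` [set y | (mdist y0 y <= r)%R]) ->
    compact A.

Definition locally_uniformly_coercive (R : realType) (X Y : metricType R)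
    (c : X * Y -> R) : Prop :=
  exists y0 : Y, forall K : set X, compact K -> forall y : nat -> Y,
    mdist (y n) y0 @[n --> \oo] --> (+oo)%R ->
    ereal_inf [set (c (x, y n))%:E | x in K] @[n --> \oo] --> +oo.

Section transport.
Context (R : realType) (X Y Z : completeMetricType R).
Variable c : X * Y -> R.

Definition coupling (a : set (borel X) -> \bar R) (b : set (borel Y) -> \bar R)
    (pi : probability (borel X * borel Y)%type R) : Prop :=
  same_measure (pushforward pi fst) a /\ same_measure (pushforward pi snd) b.

Definition transport_cost (pi : probability (borel X * borel Y)%type R) :=
  \int[pi]_p (c p)%:E.

Definition Ic (a : set (borel X) -> \bar R) (b : set (borel Y) -> \bar R)
    : \bar R :=
  ereal_inf (transport_cost @` coupling a b).

Definition optimal_coupling (a : set (borel X) -> \bar R)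
    (b : set (borel Y) -> \bar R)
    (pi : probability (borel X * borel Y)%type R) : Prop :=
  coupling a b pi /\ transport_cost pi = Ic a b.

Definition unique_monge_coupling (a : set (borel X) -> \bar R)
    (b : set (borel Y) -> \bar R) : Prop :=
  exists pi : probability (borel X * borel Y)%type R,
    [/\ optimal_coupling a b pi,
        forall pi' : probability (borel X * borel Y)%type R,
          optimal_coupling a b pi' -> same_measure pi' pi
      & exists T : borel X -> borel Y,
          [/\ measurable_fun [set: borel X] T,
              same_measure (pushforward a T) b
            & same_measure pi
                (pushforward a (fun x => (x, T x) : borel X * borel Y))]].

(* The disintegration rho(dx, dz) = k z (dx) nu(dz), nu being the Z-marginal. *)
Definition disintegration (rho : probability (borel X * borel Z)%type R)
    (nu : probability (borel Z) R) (k : R.-pker (borel Z) ~> (borel X)) : Prop :=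
  same_measure (pushforward rho snd) nu /\
  forall (A : set (borel X)) (B : set (borel Z)),
    measurable A -> measurable B -> rho (A `*` B) = \int[nu]_(z in B) k z A.

Definition total_transport_cost (nu : probability (borel Z) R)
    (k : R.-pker (borel Z) ~> (borel X)) (mu : probability (borel Y) R) :=
  \int[nu]_z Ic (k z) mu.

Definition barycenter (nu : probability (borel Z) R)
    (k : R.-pker (borel Z) ~> (borel X)) (mu : probability (borel Y) R) : Prop :=
  forall mu' : probability (borel Y) R,
    total_transport_cost nu k mu <= total_transport_cost nu k mu'.

Definition barycentric_coupling (rho : probability (borel X * borel Z)%type R)
    (pi : probability (borel X * borel Y * borel Z)%type R) : Prop :=
  same_measure
    (pushforward pi (fun p => (p.1.1, p.2) : borel X * borel Z)) rho /\
  same_measure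
    (pushforward pi (fun p => (p.1.2, p.2) : borel Y * borel Z))
    (pushforward pi (fun p => p.1.2 : borel Y) \x
     pushforward pi (fun p => p.2 : borel Z)).

Definition joint_cost (pi : probability (borel X * borel Y * borel Z)%type R) :=
  \int[pi]_p (c p.1)%:E.

Definition monge_functional (rho : probability (borel X * borel Z)%type R)
    (nu : probability (borel Z) R) (T : borel X * borel Z -> borel Y)
    : \bar R :=
  ereal_sup [set v | exists (psiY : Y -> R) (psiZ : Z -> R),
    [/\ bounded_continuous psiY, bounded_continuous psiZ,
        \int[nu]_z (psiZ z)%:E = 0
      & v = \int[rho]_p (c (p.1, T p) - psiY (T p) * psiZ p.2)%:E]].

Definition transport_map (rho : probability (borel X * borel Z)%type R)
    (nu : probability (borel Z) R) (mu : probability (borel Y) R)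
    (T : borel X * borel Z -> borel Y) : Prop :=
  measurable_fun [set: borel X * borel Z] T /\
  same_measure
    (pushforward rho (fun p => (T p, p.2) : borel Y * borel Z)) (mu \x nu).

End transport.

(* Main.v *)
(** Every coupling is represented as [y = xi (x, z, w)] with an independent
    uniform noise [w]: such a [xi] is extracted from an ultrafilter limit of
    laws on [B * Y] with fixed marginal on [B] and tight second marginal, by
    letting [w] choose successively among the cells of finer and finer covers
    with the limiting conditional probabilities. The limit is lower
    semicontinuous for nonnegative costs continuous in [y].

    With [B = X * Z], coercivity gives an optimal [xi]. With [B = Z * Y], gluing
    couplings that are near-optimal on small cells of [Z] bounds the cost of an
    optimal [xi] by the integral of a measurable minorant of [Ic c (k z) mu].
    Hence the section of an optimal [xi] at almost every [z] is an optimal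
    coupling, and by (A2) it does not depend on the noise, so [w] can be frozen.
    Finally the penalization in the last problem is finite only if [T] pushes
    [rho] to a product, since test functions can be scaled. *)
From HB Require Import structures.
Require Import Defs.
From mathcomp Require Import all_boot all_order all_algebra.
From mathcomp Require Import all_classical all_reals all_analysis.
From mathcomp Require Import measurable_realfun lra.

Set Implicit Arguments.
Unset Strict Implicit.
Unset Printing Implicit Defensive.

Import Order.TTheory GRing.Theory Num.Theory.
Import numFieldNormedType.Exports.

Local Open Scope classical_set_scope.
Local Open Scope ring_scope.
Local Open Scope ereal_scope.

(** * Laws and Borel structure *)

(** Three obstacles shape the proof. The spaces [X * Z] and [Z * Y] enter the limits only through
    their sigma-algebras, so limits are tested against functions measurable in the first variable
    and continuous in the second, as for Young measures. The limiting set function is only finitely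
    additive; it can be sampled because its parts over fixed cells of [Y] are dominated by the fixed
    marginal, hence have densities. Next, no optimal coupling is selected measurably in [z]: one
    coupling serves a whole cell, its first marginal is slightly wrong, and the error vanishes in
    the limit. There [x] is the sampled variable, so that the product law of [(z, y)] is kept
    exactly. Lastly, the maps provided by (A2) are found for each [z] separately and need not be
    jointly measurable; freezing the noise of a measurable [xi] avoids gluing them. Costs may be
    infinite, so they are shifted by a lower bound [m] and the infinite case is settled apart. *)

Definition unit_uniform (R : realType) : set (measurableTypeR R) -> \bar R :=
  mrestr (@lebesgue_measure R) (measurable_itv `[0%R, 1%R[).

HB.instance Definition _ (R : realType) := Measure.on (@unit_uniform R).

Lemma unit_uniform_setT (R : realType) : unit_uniform [set: measurableTypeR R] = 1.
Proof.
by rewrite /unit_uniform/= /mrestr setTI lebesgue_measure_itv/= lte_fin ltr01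
  -EFinB subr0.
Qed.

HB.instance Definition _ (R : realType) :=
  Measure_isProbability.Build _ _ _ (@unit_uniform R) (@unit_uniform_setT R).

(** Only half-open intervals are measured, and [r] stays strictly below 1 everywhere: the words of a
    given length will share out [[0, 1[] in half-open pieces. *)
Definition uniform_variable d (W : measurableType d) (R : realType)
    (Q : probability W R) (r : W -> R) :=
  [/\ measurable_fun [set: W] r, forall w, (0 <= r w < 1)%R &
      forall a b, (0 <= a)%R -> (a <= b)%R -> (b <= 1)%R ->
        Q [set w | (a <= r w < b)%R] = (b - a)%:E].

Lemma exists_uniform_variable (R : realType) :
  exists (d : measure_display) (W : measurableType d) (Q : probability W R)
    (r : W -> R), uniform_variable Q r.
Proof.
(* Reals outside [[0, 1[] are null for [unit_uniform]; sending them to 0 makes the bounds on [r]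
   hold everywhere. *)
pose r (w : measurableTypeR R) : R := if (0 <= w :> R)%R && (w < 1 :> R)%R then w else 0%R.
exists _, (measurableTypeR R), (@unit_uniform R), r; split.
- apply: measurable_fun_ifT => //; apply: measurable_and.
    exact: measurable_fun_ler.
  exact: measurable_fun_ltr.
- by move=> w; rewrite /r; case: ifPn => // _; rewrite lexx ltr01.
- move=> a b a0 ab b1; rewrite /= /unit_uniform/mrestr.
  rewrite (_ : _ `&` _ = [set` `[a, b[%R]).
    rewrite lebesgue_measure_itv/= lte_fin; case: ltP => h; first by rewrite -EFinB.
    have -> : a = b by apply/eqP; rewrite eq_le ab h.
    by rewrite subrr.
  apply/seteqP; split=> w /=; rewrite !in_itv/= /r.
    by move=> [+ w01]; rewrite w01.
  move=> /andP[aw wb]; have -> : (0 <= w :> R)%R && (w < 1 :> R)%R.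
    by rewrite (le_trans a0 aw)/= (lt_le_trans wb).
  by rewrite aw wb.
Qed.

Lemma probability_setC_le d (T : measurableType d) (R : realType) (P : probability T R)
    (A : set T) (e : R) : measurable A -> (P (~` A) <= e%:E) = ((1 - e)%:E <= P A).
Proof.
move=> mA; rewrite (probability_setC P mA) -[P A]fineK ?fin_num_measure//.
by rewrite -EFinB !lee_fin lerBlDr lerBlDl.
Qed.

Lemma product_probability_setT d d' (T : measurableType d) (T' : measurableType d')
    (R : realType) (P : probability T R) (Q : probability T' R) A :
  measurable A -> (P \x Q) (A `*` setT) = P A.
Proof.
move=> mA; transitivity (P A * Q setT); first exact: product_measure1E.
by rewrite [X in _ * X](_ : _ = 1) ?mule1//; exact: probability_setT.
Qed.

Section law.
Context d d' (T : measurableType d) (T' : measurableType d') (R : realType).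
Variables (P : probability T R) (f : T -> T') (mf : measurable_fun [set: T] f).

Definition law : probability T' R := distribution P (mfun_Sub (mem_set mf)).

Lemma lawE A : law A = P (f @^-1` A).
Proof. by []. Qed.

Lemma integral_law (g : T' -> \bar R) : measurable_fun [set: T'] g ->
  (forall y, 0 <= g y) -> \int[law]_y g y = \int[P]_x g (f x).
Proof.
move=> mg g0; exact: ge0_integral_pushforward.
Qed.

End law.

Definition rad {R : realType} (n : nat) : R := (n.+1%:R^-1)%R.

Lemma rad_gt0 (R : realType) n : (0 < rad n :> R)%R.
Proof. by rewrite /rad invr_gt0. Qed.

Lemma rad_small (R : realType) (e : R) : (0 < e)%R ->
  exists N, forall n, (N <= n)%N -> (rad n < e)%R.
Proof.
move=> e0; exists (Num.truncn e^-1) => n Nn.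
rewrite /rad invf_plt ?posrE ?ltr0n//.
by rewrite (lt_le_trans (truncnS_gt _))// ler_nat.
Qed.

Section borel_metric.
Context (R : realType) (Y : completeMetricType R).

Lemma open_borel_measurable (O : set Y) : open O -> measurable (O : set (borel Y)).
Proof. exact: sub_sigma_algebra. Qed.

Lemma mdist_continuous (a : Y) : continuous (mdist a : Y -> R).
Proof.
move=> x; apply/cvgrPdist_lt => e e0.
have : nbhs x (ball x e) by exact: nbhsx_ballx.
apply: filterS => y; rewrite ballEmdist/= => xy.
have := metric_triangle a x y; have := metric_triangle a y x.
rewrite (metric_sym y x) => h1 h2; rewrite ltr_norml; apply/andP; split; lra.
Qed.

Lemma continuous_borel_measurable (f : Y -> R) : continuous f ->
  measurable_fun [set: borel Y] (f : borel Y -> R).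
Proof.
move=> cf; apply: (measurability _ (RGenOInfty.measurableE R)) => //.
move=> _ [_ [r ->] <-]; rewrite setTI; apply: open_borel_measurable.
by apply: open_comp => [y _|]; [exact: cf|exact: interval_open].
Qed.

Lemma open_mball (a : Y) (r : R) : open (ball a r).
Proof.
have -> : ball a r = mdist a @^-1` [set` `]-oo, r[%R] :> set Y.
  by apply/seteqP; split=> y /=; rewrite ballEmdist/= in_itv.
by apply: open_comp => [y _|]; [exact: mdist_continuous|exact: interval_open].
Qed.

Lemma measurable_near_first (y_ : nat -> Y) N (e : R) :
  measurable ([set y | exists2 k, (k < N)%N & (mdist (y_ k) y < e)%R] : set (borel Y)).
Proof.
rewrite (_ : [set y | _] = \bigcup_(k in `I_N) ball (y_ k) e).
  by apply: bigcup_measurable => k _; apply: open_borel_measurable; exact: open_mball.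
by apply/seteqP; split=> y [k kN yk]; exists k => //; move: yk; rewrite ballEmdist.
Qed.

Lemma measurable_mdist (a : Y) : measurable_fun [set: borel Y] (mdist a : borel Y -> R).
Proof. by apply: continuous_borel_measurable; exact: mdist_continuous. Qed.

Lemma measurable_fun_borel d (T : measurableType d) (f : T -> borel Y) :
  (forall O : set Y, open O -> measurable (f @^-1` O)) -> measurable_fun setT f.
Proof.
move=> fO; apply: (measurability (@open Y : set (set (borel Y)))); first by [].
by move=> _ [V oV <-]; rewrite setTI; exact: fO.
Qed.

Definition dense_seq (y_ : nat -> Y) :=
  forall (y : Y) (r : R), (0 < r)%R -> exists k, (mdist (y_ k) y < r)%R.

Lemma separable_dense_seq : separable Y -> exists y_, dense_seq y_.
Proof.
case=> A /pfcard_geP[A0 dA|[f] dA].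
  have := dA setT; rewrite A0 setI0 => /(_ _ openT) [|].
    by exists point.
  by move=> ? [].
exists f => y r r0; have := dA (ball y r); case.
- by exists y; exact: ballxx.
- exact: open_mball.
- move=> x [yx /(@surj _ _ _ _ f)[k _ kx]]; exists k.
  by rewrite kx metric_sym; move: yx; rewrite ballEmdist.
Qed.

End borel_metric.

Section caratheodory.
Context d (B : measurableType d) (R : realType) (Y : completeMetricType R).
Variables (y_ : nat -> Y) (y_dense : dense_seq y_).

(** These are Caratheodory integrands. As [B] has no topology, they are the natural test functions
    for limits with a fixed [B]-marginal. *)
Definition caratheodory (h : B * borel Y -> R) :=
  (forall y, measurable_fun [set: B] (fun b => h (b, y))) /\
  (forall b, continuous ((fun y => h (b, y)) : Y -> R)).

(* Countably many conditions which force [h (b, y) > t] on the whole ball of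
   radius [rad n] around [y_ k]. *)
Definition ball_gt (h : B * borel Y -> R) (t : R) (n k : nat) : set B :=
  [set b | forall j, (mdist (y_ k) (y_ j) < rad n)%R ->
                     (t + rad n <= h (b, y_ j))%R].

Variables (h : B * borel Y -> R) (ch : caratheodory h).

Lemma measurable_ball_gt t n k : measurable (ball_gt h t n k).
Proof.
have -> : ball_gt h t n k = \bigcap_j [set b |
    (mdist (y_ k) (y_ j) < rad n)%R -> (t + rad n <= h (b, y_ j))%R].
  by apply/seteqP; split=> [b + j _|b + j]; apply.
apply: bigcapT_measurable => j; have [kj|kj] := pselect
    (mdist (y_ k) (y_ j) < rad n)%R; last first.
  rewrite (_ : [set _ | _] = setT)//.
  by apply/seteqP; split=> // b _ /=.
rewrite (_ : [set _ | _] =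
    (fun b => h (b, y_ j)) @^-1` [set` `[(t + rad n)%R, +oo[%R]).
  by rewrite -[X in measurable X]setTI; apply: ch.1.
by apply/seteqP; split=> b /=; rewrite in_itv/= andbT; [apply|].
Qed.

(** The margin [rad n] absorbs the passage from the dense points to [y]: some [y_ j] close to [y]
    stays in the open ball, and its value is within [rad n] of that of [y]. *)
Lemma ball_gtP t n k b y : ball_gt h t n k b ->
  (mdist (y_ k) y < rad n)%R -> (t < h (b, y))%R.
Proof.
move=> bk ky; rewrite ltNge; apply/negP => hty.
have e0 : (0 < rad n :> R)%R by exact: rad_gt0.
have /cvgrPdist_lt/(_ _ e0) := @ch.2 b y.
rewrite -(@filter_from_ballE R Y) => -[r /= r0 hr].
pose s := Num.min r (rad n - mdist (y_ k) y)%R.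
have s0 : (0 < s)%R by rewrite lt_min r0 subr_gt0.
have [j jy] := y_dense y s0.
have : (mdist (y_ k) (y_ j) < rad n)%R.
  have := metric_triangle (y_ k) y (y_ j); rewrite (metric_sym y).
  have : (s <= rad n - mdist (y_ k) y)%R by rewrite ge_min lexx orbT.
  by move=> *; lra.
move=> /bk; have : ball y r (y_ j).
  by rewrite ballEmdist/= metric_sym (lt_le_trans jy)// ge_min lexx.
by move=> /hr/=; rewrite ltr_norml => /andP[*]; lra.
Qed.

(** Half of the excess of [h (b, y)] over [t] pays for the oscillation of [h] near [y], the other
    half for the margin [rad n]. The condition on [k] is a large inequality because the limit
    variable will only be known to lie in closed balls. *)
Lemma near_ball_gt t b (y : Y) : (t < h (b, y))%R ->
  exists N, forall n, (N <= n)%N -> forall k,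
    (mdist (y_ k) y <= rad n)%R -> ball_gt h t n k b.
Proof.
rewrite -subr_gt0 => t0; have t20 : (0 < (h (b, y) - t) / 2)%R by lra.
have /cvgrPdist_lt/(_ _ t20) := @ch.2 b y.
rewrite -(@filter_from_ballE R Y) => -[r /= r0 hr].
have r20 : (0 < r / 2)%R by lra.
have [N hN] := rad_small r20; have [M hM] := rad_small t20.
exists (maxn N M) => n; rewrite geq_max => /andP[/hN nr /hM nt] k ky j kj.
have : ball y r (y_ j).
  rewrite ballEmdist/=.
  have := metric_triangle y (y_ k) (y_ j); rewrite (metric_sym y (y_ k)).
  by move=> *; lra.
by move=> /hr/=; rewrite ltr_norml => /andP[*]; lra.
Qed.

(** By the two previous lemmas, a superlevel set is a countable union of measurable rectangles. *)
Lemma caratheodory_measurable : measurable_fun [set: B * borel Y] h.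
Proof.
apply: (measurability _ (RGenOInfty.measurableE R)) => //.
move=> _ [_ [t ->] <-]; rewrite setTI.
have -> : h @^-1` [set` `]t, +oo[%R] =
    \bigcup_n \bigcup_k (ball_gt h t n k `*` (ball (y_ k) (rad n))).
  apply/seteqP; split=> [[b y]|[b y] [n _ [k _ [/= bk ky]]]] /=.
    rewrite in_itv/= andbT => /near_ball_gt[N /(_ N (leqnn _)) hN].
    have N0 : (0 < rad N :> R)%R by exact: rad_gt0.
    have [k ky] := y_dense y N0.
    exists N => //; exists k => //; split => /=; first exact/hN/ltW.
    by rewrite ballEmdist.
  rewrite in_itv/= andbT; apply: (ball_gtP bk).
  by move: ky; rewrite ballEmdist.
do 2 apply: bigcupT_measurable => ?.
apply: measurableX; first exact: measurable_ball_gt.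
by apply: open_borel_measurable; exact: open_mball.
Qed.

End caratheodory.

Section weighted_measure.
Context d d' (T : measurableType d) (T' : measurableType d') (R : realType).
Variables (P : probability T R) (f : T -> R) (eta : T -> T').
Hypotheses (mf : measurable_fun [set: T] f) (f0 : forall x, (0 <= f x)%R).
Hypothesis meta : measurable_fun [set: T] eta.

Definition weighted (A : set T') : \bar R := \int[P]_(x in eta @^-1` A) (f x)%:E.

Lemma weighted_measure : exists m : {measure set T' -> \bar R},
  forall A, m A = weighted A.
Proof.
have w0 : weighted set0 = 0 by rewrite /weighted preimage_set0 integral_set0.
have wge0 A : 0 <= weighted A.
  by apply: integral_ge0 => x _; rewrite lee_fin.
have wsigma : semi_sigma_additive weighted.
  move=> F mF tF mUF; rewrite /weighted; apply: cvg_toP.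
    apply: ereal_nondecreasing_is_cvgn => m n mn.
    apply: lee_sum_nneg_natr => // k _ _.
    by apply: integral_ge0 => x _; rewrite lee_fin.
  rewrite preimage_bigcup ge0_integral_bigcup//=.
  - by move=> k; rewrite -[X in measurable X]setTI; apply: meta.
  - by apply: measurable_funTS; exact/measurable_EFinP.
  - by move=> x _; rewrite lee_fin.
  - apply/trivIsetP => i j _ _ ij; rewrite -preimage_setI.
    by move/trivIsetP : tF => /(_ i j Logic.I Logic.I ij) ->; rewrite preimage_set0.
pose w := weighted.
pose mw := isMeasure.Build _ T' R w w0 wge0 wsigma.
by exists (HB.pack w mw : {measure set T' -> \bar R}).
Qed.

End weighted_measure.

(** * Countably many test functions that determine measures *)

Section test_functions.
Context (R : realType) (Y : completeMetricType R) (y_ : nat -> Y).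
Implicit Types (t : nat * nat * nat) (s : seq (nat * nat * nat)).

(** For [t = (k, a, b)] with [a] positive, the gauge is positive exactly outside the closed ball of
    radius [b / a] around [y_ k]. Natural parameters keep the lists of such conditions countable, so
    that they can be enumerated by [unpickle]. *)
Definition gauge t (y : Y) : R := (t.1.2%:R * mdist (y_ t.1.1) y - t.2%:R)%R.

(** A continuous function below the indicator of the open set [far s]; multiplying all gauges by [M]
    makes it increase to that indicator. *)
Definition testf s (y : Y) : R :=
  (\prod_(t <- s) Num.min 1 (Num.max 0 (gauge t y)))%R.

Definition far s : set (borel Y) := [set y | all (fun t => (0 < gauge t y)%R) s].

Definition dilate (M : nat) s := [seq (t.1.1, M * t.1.2, M * t.2)%N | t <- s].

Lemma gauge_dilate M t y :
  gauge (t.1.1, M * t.1.2, M * t.2)%N y = (M%:R * gauge t y)%R.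
Proof. by rewrite /gauge/= !natrM mulrBr mulrA. Qed.

Lemma testf_ge0 s y : (0 <= testf s y)%R.
Proof. by apply: prodr_ge0 => t _; rewrite le_min ler01 le_max lexx. Qed.

Lemma testf_le1 s y : (testf s y <= 1)%R.
Proof.
rewrite /testf; elim: s => [|t s IH]; first by rewrite big_nil.
rewrite big_cons mulr_ile1//; last by rewrite ge_min lexx.
- by rewrite le_min ler01 le_max lexx.
- exact: testf_ge0.
Qed.

Lemma gauge_continuous t : continuous (gauge t).
Proof.
move=> y; apply: cvgB; last exact: cvg_cst.
by apply: cvgM; [exact: cvg_cst|exact: mdist_continuous].
Qed.

Lemma testf_continuous s : continuous (testf s).
Proof.
rewrite /testf; elim: s => [|t s IH] y.
  by under eq_fun do rewrite big_nil; exact: cvg_cst.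
under eq_fun do rewrite big_cons.
apply: cvgM; last exact: IH.
apply: (@continuous_min R Y (fun=> 1%R) (fun x => Num.max 0 (gauge t x))%R y).
  exact: cvg_cst.
apply: (@continuous_max R Y (fun=> 0%R) (gauge t) y); first exact: cvg_cst.
exact: gauge_continuous.
Qed.

Lemma measurable_testf s : measurable_fun [set: borel Y] (testf s : borel Y -> R).
Proof. by apply: continuous_borel_measurable; exact: testf_continuous. Qed.

Lemma far_measurable s : measurable (far s).
Proof.
elim: s => [|t s IH]; first by rewrite (_ : far [::] = setT)//; apply/seteqP.
rewrite (_ : far (t :: s) = (gauge t : borel Y -> R) @^-1` [set` `]0%R, +oo[] `&` far s).
  apply: measurableI => //; rewrite -[X in measurable X]setTI.
  apply: continuous_borel_measurable => //; exact: gauge_continuous.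
by apply/seteqP; split=> y /=; rewrite in_itv/= andbT => /andP.
Qed.

Lemma farI s s' : far s `&` far s' = far (s ++ s').
Proof. by apply/seteqP; split=> y /=; rewrite /far/= all_cat => /andP. Qed.

Lemma testf_dilate_ndecr s y m n : (m <= n)%N ->
  (testf (dilate m s) y <= testf (dilate n s) y)%R.
Proof.
move=> mn; rewrite /testf !big_map; apply: ler_prod => t _.
rewrite !gauge_dilate le_min ler01 le_max lexx/=.
rewrite le_min !ge_min lexx/=; have [g0|g0] := leP 0%R (gauge t y).
  rewrite orbC ge_max; apply/orP; left.
  rewrite !le_max lexx/=; apply/orP; right.
  by rewrite ler_wpM2r// ler_nat.
apply/orP; right; rewrite ge_max !le_max lexx/=; apply/orP; left.
by rewrite mulr_ge0_le0// ltW.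
Qed.

Lemma testf_dilate_cvg s y :
  testf (dilate M s) y @[M --> \oo] --> (\1_(far s) y : R).
Proof.
rewrite indicE; have [yf|yf] := boolP (y \in far s); last first.
  apply: cvg_near_cst; near=> M.
  have /allPn[t ts] : ~~ all (fun t => (0 < gauge t y)%R) s.
    by apply/negP => h; move/negP: yf; apply; rewrite inE.
  rewrite -leNgt => gt0; rewrite /testf big_map.
  apply/eqP; rewrite prodf_seq_eq0; apply/hasP; exists t => //=.
  by rewrite gauge_dilate max_l ?mulr_ge0_le0// min_r.
apply: cvg_near_cst; move: yf; rewrite inE /far/=.
elim: s => [_|t s IH /andP[gt0 /IH]]; first by near=> M; rewrite /testf big_nil.
apply: filterS2 (nbhs_infty_ger (gauge t y)^-1).
move=> M; rewrite /testf/= big_cons => Mg ->.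
rewrite gauge_dilate mulr1 min_l// le_max; apply/orP; right.
by rewrite -ler_pdivrMr// div1r.
Unshelve. all: by end_near. Qed.

Hypothesis y_dense : dense_seq y_.

(** The complement of [far [:: (k, N.+1, 1)]] is the closed ball of radius [rad N] around [y_ k],
    and an open set is the union of the countably many sets of this kind that it contains. *)
Lemma far_generates : @measurable _ (borel Y) = <<s range far >>.
Proof.
apply/seteqP; split; last first.
  apply: smallest_sub; first exact: sigma_algebra_measurable.
  by move=> _ [s _ <-]; exact: far_measurable.
apply: smallest_sub; first exact: smallest_sigma_algebra.
move=> V oV; have -> : V = \bigcup_k \bigcup_a
   [set y | (~` far [:: (k, a, 1%N)]) y /\ ~` far [:: (k, a, 1%N)] `<=` V].
  apply/seteqP; split=> [y Vy|y [k _ [a _ [/[swap]]]]]; last exact.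
  have := open_nbhs_nbhs (conj oV Vy).
  rewrite -(@filter_from_ballE R Y) => -[r /= r0 rV].
  have r20 : (0 < r / 2)%R by lra.
  have [N /(_ N (leqnn _)) Nr] := rad_small r20.
  have [k ky] := y_dense y (rad_gt0 R N).
  have farE x : (~` far [:: (k, N.+1, 1%N)]) x = (mdist (y_ k) x <= rad N)%R.
    rewrite /far/= /gauge/= andbT; apply/propext; split.
      by move/negP; rewrite -leNgt subr_le0 /rad -div1r ler_pdivlMr// mulrC.
    move=> h; apply/negP; rewrite -leNgt subr_le0.
    by rewrite mulrC -ler_pdivlMr// div1r.
  exists k => //; exists N.+1 => //; split; first by have := farE y => /= ->; rewrite ltW.
  move=> x; rewrite farE => kx; apply: rV; rewrite ballEmdist/=.
  have := metric_triangle y (y_ k) x; rewrite (metric_sym y (y_ k)) => *; lra.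
pose GT := g_sigma_algebraType (range far).
apply: (@bigcupT_measurable _ GT) => k; apply: (@bigcupT_measurable _ GT) => a.
have [h|h] := pselect (~` far [:: (k, a, 1%N)] `<=` V); last first.
  rewrite (_ : [set _ | _] = set0); first exact: (@measurable0 _ GT).
  by apply/seteqP; split=> // y [].
rewrite (_ : [set _ | _] = ~` far [:: (k, a, 1%N)]).
  by apply: (@measurableC _ GT); apply: sub_sigma_algebra; exists [:: (k, a, 1%N)].
by apply/seteqP; split=> y // [].
Qed.

(** The sets [far s] form a pi-system, concatenation of lists being intersection, and the empty list
    gives the whole space. *)
Lemma far_measure_unique (m1 m2 : {measure set (borel Y) -> \bar R}) :
  m1 setT < +oo -> (forall s, m1 (far s) = m2 (far s)) ->
  forall A, measurable A -> m1 A = m2 A.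
Proof.
move=> m1oo m12; have farT : far [::] = setT by apply/seteqP; split.
apply: (measure_unique (range far) (fun=> setT)) => //.
- exact: far_generates.
- by move=> _ _ [s _ <-] [s' _ <-]; exists (s ++ s') => //; rewrite farI.
- by move=> _; exists [::].
- exact: bigcup_const.
- by move=> _ [s _ <-].
Qed.

End test_functions.

Section testf_determines.
Context (R : realType).
Context (Y : completeMetricType R) (y_ : nat -> Y) (y_dense : dense_seq y_).

Lemma integral_testf_dilate d (T : measurableType d) (P : probability T R) (f : T -> R)
    (eta : T -> borel Y) s :
  measurable_fun setT f -> (forall x, (0 <= f x)%R) -> measurable_fun setT eta ->
  \int[P]_x (f x * testf y_ (dilate M s) (eta x))%:E @[M --> \oo] -->
  weighted P f eta (far y_ s).
Proof.
move=> mf f0 meta; rewrite /weighted integral_mkcond.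
have mt M : measurable_fun setT (fun x => testf y_ (dilate M s) (eta x)).
  by apply: measurableT_comp meta; exact: measurable_testf.
rewrite (_ : _ \_ _ = fun x => limn (fun M => (f x * testf y_ (dilate M s) (eta x))%:E)).
  apply: cvg_monotone_convergence => //.
  - by move=> n; apply/measurable_EFinP; exact: measurable_funM.
  - by move=> n x _; rewrite lee_fin mulr_ge0// testf_ge0.
  - move=> x _ m n mn; rewrite lee_fin ler_wpM2l//.
    exact: testf_dilate_ndecr.
apply/funext => x; apply/esym/cvg_lim => //.
rewrite (_ : (_ \_ _) x = (f x * \1_(far y_ s) (eta x))%:E).
  apply: cvg_EFin; first exact: nearW.
  by apply: cvgM; [exact: cvg_cst|exact: testf_dilate_cvg].
rewrite patchE indicE; have -> : (x \in eta @^-1` far y_ s) = (eta x \in far y_ s).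
  by apply/idP/idP; rewrite !inE.
by case: ifPn => _; rewrite ?mulr1 ?mulr0.
Qed.

(* Test functions determine the image under [eta] of the measure with density
   [f]; taking for [f] an indicator or another test function gives joint laws. *)
Lemma testf_weighted_unique d d' (T : measurableType d)
    (T' : measurableType d') (P : probability T R) (f : T -> R)
    (eta : T -> borel Y) (P' : probability T' R) (f' : T' -> R)
    (eta' : T' -> borel Y) :
  measurable_fun setT f -> (forall x, (0 <= f x <= 1)%R) -> measurable_fun setT eta ->
  measurable_fun setT f' -> (forall x, (0 <= f' x)%R) -> measurable_fun setT eta' ->
  (forall s, \int[P]_x (f x * testf y_ s (eta x))%:E =
             \int[P']_x (f' x * testf y_ s (eta' x))%:E) ->
  forall A, measurable A -> weighted P f eta A = weighted P' f' eta' A.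
Proof.
move=> mf f01 meta mf' f'0 meta' ff'.
have f0 x : (0 <= f x)%R by have /andP[] := f01 x.
have [m mE] := weighted_measure P mf f0 meta.
have [m' m'E] := weighted_measure P' mf' f'0 meta'.
move=> A mA; rewrite -mE -m'E; apply: (far_measure_unique y_dense) => //.
  rewrite mE /weighted preimage_setT.
  apply: (@le_lt_trans _ _ (\int[P]_x cst 1 x)).
    apply: ge0_le_integral => //.
    - by move=> x _; rewrite lee_fin.
    - exact/measurable_EFinP.
    - by move=> x _; rewrite lee_fin; have /andP[] := f01 x.
  by rewrite integral_cst// mul1e (le_lt_trans (probability_le1 P measurableT))// ltry.
move=> s; rewrite mE m'E.
have h := integral_testf_dilate (P := P) (s := s) mf f0 meta.
have h' := integral_testf_dilate (P := P') (s := s) mf' f'0 meta'.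
apply: (cvg_unique _ h) => //; rewrite (_ : (fun M => _) = fun M =>
  \int[P']_x (f' x * testf y_ (dilate M s) (eta' x))%:E)//.
by apply/funext => M; exact: ff'.
Qed.

End testf_determines.

(** * Randomized limits of laws with a fixed marginal *)

Section dominated_content.
Context d (B : measurableType d) (R : realType).
Variables (rho : probability B R) (l : set B -> R) (p : B -> R).
Hypotheses (mp : measurable_fun [set: B] p) (p01 : forall b, (0 <= p b <= 1)%R).
Hypothesis l0 : forall F, (0 <= l F)%R.
Hypothesis lp : forall F, measurable F -> (l F)%:E <= \int[rho]_(b in F) (p b)%:E.
Hypothesis lU : forall F G, measurable F -> measurable G -> F `&` G = set0 ->
  l (F `|` G) = (l F + l G)%R.

Let p0 b : (0 <= p b)%R. Proof. by have /andP[] := p01 b. Qed.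

Let l_set0 : l set0 = 0%R.
Proof.
have := lU measurable0 measurable0 (setI0 _); rewrite setU0 => h; lra.
Qed.

Let l_bigsetU (F : (set B)^nat) n : (forall i, measurable (F i)) ->
  trivIset setT F -> l (\big[setU/set0]_(i < n) F i) = (\sum_(0 <= i < n) l (F i))%R.
Proof.
move=> mF tF; elim: n => [|n IH]; first by rewrite big_ord0 big_nil.
rewrite big_ord_recr/= lU//; last 2 first.
- exact: bigsetU_measurable.
- by apply: (@trivIset_bigsetUI _ predT) => //; exact: sub_trivIset tF.
by rewrite IH big_nat_recr.
Qed.

Let l_le (F G : set B) : measurable F -> measurable G -> F `<=` G ->
  l G = (l F + l (G `\` F))%R.
Proof.
move=> mF mG FG; rewrite -lU//; last 2 first.
- exact: measurableD.
- by rewrite setDIK.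
by rewrite setDUK.
Qed.

Let w_fin (m : {measure set B -> \bar R}) : (forall A, m A = weighted rho p id A) ->
  forall A, measurable A -> m A \is a fin_num.
Proof.
move=> mE A mA; rewrite ge0_fin_numE// mE.
apply: (@le_lt_trans _ _ (\int[rho]_(x in A) cst 1 x)).
  apply: ge0_le_integral => //.
  - by move=> x _; rewrite lee_fin.
  - by apply: measurable_funTS; exact/measurable_EFinP.
  - by move=> x _; rewrite lee_fin; have /andP[] := p01 x.
by rewrite integral_cst// mul1e (le_lt_trans (probability_le1 rho mA))// ltry.
Qed.

(* The tails of [l] are controlled by those of the measure with density [p],
   so [l] is countably additive. *)
Let content_sigma_additive : semi_sigma_additive (EFin \o l).
Proof.
have [m mE] := weighted_measure rho mp p0 (@measurable_id _ B setT).
have mfin := w_fin mE.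
move=> F mF tF mUF; set U := \bigcup_n F n.
pose S n := (\sum_(0 <= i < n) l (F i))%R.
rewrite (_ : (fun n => _) = EFin \o S); last first.
  by apply/funext => n; rewrite /= sumEFin.
have mS n : measurable (\big[setU/set0]_(i < n) F i) by exact: bigsetU_measurable.
have sub n : \big[setU/set0]_(i < n) F i `<=` U.
  by rewrite -bigcup_mkord => b [i _ Fb]; exists i.
apply: cvg_EFin; first exact: nearW.
pose W n := fine (\sum_(0 <= i < n) m (F i)).
have WE n : W n = fine (m (\big[setU/set0]_(i < n) F i)).
  by rewrite /W big_mkord -measure_bigsetU.
apply: (@squeeze_cvgr _ _ _ _ (fun n => (l U - (fine (m U) - W n)))%R (fun=> l U)).
- apply: nearW => n; rewrite /= /S -l_bigsetU// (l_le (mS n) mUF)//.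
  set G := _ `\` _; rewrite lerDl l0 andbT.
  have mG : measurable G by exact: measurableD.
  have : (l G <= fine (m G))%R by rewrite -lee_fin fineK ?mfin// mE; exact: lp.
  suff : fine (m U) = (W n + fine (m G))%R by move=> -> *; lra.
  rewrite WE -fineD ?mfin// -measureU//; last by rewrite setDIK.
  by rewrite setDUK.
- rewrite -[X in _ --> X]subr0; apply: cvgB; first exact: cvg_cst.
  rewrite -[X in _ --> X](subrr (fine (m U))); apply: cvgB; first exact: cvg_cst.
  apply: fine_cvg; rewrite fineK ?mfin//.
  exact: measure_semi_sigma_additive.
- exact: cvg_cst.
Qed.

(** Radon-Nikodym for a set function only assumed finitely additive. The derivative is below [p]
    almost everywhere; its minimum with [p] is taken so that the bound holds at every [b] and a
    weight can later be split exactly between two subcells. *)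
Lemma dominated_content_density : exists q : B -> R,
  [/\ measurable_fun [set: B] q, forall b, (0 <= q b <= p b)%R
    & forall F, measurable F -> (l F)%:E = \int[rho]_(b in F) (q b)%:E].
Proof.
pose lE : set B -> \bar R := EFin \o l.
have lE0 : lE set0 = 0 by rewrite /lE/= l_set0.
have lEge0 A : 0 <= lE A by rewrite lee_fin.
have lEfin : fin_num_fun lE by [].
pose m1 := isMeasure.Build _ B R lE lE0 lEge0 content_sigma_additive.
pose mm : {measure set B -> \bar R} := HB.pack lE m1.
have mmfin : fin_num_fun mm by [].
pose m2 := Measure_isFinite.Build _ B R mm mmfin.
pose m : {finite_measure set B -> \bar R} := HB.pack lE m1 m2.
have mabs : m `<< rho.
  apply/null_content_dominatesP => A mA rA0; apply/eqP; rewrite eq_le lEge0 andbT.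
  rewrite /= /lE/= (le_trans (lp mA))// null_set_integral//.
  by apply: measurable_funTS; exact/measurable_EFinP.
have [f [f0 ffin fi fE]] := radon_nikodym_sigma_finite mabs.
have mf : measurable_fun setT f by exact: measurable_int fi.
have mff : measurable_fun setT (fine \o f) by exact: measurableT_comp.
pose q b := Num.min (fine (f b)) (p b).
have mq : measurable_fun setT q by exact: measurable_minr.
have q0 b : (0 <= q b)%R by rewrite le_min fine_ge0//=.
exists q; split => //.
  by move=> b; rewrite q0/= ge_min lexx orbT.
have mEq : measurable_fun setT (EFin \o q) by exact/measurable_EFinP.
have mEp : measurable_fun setT (EFin \o p) by exact/measurable_EFinP.
have qf b : (q b)%:E <= f b by rewrite -[f b]fineK// lee_fin ge_min lexx.
pose N := [set b | (p b < fine (f b))%R].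
have mN : measurable N by rewrite -[X in measurable X]setTI; exact: measurable_fun_ltr.
move=> F mF; rewrite (_ : (l F)%:E = m F)// fE//.
have FE : F = (F `&` N) `|` (F `\` N) by rewrite setUIDK.
have mFN := measurableI _ _ mF mN; have mFD := measurableD mF mN.
have dFN : [disjoint F `&` N & F `\` N].
  by apply/disj_setPS => b [[_ Nb] [_ /(_ Nb)]].
rewrite FE !ge0_integral_setU//; last 3 first.
- exact: measurable_funTS.
- by move=> b _; rewrite lee_fin.
- exact: measurable_funTS.
congr (_ + _); last first.
  apply: eq_integral => b; rewrite inE => -[_ /negP]; rewrite -leNgt => fp.
  by rewrite /q min_l// fineK.
(* On [N] the minimum equals [p], and the domination of [l] bounds the integral of the derivative
   over the part of [F] in [N] by that of [p]. *)
apply/eqP; rewrite eq_le; apply/andP; split; last first.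
  apply: ge0_le_integral => //.
  - by move=> b _; rewrite lee_fin.
  - exact: measurable_funTS.
  - exact: measurable_funTS.
rewrite -fE//= /lE/= (le_trans (lp mFN))//.
rewrite le_eqVlt; apply/orP; left; apply/eqP.
apply: eq_integral => b; rewrite inE => -[_ Nb].
by rewrite /q min_r// ltW.
Qed.

End dominated_content.

(** * Sampling a sequence of events from one uniform noise *)

Fixpoint word (f : nat -> bool) n : seq bool :=
  if n is n'.+1 then f n' :: word f n' else [::].

Lemma size_word f n : size (word f n) = n.
Proof. by elim: n => //= n ->. Qed.

Lemma nth_word f n j : (j < n)%N -> nth false (rev (word f n)) j = f j.
Proof.
elim: n => //= n IH; rewrite rev_cons nth_rcons size_rev size_word ltnS leq_eqVlt.
by case/predU1P => [->|jn]; rewrite ?ltnn ?eqxx// jn IH.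
Qed.

Definition words L := [seq val t | t <- enum {: L.-tuple bool}].

Lemma words_uniq L : uniq (words L).
Proof. by rewrite map_inj_uniq ?enum_uniq//; exact: val_inj. Qed.

Lemma mem_words f L : word f L \in words L.
Proof.
apply/mapP; have sw : size (word f L) == L by rewrite size_word.
by exists (Tuple sw); rewrite ?mem_enum.
Qed.

Lemma size_words L s : s \in words L -> size s = L.
Proof. by move=> /mapP[t _ ->]; rewrite size_tuple. Qed.

(** Finite additivity is all that is asked of [l], since the lemma is applied both to a probability
    and to [lam]. Measurability of the union is part of the conclusion because [W] itself is not
    assumed measurable. *)
Lemma additive_partition d (T : measurableType d) (R : realType) (I : eqType)
    (l : set T -> R) (W : T -> I) (A : I -> set T) (ws : seq I) :
  l set0 = 0%R ->
  (forall F G, measurable F -> measurable G -> F `&` G = set0 ->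
     l (F `|` G) = (l F + l G)%R) ->
  (forall i, i \in ws -> measurable [set x | W x = i /\ A i x]) -> uniq ws ->
  measurable [set x | W x \in ws /\ A (W x) x] /\
  l [set x | W x \in ws /\ A (W x) x] =
    (\sum_(i <- ws) l [set x | W x = i /\ A i x])%R.
Proof.
move=> l0 lU; elim: ws => [|i ws IH] mA /=.
  rewrite (_ : [set x | _] = set0) ?big_nil//.
  by apply/seteqP; split=> // x [].
move=> /andP[iws uws].
have [mI IHI] := IH (fun j jws => mA j (ltac:(by rewrite inE jws orbT))) uws.
have mi := mA i (mem_head _ _).
have -> : [set x | W x \in i :: ws /\ A (W x) x] =
    [set x | W x = i /\ A i x] `|` [set x | W x \in ws /\ A (W x) x].
  apply/seteqP; split=> x /=; last first.
    move=> [[Wx Ax]|[Wx Ax]]; first by rewrite Wx mem_head.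
    by rewrite inE Wx orbT.
  by rewrite inE => -[/predU1P[Wx|Wx] Ax]; [left; rewrite -Wx|right].
split; first exact: measurableU.
rewrite big_cons -IHI lU//; apply/seteqP; split=> // x [[Wi _] [+ _]].
by rewrite Wi (negbTE iws).
Qed.

Section random_bits.
Context d d' (B : measurableType d) (Y : measurableType d') (R : realType).
Context dW (W : measurableType dW) (Q : probability W R) (r : W -> R).
Hypothesis r_uniform : uniform_variable Q r.
Variables (rho : probability B R) (lam : set (B * Y) -> R) (E : nat -> set Y).
Hypothesis mE : forall j, measurable (E j).
Hypothesis lam_ge0 : forall A, (0 <= lam A)%R.
Hypothesis lamU : forall F G, measurable F -> measurable G -> F `&` G = set0 ->
  lam (F `|` G) = (lam F + lam G)%R.
Hypothesis lam_marginal : forall F, measurable F -> (lam (F `*` setT))%:E = rho F.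

Let ebit (y : Y) j := `[< E j y >].

Let cell s : set Y := [set y | word (ebit y) (size s) = s].

Let cell_true s : cell (true :: s) = cell s `&` E (size s).
Proof.
apply/seteqP; split=> y; rewrite /cell/= /ebit.
  by move=> [/asboolP Ey ->].
by move=> [-> Ey]; congr cons; exact/asboolP.
Qed.

Let cell_false s : cell (false :: s) = cell s `\` E (size s).
Proof.
apply/seteqP; split=> y; rewrite /cell/= /ebit.
  by move=> [/asboolPn Ey ->].
by move=> [-> Ey]; congr cons; exact/asboolPn.
Qed.

Let measurable_cell s : measurable (cell s).
Proof.
elim: s => [|[] s IH]; last 2 first.
- by rewrite cell_true; exact: measurableI.
- by rewrite cell_false; exact: measurableD.
by rewrite (_ : cell [::] = setT)//; apply/seteqP.
Qed.

Let density s (q : B -> R) := [/\ measurable_fun setT q, forall b, (0 <= q b <= 1)%R &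
  forall F, measurable F -> (lam (F `*` cell s))%:E = \int[rho]_(b in F) (q b)%:E].

Let lam_cell s F : measurable F -> lam (F `*` cell s) =
  (lam (F `*` cell (true :: s)) + lam (F `*` cell (false :: s)))%R.
Proof.
move=> mF; rewrite -lamU; last 3 first.
- by apply: measurableX => //; exact: measurable_cell.
- by apply: measurableX => //; exact: measurable_cell.
- rewrite -setXI cell_true cell_false (_ : cell s `&` _ `&` _ = set0) ?setX0//.
  by apply/seteqP; split=> // y [[_ Ey] [_ /(_ Ey)]].
congr lam; rewrite cell_true cell_false.
by apply/seteqP; split=> -[b y] /=; have := EM (E (size s) y); tauto.
Qed.

(** [dominated_content_density] is applied to the half of the cell inside the next event. Its
    density stays below [q] everywhere, so the difference is a nonnegative density for the other
    half. *)
Let density_split s q : density s q -> exists q', [/\ density (true :: s) q',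
  forall b, (q' b <= q b)%R & density (false :: s) (q \- q')%R].
Proof.
move=> [mq q01 lq].
have [|||q' [mq' q'q lq']] := @dominated_content_density _ _ _ rho
    (fun F => lam (F `*` cell (true :: s))) q mq q01.
- by [].
- by move=> F mF; rewrite -lq// lee_fin (lam_cell s mF) lerDl.
- move=> F G mF mG FG; rewrite -lamU//.
  + by congr lam; apply/seteqP; split=> -[b y] /=; tauto.
  + by apply: measurableX => //; exact: measurable_cell.
  + by apply: measurableX => //; exact: measurable_cell.
  + by rewrite -setXI FG set0X.
have q'1 b : (0 <= q' b <= 1)%R.
  by have /andP[q0 q1] := q01 b; have /andP[-> h] := q'q b; rewrite (le_trans h).
exists q'; split => //; first by move=> b; have /andP[] := q'q b.
split; first exact: measurable_funB.
  move=> b; have /andP[q0 q1] := q01 b; have /andP[q'0 h] := q'q b.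
  by apply/andP; split => /=; lra.
move=> F mF.
suff h : (lam (F `*` cell (false :: s)))%:E + (lam (F `*` cell (true :: s)))%:E =
    \int[rho]_(b in F) ((q \- q') b)%:E + (lam (F `*` cell (true :: s)))%:E.
  by move/(congr1 (fun e => e - (lam (F `*` cell (true :: s)))%:E)) : h; rewrite !addeK.
rewrite -EFinD addrC -lam_cell// lq// lq'// -ge0_integralD//.
- by apply: eq_integral => b _; rewrite -EFinD/=; congr EFin; lra.
- by move=> b _; rewrite lee_fin subr_ge0; have /andP[] := q'q b.
- by apply: measurable_funTS; apply/measurable_EFinP; exact: measurable_funB.
- by move=> b _; rewrite lee_fin; have /andP[] := q'1 b.
- by apply: measurable_funTS; exact/measurable_EFinP.
Qed.

(* Conditional weights given [b] of the cells cut out of [Y] by the events [E];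
   words are reversed, the latest bit coming first. *)
Let exists_weights : exists p : seq bool -> B -> R,
  [/\ p [::] = cst 1%R, forall s, density s (p s),
      forall s b, (p (true :: s) b <= p s b)%R
    & forall s b, p (false :: s) b = (p s b - p (true :: s) b)%R].
Proof.
pose good s q q' := [/\ density (true :: s) q',
  forall b, (q' b <= q b)%R & density (false :: s) (q \- q')%R].
(* The default [q] is never reached along the recursion, since every density can be split. *)
pose next s q := xget q [set q' | good s q q'].
pose fix p s : B -> R := match s with
  | [::] => cst 1%R
  | true :: s' => next s' (p s')
  | false :: s' => (p s' \- next s' (p s'))%R end.
have good_next s q : density s q -> good s q (next s q).
  by move=> /density_split[q' gq']; apply: (@xgetPex _ q [set q' | good s q q']); exists q'.
have dens s : density s (p s).
  elim: s => [|c s IH]; last by have [h1 _ h2] := good_next _ _ IH; case: c.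
  split=> //=.
    by move=> b; rewrite ler01 lexx.
  move=> F mF; have -> : \int[rho]_(b in F) (p [::] b)%:E = rho F.
    by rewrite /= integral_cst// mul1e.
  rewrite -lam_marginal//; congr (lam _)%:E.
  by congr (_ `*` _); apply/seteqP.
exists p; split => // s b.
by have [_ + _] := good_next _ _ (dens s); exact.
Qed.

(** Inverse transform sampling along the binary tree of cells: given [b], a word gets an interval of
    length its conditional weight, nested in that of the shorter word, and the bits tell in which
    interval [r w] falls. A set [D] depending on [b] and on the first [L] bits expresses the joint
    law of [b] with finitely many bits. *)
Lemma random_bits : exists bit : nat -> B * W -> bool,
  (forall j, measurable [set x | bit j x]) /\
  forall L (D : (nat -> bool) -> set B),
    (forall f g, (forall j, (j < L)%N -> f j = g j) -> D f = D g) ->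
    (forall f, measurable (D f)) ->
    [/\ measurable [set x | D (bit ^~ x) x.1],
        measurable [set x | D (fun j => `[< E j x.2 >]) x.1]
      & (rho \x Q) [set x | D (bit ^~ x) x.1] =
        (lam [set x | D (fun j => `[< E j x.2 >]) x.1])%:E].
Proof.
have [mr r01 Qr] := r_uniform.
have [p [p_nil dp p_le p_false]] := exists_weights.
have mp s : measurable_fun setT (p s) by have [] := dp s.
have p01 s b : (0 <= p s b <= 1)%R by have [_ + _] := dp s; exact.
have p0 s b : (0 <= p s b)%R by have /andP[] := p01 s b.
(* Left endpoint of the interval of a word: the [true] child takes the left part, the [false] child
   what remains. *)
pose fix low (s : seq bool) (b : B) {struct s} : R := match s with
  | [::] => 0%R
  | true :: s' => low s' b
  | false :: s' => (low s' b + p (true :: s') b)%R end.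
have mlow s : measurable_fun setT (low s).
  by elim: s => [|[] s IH] //=; exact: measurable_funD.
have low0 s b : (0 <= low s b)%R by elim: s => [|[] s IH] //=; rewrite addr_ge0.
have low1 s b : (low s b + p s b <= 1)%R.
  elim: s => [|[] s IH] /=; first by rewrite p_nil add0r.
    by rewrite (le_trans _ IH)// lerD2l.
  rewrite p_false; lra.
pose fix rword (n : nat) (x : B * W) {struct n} : seq bool := if n is n'.+1 then
  (r x.2 < low (rword n' x) x.1 + p (true :: rword n' x) x.1)%R :: rword n' x else [::].
pose bit j x := (r x.2 < low (rword j x) x.1 + p (true :: rword j x) x.1)%R.
have rwordE n x : rword n x = word (bit ^~ x) n by elim: n => //= n <-.
(* Decoding inverts the encoding: the intervals of the words of a given length partition [[0, 1[],
   the empty word having all of it. *)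
have rwordP s b w :
    (rword (size s) (b, w) = s) <-> (low s b <= r w < low s b + p s b)%R.
  have /andP[u0 u1] := r01 w; split.
    elim: s => [_ /=|c s IH /= []]; first by rewrite p_nil add0r u0.
    move=> + rs; rewrite rs => cE; have /andP[lu up] := IH rs.
    rewrite -cE; case: ltP => [ul|ul]; first by rewrite lu.
    by rewrite ul p_false/=; lra.
  elim: s => //= c s IH /andP[h1 h2].
  suff -> : rword (size s) (b, w) = s.
    congr cons; case: c h1 h2 => h1 h2; first exact: h2.
    by apply/negbTE; rewrite -leNgt.
  have := p0 (true :: s) b; have := p_le s b => *.
  by apply: IH; case: c h1 h2; rewrite ?p_false => *; apply/andP; split; lra.
have mbitc s : measurable [set x : B * W |
    (r x.2 < low s x.1 + p (true :: s) x.1)%R].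
  rewrite -[X in measurable X]setTI; apply: measurable_fun_ltr => //.
    exact: measurableT_comp mr measurable_snd.
  apply: measurable_funD; first exact: measurableT_comp (mlow s) measurable_fst.
  exact: measurableT_comp (mp _) measurable_fst.
have mrword n s : measurable [set x | rword n x = s].
  elim: n s => [|n IH] [|c s] /=.
  - by rewrite (_ : [set _ | _] = setT)//; apply/seteqP.
  - by rewrite (_ : [set _ | _] = set0)//; apply/seteqP; split.
  - by rewrite (_ : [set _ | _] = set0)//; apply/seteqP; split.
  rewrite (_ : [set _ | _] = [set x | rword n x = s] `&`
      (if c then [set x : B * W | (r x.2 < low s x.1 + p (true :: s) x.1)%R] else
       ~` [set x : B * W | (r x.2 < low s x.1 + p (true :: s) x.1)%R])).
    by apply: measurableI => //; case: c => //; exact: measurableC.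
  apply/seteqP; split=> x /=.
    by move=> [cE xs]; rewrite xs in cE; split=> //; rewrite -cE; case: ifPn => [|/negP].
  move=> [xs]; rewrite xs; case: c => [->//|/negP].
  by rewrite -leNgt => h; congr cons; apply/negbTE; rewrite -leNgt.
have bitE j : [set x | bit j x] = [set x | exists2 s, s \in words j &
    rword j x = s /\ (r x.2 < low s x.1 + p (true :: s) x.1)%R].
  apply/seteqP; split=> x /=; last by move=> [s _ [xs]]; rewrite /bit xs.
  by move=> bx; exists (rword j x) => //; rewrite rwordE mem_words.
have mbit j : measurable [set x | bit j x].
  have -> : [set x | bit j x] = [set x | word (bit ^~ x) j.+1 \in
      [seq true :: s | s <- words j] /\ True].
    apply/seteqP; split=> x /=.
      move=> bx; split => //; apply/mapP; exists (word (bit ^~ x) j).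
        exact: mem_words.
      by rewrite bx.
    by move=> [/mapP[s _ [->]]].
  (* The zero set function is additive, so the lemma yields the measurability of a finite union of
     pieces. *)
  pose Rl : set (B * W) -> R := fun=> 0%R.
  have [] := @additive_partition _ _ R _ Rl (fun x => word (bit ^~ x) j.+1)
    (fun=> setT) [seq true :: s | s <- words j] (erefl _).
  - by move=> *; rewrite /Rl addr0.
  - move=> s _; rewrite (_ : [set _ | _] = [set x | rword j.+1 x = s]) //.
    by apply/seteqP; split=> x /=; rewrite -rwordE; tauto.
  - by rewrite map_inj_uniq ?words_uniq// => ? ? [].
  - by [].
exists bit; split => // L D Ddep mD.
pose fn s j := nth false (rev s) j.
have Dfn f : D f = D (fn (word f L)).
  by apply: Ddep => j jL; rewrite /fn nth_word.
pose mu : probability (B * W)%type R := rho \x Q.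
pose P A := fine (mu A).
have fP A : measurable A -> mu A \is a fin_num.
  by move=> mA; rewrite ge0_fin_numE// (le_lt_trans (probability_le1 _ mA))// ltry.
(* Over [b] in [F] the section is an interval of length [p s b], whose integral over [F] is the mass
   of the cell by the definition of [density]. *)
have mur s F : measurable F ->
    mu [set x | rword (size s) x = s /\ F x.1] = (lam (F `*` cell s))%:E.
  move=> mF; have [_ _ ->//] := dp s.
  rewrite [RHS]integral_mkcond /mu/= /product_measure1.
  apply: eq_integral => b _; rewrite patchE; case: ifPn => bF; last first.
    rewrite /= (_ : xsection _ _ = set0) ?measure0//; apply/seteqP; split=> // u.
    by rewrite /xsection/= inE/= => -[_ Fb]; move/negP: bF; rewrite inE.
  rewrite /= (_ : xsection _ _ = [set w | (low s b <= r w < low s b + p s b)%R]).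
    by rewrite Qr// ?lerDl// addrC addKr.
  rewrite inE in bF; apply/seteqP; split=> w /=; rewrite /xsection/= inE/=.
    by move=> [/rwordP].
  by move=> h; split=> //; exact/rwordP.
have P0 : P set0 = 0%R by rewrite /P measure0.
have PU F G : measurable F -> measurable G -> F `&` G = set0 ->
    P (F `|` G) = (P F + P G)%R.
  by move=> mF mG FG; rewrite /P measureU// fineD// fP.
have lam0 : lam set0 = 0%R.
  by have := lamU measurable0 measurable0 (setI0 _); rewrite setU0 => h; lra.
have mP s : s \in words L -> measurable [set x | rword L x = s /\ D (fn s) x.1].
  move=> sL; rewrite -(size_words sL) (_ : [set _ | _] =
      [set x | rword (size s) x = s] `&` (D (fn s) `*` setT)).
    by apply: measurableI => //; exact: measurableX.
  by apply/seteqP; split=> x /= [-> h]; split=> //; case: h.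
have lamE s : s \in words L ->
    [set x | word (ebit x.2) L = s /\ D (fn s) x.1] = D (fn s) `*` cell s.
  move=> sL; rewrite /cell (size_words sL).
  by apply/seteqP; split=> x /= [].
have ml s : s \in words L ->
    measurable [set x | word (ebit x.2) L = s /\ D (fn s) x.1].
  by move=> sL; rewrite lamE//; apply: measurableX => //; exact: measurable_cell.
have [m1 E1] := additive_partition (A := fun s => [set x | D (fn s) x.1])
  P0 PU mP (words_uniq L).
have [m2 E2] := additive_partition (A := fun s => [set x | D (fn s) x.1])
  lam0 lamU ml (words_uniq L).
have -> : [set x | D (bit ^~ x) x.1] =
    [set x | rword L x \in words L /\ D (fn (rword L x)) x.1].
  apply/seteqP; split=> x /=; rewrite rwordE -Dfn; last by case.
  by rewrite mem_words.
have -> : [set x | D (fun j => `[< E j x.2 >]) x.1] =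
    [set x | word (ebit x.2) L \in words L /\ D (fn (word (ebit x.2) L)) x.1].
  apply/seteqP; split=> x /=; rewrite -Dfn; last by case.
  by rewrite mem_words.
split => //; rewrite -[LHS]fineK ?fP// -[fine _]/(P _) E1 E2; congr EFin.
apply: eq_big_seq => s sL; rewrite lamE// /P -{1}(size_words sL).
by rewrite (mur s (D (fn s))).
Qed.

End random_bits.

Lemma measure_bigcup_le d (T : measurableType d) (R : realType)
    (mu : {measure set T -> \bar R}) (F : (set T)^nat) v :
  (forall n, measurable (F n)) -> nondecreasing_seq F ->
  (forall n, mu (F n) <= v) -> mu (\bigcup_n F n) <= v.
Proof.
move=> mF ndF Fv; have h : mu \o F @ \oo --> mu (\bigcup_n F n).
  by apply: nondecreasing_cvg_mu => //; exact: bigcupT_measurable.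
rewrite -(cvg_lim _ h)//; apply: lime_le; first exact: cvgP h.
exact: nearW.
Qed.

Section limit_variable.
Context d (B : measurableType d) dW (W : measurableType dW) (R : realType).
Context (Y : completeMetricType R) (y_ : nat -> Y) (y_dense : dense_seq y_).
Variables (Q : probability W R) (r : W -> R) (r_uniform : uniform_variable Q r).
Variables (rho : probability B R) (lam : set (B * borel Y) -> R).
Hypothesis lam_ge0 : forall A, (0 <= lam A)%R.
Hypothesis lamU : forall F G, measurable F -> measurable G -> F `&` G = set0 ->
  lam (F `|` G) = (lam F + lam G)%R.
Hypothesis lam_marginal : forall F, measurable F -> (lam (F `*` setT))%:E = rho F.
Hypothesis lam_tight : forall n (e : R), (0 < e)%R -> exists N, (1 - e <=
  lam [set x | exists2 k, (k < N)%N & (mdist (y_ k) x.2 < rad n)%R])%R.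

Let lam0 : lam set0 = 0%R.
Proof. by have := lamU measurable0 measurable0 (setI0 _); rewrite setU0 => h; lra. Qed.

Let lam_le F G : measurable F -> measurable G -> F `<=` G -> (lam F <= lam G)%R.
Proof.
move=> mF mG FG; rewrite -(setDUK FG) lamU ?lerDl//; first exact: measurableD.
by rewrite setDIK.
Qed.

Let mu : probability (B * W)%type R := rho \x Q.

(* [bit n k] plays the role of the event "the limit variable is within [rad n]
   of [y_ k]". *)
Let ball_bits : exists bit : nat -> nat -> B * W -> bool,
  [/\ forall n k, measurable [set p | bit n k p],
      forall n N (G : nat -> set B), (forall k, measurable (G k)) ->
        mu [set p | exists2 k, (k < N)%N & bit n k p /\ G k p.1] =
        (lam [set x | exists2 k, (k < N)%N &
                        (mdist (y_ k) x.2 < rad n)%R /\ G k x.1])%:E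
    & forall n k m l, (rad n + rad m < mdist (y_ k) (y_ l))%R ->
        mu [set p | bit n k p /\ bit m l p] = 0].
Proof.
pose E j : set (borel Y) :=
  if unpickle j is Some (n, k) then [set y | (mdist (y_ k) y < rad n)%R] else set0.
have E_pickle n k : E (pickle (n, k)) = [set y | (mdist (y_ k) y < rad n)%R].
  by rewrite /E pickleK.
have mE j : measurable (E j).
  rewrite /E; case: unpickle => [[n k]|//]; rewrite -ballEmdist.
  by apply: open_borel_measurable; exact: open_mball.
have [bit [mbit bitP]] := @random_bits _ _ _ _ R _ _ _ _ r_uniform rho lam E mE lam_ge0 lamU
  lam_marginal.
exists (fun n k => bit (pickle (n, k))); split.
- by move=> n k; exact: mbit.
- move=> n N G mG; pose L := (\max_(k < N) pickle (n, nat_of_ord k)).+1.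
  pose D (f : nat -> bool) := [set b | exists2 k, (k < N)%N & f (pickle (n, k)) /\ G k b].
  have [f g fg|f|_ _] := bitP L D.
  + apply/seteqP; split=> b [k kN [fk Gk]]; exists k => //; split => //.
      by rewrite -fg// /L ltnS (leq_bigmax (Ordinal kN)).
    by rewrite fg// /L ltnS (leq_bigmax (Ordinal kN)).
  + rewrite (_ : D f = \bigcup_(k in [set k | (k < N)%N /\ f (pickle (n, k))]) G k).
      by apply: bigcup_measurable => k _.
    by apply/seteqP; split=> b [k]; [move=> kN [fk Gk]|move=> [kN fk] Gk]; exists k.
  + rewrite /D/= => ->; congr (lam _)%:E.
    apply/seteqP; split=> x [k kN [xk Gk]]; exists k => //; split => //.
      by move: xk => /asboolP; rewrite E_pickle.
    by apply/asboolP; rewrite E_pickle.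
- move=> n k m l nm.
  pose L := (maxn (pickle (n, k)) (pickle (m, l))).+1.
  pose D (f : nat -> bool) : set B := [set b | f (pickle (n, k)) /\ f (pickle (m, l))].
  have [f g fg|f|_ _] := bitP L D.
  + by rewrite /D !fg// /L ltnS ?leq_maxl ?leq_maxr.
  + have [h|h] := pselect (f (pickle (n, k)) /\ f (pickle (m, l))).
      by rewrite (_ : D f = setT)//; apply/seteqP; split.
    by rewrite (_ : D f = set0)//; apply/seteqP; split.
  + rewrite /D/= => ->; rewrite (_ : [set _ | _] = set0) ?lam0//.
    apply/seteqP; split=> // x [/asboolP + /asboolP]; rewrite !E_pickle/= => nk ml.
    have := metric_triangle (y_ k) x.2 (y_ l).
    by rewrite (metric_sym x.2) => h; move: nm; rewrite ltNge => /negP; apply; lra.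
Qed.

(** Almost surely some ball is selected at every scale, by tightness, and no two selected balls are
    far apart. The selected centres then form a Cauchy sequence, and [xi] is its limit. Only
    finitely many bits are controlled at a time, so strict superlevel sets are compared, and in one
    direction. *)
Lemma limit_variable : exists xi : B * W -> borel Y,
  measurable_fun [set: B * W] xi /\
  forall h, caratheodory h -> forall t : R,
    (rho \x Q) [set p | (t < h (p.1, xi p))%R] <= (lam [set x | (t < h x)%R])%:E.
Proof.
have [bit [mbit bitP bit_far]] := ball_bits.
pose near_bits p (y : Y) := forall n k, bit n k p -> (mdist (y_ k) y <= rad n)%R.
pose good : set (B * W) := [set p | (forall n, exists k, bit n k p) /\
  (forall n k m l, bit n k p -> bit m l p -> (mdist (y_ k) (y_ l) <= rad n + rad m)%R)].
have goodE : good = (\bigcap_n \bigcup_k [set p | bit n k p]) `&`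
    \bigcap_n \bigcap_k \bigcap_m \bigcap_l [set p | bit n k p ->
      bit m l p -> (mdist (y_ k) (y_ l) <= rad n + rad m)%R].
  apply/seteqP; split=> [p [g1 g2]|p [g1 g2]].
    split=> n _; first by have [k nk] := g1 n; exists k.
    by move=> k _ m _ l _; exact: g2.
  split=> [n|n k m l]; first by have [k _ nk] := g1 n Logic.I; exists k.
  exact: (g2 n Logic.I k Logic.I m Logic.I l Logic.I).
have mgood : measurable good.
  rewrite goodE; apply: measurableI.
    by apply: bigcapT_measurable => n; exact: bigcupT_measurable.
  apply: bigcapT_measurable => n; apply: bigcapT_measurable => k.
  apply: bigcapT_measurable => m; apply: bigcapT_measurable => l.
  case: (lerP (mdist (y_ k) (y_ l)) (rad n + rad m)) => h.
    by rewrite (_ : [set _ | _] = setT)//; apply/seteqP; split.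
  rewrite (_ : [set _ | _] = ~` ([set p | bit n k p] `&` [set p | bit m l p])).
    by apply: measurableC; exact: measurableI.
  apply/seteqP; split=> p /=.
    by move=> h' [h1 h2]; have := h' h1 h2.
  by move=> h' h1 h2; exfalso; apply: h'.
have ae_good : {ae mu, forall p, good p}.
  have ae1 : {ae mu, forall p, forall n, exists k, bit n k p}.
    apply: ae_foralln => n.
    pose A := \bigcup_k [set p | bit n k p].
    have mA : measurable A by exact: bigcupT_measurable.
    exists (~` A); split; first exact: measurableC.
      rewrite [LHS](_ : _ = 1 - mu A); last exact: (probability_setC mu mA).
      suff -> : mu A = 1 by rewrite subee.
      apply/eqP; rewrite eq_le; apply/andP; split; first exact: probability_le1.
      (* A finitely additive [lam] could lose mass along the infinite union of balls; tightness
         bounds the loss by [e] using finitely many of them. *)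
      apply/lee_addgt0Pr => e e0; have [N] := lam_tight n e0.
      rewrite lerBlDr -lee_fin => /le_trans; apply.
      rewrite EFinD leeD2r//.
      have := bitP n N (fun=> setT) (fun=> measurableT).
      rewrite (_ : [set x | exists2 k, _ & (_ < _)%R /\ _] =
        [set x | exists2 k, (k < N)%N & (mdist (y_ k) x.2 < rad n)%R]); last first.
        by apply/seteqP; split=> x [k kN]; [move=> [? _]|move=> ?]; exists k.
      move=> <-; apply: le_measure.
      - rewrite inE (_ : [set p | _] = \bigcup_(k in `I_N) [set p | bit n k p]).
          by apply: bigcup_measurable => k _.
        by apply/seteqP; split=> p [k kN]; [move=> [? _]|move=> ?]; exists k.
      - by rewrite inE.
      - by move=> p [k _ [nk _]]; exists k.
    by move=> p /= h [k _ nk]; apply: h; exists k.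
  have ae2 : {ae mu, forall p, forall n k m l, bit n k p -> bit m l p ->
      (mdist (y_ k) (y_ l) <= rad n + rad m)%R}.
    apply: ae_foralln => n; apply: ae_foralln => k.
    apply: ae_foralln => m; apply: ae_foralln => l.
    case: (lerP (mdist (y_ k) (y_ l)) (rad n + rad m)) => h.
      exact: aeW.
    exists ([set p | bit n k p] `&` [set p | bit m l p]); split.
    - exact: measurableI.
    - exact: bit_far.
    - by move=> p /= /not_implyP[h1 /not_implyP[h2 _]].
  by move: ae1 ae2; apply: filterS2 => p.
have near_bits_ex p : good p -> exists y, near_bits p y.
  move=> [g1 g2].
  have [k nk] := boolp.choice g1.
  have : cvg (y_ (k n) @[n --> \oo]).
    apply: cauchy_cvg; apply: cauchy_exP => e e0.
    have e20 : (0 < e / 2)%R by lra.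
    have [N hN] := rad_small e20.
    exists (y_ (k N)), N => // n /= Nn; rewrite ballEmdist/=.
    have h1 := hN N (leqnn N); have h2 := hN n Nn.
    have h3 := g2 _ _ _ _ (nk N) (nk n); lra.
  move/cvg_ex => [y /metricType_numDomainType.cvgrPdist_lt yk].
  exists y => m l ml; apply/ler_addgt0Pr => e e0.
  have e20 : (0 < e / 2)%R by lra.
  have [M _ hM] := yk _ e20; have [N hN] := rad_small e20.
  pose n := maxn M N.
  have h1 : (mdist y (y_ (k n)) < e / 2)%R by exact: (hM n (leq_maxl _ _)).
  have h2 : (rad n < e / 2)%R by apply: hN; exact: leq_maxr.
  have := g2 _ _ _ _ ml (nk n); have := metric_triangle (y_ l) (y_ (k n)) y.
  by rewrite (metric_sym (y_ (k n)) y) => *; lra.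
pose xi p : borel Y := if `[< good p >] then xget point (near_bits p) else point.
have xiP p : good p -> near_bits p (xi p).
  move=> gp; rewrite /xi asboolT//.
  exact: xgetPex (near_bits_ex p gp).
have mxi : measurable_fun setT xi.
  apply: measurable_fun_borel => V oV.
  (* On [good], the point [xi p] lies in the open set [V] exactly when some selected ball with its
     radius doubled fits in [V], a countable condition on the bits. *)
  pose fits n k := `[< forall y : Y, (mdist (y_ k) y < rad n *+ 2)%R -> V y >].
  have -> : xi @^-1` V =
      (good `&` \bigcup_n \bigcup_k [set p | bit n k p /\ fits n k]) `|`
      (~` good `&` [set p | V point]).
    apply/seteqP; split=> p /=; have [gp|gp] := pselect (good p).
    - move=> Vp; left; split=> //.
      have := open_nbhs_nbhs (conj oV Vp).
      rewrite -(@filter_from_ballE R Y) => -[e /= e0 eV].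
      have e40 : (0 < e / 4)%R by lra.
      have [N /(_ N (leqnn N)) hN] := rad_small e40.
      have [k Nk] := gp.1 N; exists N => //; exists k => //; split => //.
      apply/asboolP => y yk; apply: eV; rewrite ballEmdist/=.
      have := xiP p gp N k Nk; have := metric_triangle (xi p : Y) (y_ k) y.
      by rewrite (metric_sym (xi p : Y) (y_ k)) => *; rewrite mulr2n in yk; lra.
    - by rewrite /xi asboolF// => Vp; right.
    - move=> [[_ [n _ [k _ [nk /asboolP]]]]|[//]]; apply.
      have := xiP p gp n k nk; have := rad_gt0 R n.
      by rewrite mulr2n => *; lra.
    - by rewrite /xi asboolF// => -[[]|[]].
  apply: measurableU; last first.
    apply: measurableI; first exact: measurableC.
    have [Vp|Vp] := pselect (V point).
      by rewrite (_ : [set _ | _] = setT)//; apply/seteqP; split.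
    by rewrite (_ : [set _ | _] = set0)//; apply/seteqP; split.
  apply: measurableI => //; apply: bigcupT_measurable => n; apply: bigcupT_measurable => k.
  case: (fits n k); last first.
    by rewrite (_ : [set _ | _] = set0)//; apply/seteqP; split=> // p [].
  rewrite (_ : [set _ | _] = [set p | bit n k p])//.
  by apply/seteqP; split=> // p [].
exists xi; split=> // h ch t.
have mh : measurable [set x | (t < h x)%R].
  rewrite -[X in measurable X]setTI; apply: measurable_fun_ltr => //.
  exact: (caratheodory_measurable y_dense ch).
pose A n := \bigcup_k ([set p | bit n k p] `&` (ball_gt y_ h t n k `*` setT)).
have mA n : measurable (A n).
  apply: bigcupT_measurable => k; apply: measurableI => //.
  by apply: measurableX => //; exact: measurable_ball_gt.
(* The bits match [lam] on finitely many balls only. The union over all [k] is reached by monotone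
   continuity of [mu], which is countably additive, with a bound uniform in the number of balls. *)
have muA n : mu (A n) <= (lam [set x | (t < h x)%R])%:E.
  pose F N := [set p | exists2 k, (k < N)%N & bit n k p /\ ball_gt y_ h t n k p.1].
  have -> : A n = \bigcup_N F N.
    apply/seteqP; split=> p.
      by move=> [k _ [nk [bk _]]]; exists k.+1 => //; exists k.
    by move=> [N _ [k kN [nk bk]]]; exists k.
  apply: measure_bigcup_le => [N|M N MN|N].
  - rewrite (_ : F N = \bigcup_(k in `I_N) ([set p | bit n k p] `&`
        (ball_gt y_ h t n k `*` setT))).
      apply: bigcup_measurable => k _; apply: measurableI => //.
      by apply: measurableX => //; exact: measurable_ball_gt.
    by apply/seteqP; split=> p [k kN]; [move=> []|move=> [? [? _]]]; exists k.
  - apply/subsetPset => p [k kM ?]; exists k => //; exact: leq_trans kM MN.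
  - have mball k : measurable (ball_gt y_ h t n k) by exact: measurable_ball_gt.
    have muF := bitP n N (ball_gt y_ h t n) mball.
    rewrite [leLHS](_ : _ = mu (F N))// muF lee_fin; apply: lam_le => //.
      rewrite (_ : [set _ | _] = \bigcup_(k in `I_N)
          (ball_gt y_ h t n k `*` ball (y_ k) (rad n))).
        apply: bigcup_measurable => k _; apply: measurableX.
          exact: measurable_ball_gt.
        by apply: open_borel_measurable; exact: open_mball.
      apply/seteqP; split=> x [k kN].
        by move=> [xk bk]; exists k => //; split => //; rewrite ballEmdist.
      by move=> [bk]; rewrite ballEmdist => xk; exists k.
    by move=> [b y] [k kN /= [yk bk]]; exact: (ball_gtP y_dense ch bk yk).
(* If [h] exceeds [t] at [xi p], every fine enough scale detects it. So the superlevel set lies, up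
   to a null set, in the inferior limit of the [A n], whose measure is at most any common bound of
   theirs. *)
pose I N := \bigcap_(n in [set n | (N <= n)%N]) A n.
have mI N : measurable (I N) by apply: bigcap_measurable => //; exists N => /=.
have sub : [set p | (t < h (p.1, xi p))%R] `&` good `<=` \bigcup_N I N.
  move=> p [tp gp]; have [N hN] := near_ball_gt y_ ch tp.
  exists N => // n /= Nn; have [k nk] := gp.1 n.
  by exists k => //; split => //; split => //=; apply: hN => //; exact: xiP.
have [Z [mZ Z0 goodZ]] := ae_good.
have mUI : measurable (\bigcup_N I N) by exact: bigcupT_measurable.
have mS : measurable [set p | (t < h (p.1, xi p))%R].
  rewrite (_ : [set p | _] = (fun p => (p.1, xi p)) @^-1` [set x | (t < h x)%R])//.
  rewrite -[X in measurable X]setTI.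
  by apply: (measurable_fun_pair measurable_fst mxi).
apply: (@le_trans _ _ (mu ((\bigcup_N I N) `|` Z))).
  apply: le_measure; rewrite ?inE//; first exact: measurableU.
  move=> p tp; have [gp|gp] := pselect (good p); [left|right]; last exact: goodZ.
  exact: sub.
apply: (le_trans (measureU2 mu mUI mZ)); rewrite [X in _ + X]Z0 adde0.
apply: measure_bigcup_le => // [N M NM|N].
  by apply/subsetPset => p IN n /= Mn; apply: IN => /=; exact: leq_trans Mn.
by apply: le_trans (muA N); apply: le_measure; rewrite ?inE// => p; apply => /=.
Qed.

End limit_variable.

Lemma integral_probability_cst d (T : measurableType d) (R : realType)
    (P : probability T R) (a : R) : \int[P]_x a%:E = a%:E.
Proof.
rewrite (integral_cst P measurableT) [X in _ * X](_ : _ = 1) ?mule1//.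
exact: probability_setT.
Qed.

(** * Ultrafilter limits of laws and of their integrals *)

Section ultrafilter_limit.
Context (I : Type) (U : set_system I) {UU : UltraFilter U}.

Lemma fmap_ultra (T : Type) (f : I -> T) : UltraFilter (f @ U).
Proof.
split=> [|G GF fG]; first exact: fmap_proper_filter.
apply/seteqP; split=> // A GA; have [//|fA] := in_ultra_setVsetC (f @^-1` A) UU.
have : G (A `&` ~` A) by apply: filterI => //; exact: fG.
by rewrite setICr => /(@filter_not_empty _ G).
Qed.

(** Compactness of the unit interval gives limits along one ultrafilter for all measurable sets at
    once, with no extraction of subsequences. *)
Lemma ultra_bounded_cvg (R : realType) (u : I -> R) :
  (forall i, (0 <= u i <= 1)%R) -> cvg (u @ U).
Proof.
move=> u01; have := @segment_compact R 0 1; rewrite compact_ultra.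
move=> /(_ _ (fmap_ultra u)) [|l [_ ul]]; last exact: cvgP ul.
suff : U (u @^-1` `[0%R, 1%R]%classic) by [].
by apply: filterE => i /=; rewrite in_itv/=.
Qed.

End ultrafilter_limit.

(** A staircase below [x] with steps [e], capped at [M * e]. Its integral is a finite combination of
    measures of strict superlevel sets, which is how bounds on these sets pass to integrals. *)
Definition levels (R : realType) (e : R) (M : nat) (x : R) : R :=
  (\sum_(j < M) e * (j.+1%:R * e < x)%R%:R)%R.

Lemma levels_le (R : realType) (e x : R) M : (0 < e)%R -> (0 <= x)%R ->
  (levels e M x <= x)%R.
Proof.
move=> e0 x0; have : (levels e M x <= x)%R /\ (levels e M x <= M%:R * e)%R.
  elim: M => [|M [IH1 IH2]]; first by rewrite /levels big_ord0 mul0r.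
  have M1 : (M.+1%:R * e = M%:R * e + e)%R by rewrite -natr1 mulrDl mul1r.
  rewrite /levels big_ord_recr/= -/(levels e M x).
  by case: ltrP => h; rewrite ?mulr1 ?mulr0; split; lra.
by case.
Qed.

Lemma min_levels (R : realType) (e x : R) M : (0 < e)%R -> (0 <= x)%R ->
  (Num.min x (M%:R * e) <= levels e M x + e)%R.
Proof.
move=> e0 x0.
have : (levels e M x = M%:R * e)%R \/ (x <= levels e M x + e)%R.
  elim: M => [|M IH]; first by left; rewrite /levels big_ord0 mul0r.
  have M1 : (M.+1%:R * e = M%:R * e + e)%R by rewrite -natr1 mulrDl mul1r.
  rewrite /levels big_ord_recr/= -/(levels e M x).
  by case: ltrP IH => h [IH|IH]; rewrite ?mulr1 ?mulr0; (left; lra) || (right; lra).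
by case=> [->|h]; rewrite ge_min; apply/orP; [right; lra|left].
Qed.

Section levels_integral.
Context d (T : measurableType d) (R : realType) (P : probability T R).
Variables (f : T -> R) (mf : measurable_fun [set: T] f) (f0 : forall x, (0 <= f x)%R).

Let mlt t : measurable [set x | (t < f x)%R].
Proof. by rewrite -[X in measurable X]setTI; exact: measurable_fun_ltr. Qed.

Lemma measurable_levels e M : measurable_fun [set: T] (fun x => levels e M (f x)).
Proof.
rewrite /levels; apply: measurable_sum => j.
apply: measurable_funM => //.
rewrite (_ : (fun x => _) = \1_[set x | (j.+1%:R * e < f x)%R]).
  exact: measurable_indic.
apply/funext => x; rewrite indicE.
by rewrite (_ : (x \in _) = (j.+1%:R * e < f x)%R)//; apply/idP/idP; rewrite inE.
Qed.

Lemma integral_levels e M : (0 < e)%R -> \int[P]_x (levels e M (f x))%:E =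
  (\sum_(j < M) e * fine (P [set x | (j.+1%:R * e < f x)%R]))%R%:E.
Proof.
move=> e0; rewrite -sumEFin.
under eq_integral do rewrite /levels -sumEFin.
rewrite ge0_integral_sum//; last 2 first.
- move=> j; apply/measurable_EFinP; apply: measurable_funM => //.
  rewrite (_ : (fun x => _) = \1_[set x | (j.+1%:R * e < f x)%R]).
    exact: measurable_indic.
  apply/funext => x; rewrite indicE.
  by rewrite (_ : (x \in _) = (j.+1%:R * e < f x)%R)//; apply/idP/idP; rewrite inE.
- by move=> j x _; rewrite lee_fin mulr_ge0// ltW.
apply: eq_bigr => j _.
rewrite (_ : (fun x => _) = fun x => e%:E * (\1_[set x | (j.+1%:R * e < f x)%R] x)%:E).
  rewrite ge0_integralZl//; last by rewrite lee_fin ltW.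
    by rewrite integral_indic// setIT EFinM fineK// fin_num_measure.
  by apply/measurable_EFinP; exact: measurable_indic.
apply/funext => x; rewrite -EFinM indicE.
by rewrite (_ : (x \in _) = (j.+1%:R * e < f x)%R)//; apply/idP/idP; rewrite inE.
Qed.

Lemma integral_le_levels (l : R) :
  (forall e M, (0 < e)%R ->
     (\sum_(j < M) e * fine (P [set x | (j.+1%:R * e < f x)%R]) <= l)%R) ->
  \int[P]_x (f x)%:E <= l%:E.
Proof.
move=> hl.
have mE (g : T -> R) :
    measurable_fun setT g -> measurable_fun setT (fun x => (g x)%:E).
  by move=> mg; apply/measurable_EFinP.
have mmin (n : nat) : measurable_fun setT (fun x => Num.min (f x) n.+1%:R).
  exact: measurable_minr.
have min0 (n : nat) x : (0 <= Num.min (f x) n.+1%:R)%R by rewrite le_min f0/=.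
have minl (n : nat) : \int[P]_x (Num.min (f x) n.+1%:R)%:E <= l%:E.
  apply/lee_addgt0Pr => e e0; have [m /(_ m (leqnn _)) me] := rad_small e0.
  have m0 := rad_gt0 R m.
  (* With step [rad m] and [n.+1 * m.+1] steps the cap is exactly [n.+1]. *)
  apply: (@le_trans _ _ (\int[P]_x (levels (rad m) (n.+1 * m.+1) (f x) + rad m)%:E)).
    apply: ge0_le_integral => //.
    - by move=> x _; rewrite lee_fin.
    - exact: mE.
    - by apply: mE; apply: measurable_funD => //; exact: measurable_levels.
    - move=> x _; rewrite lee_fin.
      have := min_levels (n.+1 * m.+1) m0 (f0 x).
      by rewrite natrM -mulrA /rad mulfV// mulr1.
  under eq_integral do rewrite EFinD.
  rewrite ge0_integralD//; last 3 first.
  - by move=> x _; rewrite lee_fin /levels sumr_ge0// => j _; rewrite mulr_ge0// ltW.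
  - by apply: mE; exact: measurable_levels.
  - by move=> x _; rewrite lee_fin ltW.
  rewrite integral_levels// integral_probability_cst -EFinD lee_fin.
  by rewrite lerD ?hl// ltW.
have : \int[P]_x (Num.min (f x) n.+1%:R)%:E @[n --> \oo] --> \int[P]_x (f x)%:E.
  rewrite (_ : (fun x => _) = fun x => limn (fun n => (Num.min (f x) n.+1%:R)%:E)).
    apply: cvg_monotone_convergence => //.
    - by move=> n; exact: mE.
    - by move=> n x _; rewrite lee_fin.
    - move=> x _ m n mn; rewrite lee_fin le_min ge_min lexx/= ge_min.
      by rewrite ler_nat ltnS mn orbT.
  apply/funext => x; apply/esym/cvg_lim => //.
  apply: cvg_near_cst; exists (Num.truncn (f x)) => // n /= fn.
  rewrite min_l// (le_trans (ltW (truncnS_gt _)))// ler_nat ltnS.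
  exact: fn.
move=> h; rewrite -(cvg_lim _ h)//; apply: lime_le; first exact: cvgP h.
exact: nearW.
Qed.

End levels_integral.

Section limit_law.
Context d (B : measurableType d) dW (W : measurableType dW) (R : realType).
Context (Y : completeMetricType R) (y_ : nat -> Y) (y_dense : dense_seq y_).
Variables (Q : probability W R) (r : W -> R) (r_uniform : uniform_variable Q r).
Context (I : Type) (U : set_system I) {UU : UltraFilter U}.
Variables (rho : probability B R) (pi : I -> probability (B * borel Y)%type R).
Hypothesis pi_marginal : forall i F, measurable F -> pi i (F `*` setT) = rho F.
Hypothesis pi_tight : forall n (e : R), (0 < e)%R -> exists N, \forall i \near U,
  (1 - e)%:E <=
  pi i [set x | exists2 k, (k < N)%N & (mdist (y_ k) x.2 < rad n)%R].

(** The maximum matters only outside the measurable sets, where the limit may fail to exist: [lam]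
    has to be nonnegative on all sets. *)
Let lam (A : set (B * borel Y)) : R :=
  Num.max 0%R (lim (fine (pi i A) @[i --> U])).

Let pi01 i A : measurable A -> (0 <= fine (pi i A) <= 1)%R.
Proof.
by move=> mA; rewrite fine_ge0//= -lee_fin fineK ?fin_num_measure//
  probability_le1.
Qed.

Let lam_cvg A : measurable A -> fine (pi i A) @[i --> U] --> lam A.
Proof.
move=> mA; have h : cvg (fine (pi i A) @[i --> U]).
  by apply: ultra_bounded_cvg => i; exact: pi01.
rewrite /lam max_r//; apply: limr_ge => //; apply: nearW => i.
by have /andP[] := pi01 i mA.
Qed.

(** Lower semicontinuity along [U]. The limit [lam] of the laws is realized by [limit_variable] with
    an inequality on superlevel sets, which the staircases turn into one on integrals. *)
Lemma limit_law : exists xi : B * W -> borel Y,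
  measurable_fun [set: B * W] xi /\
  forall h, caratheodory h -> (forall x, (0 <= h x)%R) -> forall l : R,
    (\forall i \near U, \int[pi i]_x (h x)%:E <= l%:E) ->
    \int[rho \x Q]_p (h (p.1, xi p))%:E <= l%:E.
Proof.
have lam_ge0 A : (0 <= lam A)%R by rewrite /lam le_max lexx.
have lamU F G : measurable F -> measurable G -> F `&` G = set0 ->
    lam (F `|` G) = (lam F + lam G)%R.
  move=> mF mG FG; have mFG := measurableU _ _ mF mG.
  apply: (cvg_unique _ (lam_cvg mFG)) => //.
  rewrite (_ : (fun i => _) = fun i => (fine (pi i F) + fine (pi i G))%R).
    by apply: cvgD; exact: lam_cvg.
  by apply/funext => i; rewrite measureU// fineD// fin_num_measure.
have lam_marginal F : measurable F -> (lam (F `*` setT))%:E = rho F.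
  move=> mF; have mFT : measurable (F `*` [set: borel Y]) by exact: measurableX.
  rewrite -[RHS]fineK ?fin_num_measure//; congr EFin.
  apply: (cvg_unique _ (lam_cvg mFT)) => //.
  rewrite (_ : (fun i => _) = fun=> fine (rho F)); first exact: cvg_cst.
  by apply/funext => i; congr fine; exact: pi_marginal.
have lam_tight n (e : R) : (0 < e)%R -> exists N, (1 - e <=
    lam [set x | exists2 k, (k < N)%N & (mdist (y_ k) x.2 < rad n)%R])%R.
  move=> e0; have [N hN] := pi_tight n e0; exists N.
  have mA : measurable
      [set x : B * borel Y | exists2 k, (k < N)%N & (mdist (y_ k) x.2 < rad n)%R].
    rewrite -[X in measurable X]setTI.
    exact: (measurable_snd measurableT _ (measurable_near_first y_ N (rad n))).
  apply: (cvgr_to_ge (lam_cvg mA)).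
  apply: filterS hN => i; rewrite -lee_fin fineK//.
  exact: fin_num_measure.
have [xi [mxi xiP]] := limit_variable y_dense r_uniform lam_ge0 lamU lam_marginal lam_tight.
exists xi; split => // h ch h0 l hl.
have mh := caratheodory_measurable y_dense ch.
have mpair : measurable_fun setT (fun p : B * W => (p.1, xi p)).
  exact: (measurable_fun_pair measurable_fst mxi).
apply: (integral_le_levels (f := fun p => h (p.1, xi p))) => //.
  exact: measurableT_comp mh mpair.
move=> e M e0.
have mlt t : measurable [set x | (t < h x)%R].
  by rewrite -[X in measurable X]setTI; exact: measurable_fun_ltr.
apply: (@le_trans _ _ (\sum_(j < M) e * lam [set x | (j.+1%:R * e < h x)%R])%R).
  apply: ler_sum => j _; rewrite ler_pM2l//.
  rewrite -lee_fin fineK; first exact: xiP.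
  apply: fin_num_measure; rewrite (_ : [set x | _] =
    (fun p => (p.1, xi p)) @^-1` [set x | (j.+1%:R * e < h x)%R])//.
  by rewrite -[X in measurable X]setTI; exact: mpair.
have cv : (\sum_(j < M) e * fine (pi i [set x | (j.+1%:R * e < h x)%R]))%R @[i --> U]
    --> (\sum_(j < M) e * lam [set x | (j.+1%:R * e < h x)%R])%R.
  elim: M => [|M IH].
    by under eq_fun do rewrite big_ord0; rewrite big_ord0; exact: cvg_cst.
  under eq_fun do rewrite big_ord_recr/=; rewrite big_ord_recr/=.
  by apply: cvgD IH _; apply: cvgM; [exact: cvg_cst|exact: lam_cvg].
apply: (cvgr_to_le cv); apply: filterS hl => i hl.
rewrite -lee_fin; apply: le_trans hl.
rewrite -integral_levels//; apply: ge0_le_integral => //.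
- by move=> x _; rewrite lee_fin /levels sumr_ge0// => j _; rewrite mulr_ge0// ltW.
- by apply/measurable_EFinP; exact: measurable_levels.
- exact/measurable_EFinP.
- by move=> x _; rewrite lee_fin levels_le.
Qed.

End limit_law.

Section limit_law_cvg.
Context d (B : measurableType d) dW (W : measurableType dW) (R : realType).
Context (Y : completeMetricType R) (y_ : nat -> Y) (y_dense : dense_seq y_).
Context (I : Type) (U : set_system I) {UU : UltraFilter U}.
Variables (Q : probability W R) (rho : probability B R).
Variables (pi : I -> probability (B * borel Y)%type R) (xi : B * W -> borel Y).
Hypothesis mxi : measurable_fun [set: B * W] xi.
Hypothesis xiP : forall h, caratheodory h -> (forall x, (0 <= h x)%R) -> forall l : R,
    (\forall i \near U, \int[pi i]_x (h x)%:E <= l%:E) ->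
    \int[rho \x Q]_p (h (p.1, xi p))%:E <= l%:E.

Lemma integral_unit_fin_num d' (T : measurableType d') (P : probability T R)
    (f : T -> R) : measurable_fun [set: T] f -> (forall x, (0 <= f x <= 1)%R) ->
  \int[P]_x (f x)%:E \is a fin_num.
Proof.
move=> mf f01; have f0 x : 0 <= (f x)%:E by rewrite lee_fin; have /andP[] := f01 x.
rewrite ge0_fin_numE; last exact: integral_ge0.
apply: (@le_lt_trans _ _ (\int[P]_x 1%:E)); last first.
  by rewrite integral_probability_cst ltry.
apply: ge0_le_integral => //; first exact/measurable_EFinP.
by move=> x _; rewrite lee_fin; have /andP[] := f01 x.
Qed.

Lemma integral_onem d' (T : measurableType d') (P : probability T R)
    (f : T -> R) : measurable_fun [set: T] f -> (forall x, (0 <= f x <= 1)%R) ->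
  \int[P]_x (1 - f x)%:E = (1 - fine (\int[P]_x (f x)%:E))%:E.
Proof.
move=> mf f01; have ffin := integral_unit_fin_num P mf f01.
suff : \int[P]_x (1 - f x)%:E + \int[P]_x (f x)%:E = 1.
  move/(congr1 (fun e => e - \int[P]_x (f x)%:E)); rewrite addeK// => ->.
  by rewrite EFinB fineK.
rewrite -ge0_integralD//.
- rewrite -[RHS](integral_probability_cst P); apply: eq_integral => x _.
  by rewrite -EFinD subrK.
- by move=> x _; rewrite lee_fin subr_ge0; have /andP[] := f01 x.
- by apply/measurable_EFinP; exact: measurable_funB.
- by move=> x _; rewrite lee_fin; have /andP[] := f01 x.
- exact/measurable_EFinP.
Qed.

Lemma caratheodory_onem (h : B * borel Y -> R) : caratheodory h ->
  caratheodory (fun x => 1 - h x)%R.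
Proof.
move=> [h1 h2]; split=> [y|b]; first by apply: measurable_funB.
by move=> y; apply: cvgB; [exact: cvg_cst|exact: h2].
Qed.

(** For [h] with values in [[0, 1]], lower semicontinuity applies to [h] and to [1 - h], and the two
    bounds together give convergence. *)
Lemma limit_law_cvg h : caratheodory h -> (forall x, (0 <= h x <= 1)%R) ->
  fine (\int[pi i]_x (h x)%:E) @[i --> U] -->
  fine (\int[rho \x Q]_p (h (p.1, xi p))%:E).
Proof.
have mpair : measurable_fun setT (fun p : B * W => (p.1, xi p)).
  exact: (measurable_fun_pair measurable_fst mxi).
have lower h' : caratheodory h' -> (forall x, (0 <= h' x <= 1)%R) -> forall e : R,
    (0 < e)%R -> \forall i \near U,
    (fine (\int[rho \x Q]_p (h' (p.1, xi p))%:E) - e <= fine (\int[pi i]_x (h' x)%:E))%R.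
  move=> ch h01 e e0; have mh := caratheodory_measurable y_dense ch.
  have mhxi : measurable_fun setT (fun p => h' (p.1, xi p)).
    exact: measurableT_comp mh mpair.
  set v := fine _; have vE : \int[rho \x Q]_p (h' (p.1, xi p))%:E = v%:E.
    by rewrite fineK//; exact: integral_unit_fin_num.
  (* Either the wanted inequality holds along [U], or its negation does; the latter would bound the
     limit integral by [v - e]. *)
  have [//|hU] := in_ultra_setVsetC
    [set i | (v - e <= fine (\int[pi i]_x (h' x)%:E))%R] UU.
  have : \int[rho \x Q]_p (h' (p.1, xi p))%:E <= (v - e)%:E.
    apply: xiP => //; first by move=> x; have /andP[] := h01 x.
    apply: filterS hU => i /= /negP; rewrite -ltNge => /ltW.
    by rewrite -lee_fin fineK//; exact: integral_unit_fin_num.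
  by rewrite vE lee_fin => ?; exfalso; lra.
move=> ch h01; have mh := caratheodory_measurable y_dense ch.
have mhxi : measurable_fun setT (fun p => h (p.1, xi p)).
  exact: measurableT_comp mh mpair.
apply/cvgrPdist_le => e e0.
have h'01 x : (0 <= 1 - h x <= 1)%R.
  by have /andP[? ?] := h01 x; apply/andP; split; lra.
have := lower _ (caratheodory_onem ch) h'01 _ e0; have := lower _ ch h01 _ e0.
apply: filterS2 => i /=; rewrite !integral_onem//= => h1 h2.
by rewrite ler_norml; apply/andP; split; lra.
Qed.

End limit_law_cvg.

Lemma rectangle_measure_unique d d' (T : measurableType d) (T' : measurableType d')
    (R : realType) (m1 m2 : {measure set (T * T') -> \bar R}) :
  m1 setT < +oo ->
  (forall A C, measurable A -> measurable C -> m1 (A `*` C) = m2 (A `*` C)) ->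
  forall A, measurable A -> m1 A = m2 A.
Proof.
move=> m1oo m12.
pose G : set (set (T * T')) := [set A `*` C | A in measurable & C in measurable].
apply: (measure_unique G (fun=> setT)) => //.
- by rewrite measurable_prod_measurableType.
- move=> _ _ [X1 mX1 [X2 mX2 <-]] [Y1 mY1 [Y2 mY2 <-]].
  exists (X1 `&` Y1); first exact: measurableI.
  by exists (X2 `&` Y2); [exact: measurableI|rewrite setXI].
- by move=> _; exists setT => //; exists setT => //; rewrite setXTT.
- exact: bigcup_const.
- by move=> _ [A mA [C mC <-]]; exact: m12.
Qed.

Section joint_law.
Context (R : realType) (Y : completeMetricType R) (y_ : nat -> Y).
Context (y_dense : dense_seq y_).

Lemma weighted_indic d dB (T : measurableType d) (B : measurableType dB)
    (P : probability T R) (b : T -> B) (eta : T -> borel Y) F A :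
  measurable_fun [set: T] b -> measurable_fun [set: T] eta ->
  measurable F -> measurable A ->
  weighted P (fun x => \1_F (b x)) eta A = P ((fun x => (b x, eta x)) @^-1` (F `*` A)).
Proof.
move=> mb meta mF mA; rewrite /weighted.
have mbF : measurable (b @^-1` F) by rewrite -[X in measurable X]setTI; exact: mb.
have mea : measurable (eta @^-1` A) by rewrite -[X in measurable X]setTI; exact: meta.
rewrite (_ : (fun x => _) = fun x => (\1_(b @^-1` F) x)%:E).
  by rewrite integral_indic// setIC.
by apply/funext => x; rewrite !indicE.
Qed.

Lemma joint_law_unique d d' dB (T : measurableType d) (T' : measurableType d')
    (B : measurableType dB) (P : probability T R) (P' : probability T' R)
    (b : T -> B) (b' : T' -> B) (eta : T -> borel Y) (eta' : T' -> borel Y) :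
  measurable_fun [set: T] b -> measurable_fun [set: T] eta ->
  measurable_fun [set: T'] b' -> measurable_fun [set: T'] eta' ->
  (forall F s, measurable F -> \int[P]_x (\1_F (b x) * testf y_ s (eta x))%:E =
                               \int[P']_x (\1_F (b' x) * testf y_ s (eta' x))%:E) ->
  forall A, measurable A -> P ((fun x => (b x, eta x)) @^-1` A) =
                            P' ((fun x => (b' x, eta' x)) @^-1` A).
Proof.
move=> mb meta mb' meta' PP' A mA.
have mp : measurable_fun setT (fun x => (b x, eta x)) by exact: measurable_fun_pair.
have mp' : measurable_fun setT (fun x => (b' x, eta' x)) by exact: measurable_fun_pair.
rewrite -(lawE P mp) -(lawE P' mp'); apply: rectangle_measure_unique => //.
  by rewrite -ge0_fin_numE// fin_num_measure.
move=> F C mF mC; transitivity (weighted P (fun x => \1_F (b x)) eta C).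
  by rewrite weighted_indic.
transitivity (weighted P' (fun x => \1_F (b' x)) eta' C); last first.
  by rewrite weighted_indic.
have mind d0 (T0 : measurableType d0) (c : T0 -> B) : measurable_fun setT c ->
    measurable_fun setT (fun x => \1_F (c x) : R).
  by move=> mc; apply: measurableT_comp mc; exact: measurable_indic.
apply: (testf_weighted_unique y_dense) => //.
- exact: mind.
- by move=> x; rewrite indicE; case: (_ \in _); rewrite lexx ler01.
- exact: mind.
- by move=> s; exact: PP'.
Qed.

(** The countably many sets [far s] determine a measure, so it is enough to unite their exceptional
    null sets. *)
Lemma ae_eq_kernel d (Z : measurableType d) (nu : probability Z R)
    (k k' : Z -> {measure set (borel Y) -> \bar R}) :
  (forall z, k z setT = 1) -> (forall z, k' z setT = 1) ->
  (forall A, measurable A -> measurable_fun [set: Z] (k ^~ A)) ->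
  (forall A, measurable A -> measurable_fun [set: Z] (k' ^~ A)) ->
  (forall A C, measurable A -> measurable C ->
     \int[nu]_(z in C) k z A = \int[nu]_(z in C) k' z A) ->
  {ae nu, forall z, forall A, measurable A -> k z A = k' z A}.
Proof.
move=> k1 k'1 mk mk' kk'.
have ae_far : {ae nu, forall z, forall n,
    k z (far y_ (odflt [::] (unpickle n))) = k' z (far y_ (odflt [::] (unpickle n)))}.
  apply: ae_foralln => n; set s := odflt _ _.
  have mf := @far_measurable _ _ y_ s.
  have : ae_eq nu setT (k ^~ (far y_ s)) (k' ^~ (far y_ s)).
    apply: integral_ae_eq => //.
    - apply/integrableP; split; first exact: mk.
      apply: (@le_lt_trans _ _ (\int[nu]_z 1%:E)); last first.
        by rewrite integral_probability_cst ltry.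
      apply: ge0_le_integral => //.
        by apply: measurableT_comp => //; exact: mk.
      move=> z _; rewrite gee0_abs// -(k1 z).
      by apply: le_measure; rewrite ?inE.
    - exact: mk'.
    - by move=> C _ mC; exact: kk'.
  by apply: filterS => z /(_ Logic.I).
apply: filterS ae_far => z hz A mA; apply: (far_measure_unique y_dense) => //.
  by rewrite [ltLHS]k1 ltry.
by move=> s; have := hz (pickle s); rewrite pickleK.
Qed.

End joint_law.

Section randomization.
Context d (B : measurableType d) dW (W : measurableType dW) (R : realType).
Context (Y : completeMetricType R) (y_ : nat -> Y) (y_dense : dense_seq y_).
Variables (Q : probability W R) (r : W -> R) (r_uniform : uniform_variable Q r).

Lemma probability_tight (P : probability (borel Y) R) n (e : R) : (0 < e)%R ->
  exists N, (1 - e)%:E <= P [set y | exists2 k, (k < N)%N & (mdist (y_ k) y < rad n)%R].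
Proof.
move=> e0; pose F N : set (borel Y) :=
  [set y | exists2 k, (k < N)%N & (mdist (y_ k) y < rad n)%R].
have mF N : measurable (F N) by exact: measurable_near_first.
have FT : \bigcup_N F N = setT.
  apply/seteqP; split=> // y _; have [k yk] := y_dense y (rad_gt0 R n).
  by exists k.+1 => //; exists k.
have : (P \o F) N @[N --> \oo] --> P (\bigcup_N F N).
  apply: nondecreasing_cvg_mu => //; first exact: bigcupT_measurable.
  by move=> M N MN; apply/subsetPset => y [k kM yk]; exists k => //; exact: leq_trans kM MN.
rewrite FT (_ : P setT = 1%:E); last exact: probability_setT.
move=> /fine_cvgP[_ /cvgrPdist_lt/(_ _ e0)[N _ /(_ N (leqnn N))]] /=.
rewrite ltr_norml => /andP[_ h]; exists N.
rewrite -[leRHS](_ : (fine (P (F N)))%:E = _); first by rewrite lee_fin; lra.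
exact/fineK/fin_num_measure.
Qed.

(** Noise outsourcing: the limit construction is applied to the constant family [pi]. Convergence of
    the integrals of test functions then becomes equality. *)
Lemma randomization (rho : probability B R) (pi : probability (B * borel Y)%type R) :
  (forall F, measurable F -> pi (F `*` setT) = rho F) ->
  exists xi : B * W -> borel Y, measurable_fun [set: B * W] xi /\
    forall A, measurable A -> pi A = (rho \x Q) ((fun p => (p.1, xi p)) @^-1` A).
Proof.
move=> pirho; have [U [UU _]] := @ultraFilterLemma nat \oo _.
have tight n (e : R) : (0 < e)%R -> exists N, \forall i \near U,
  (1 - e)%:E <= pi [set x | exists2 k, (k < N)%N & (mdist (y_ k) x.2 < rad n)%R].
  move=> e0; have [N hN] := probability_tight (law pi measurable_snd) n e0.
  by exists N; apply: nearW => i.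
have [xi [mxi xiP]] := limit_law y_dense r_uniform (UU := UU)
  (fun=> pirho) tight.
exists xi; split => //.
have mpair : measurable_fun setT (fun p : B * W => (p.1, xi p)).
  exact: (measurable_fun_pair measurable_fst mxi).
move=> A mA; rewrite -[A in LHS]preimage_id.
rewrite (_ : id = fun x : B * borel Y => (x.1, x.2)); last first.
  by apply/funext => -[].
apply: (joint_law_unique y_dense) => // F s mF.
pose h (x : B * borel Y) : R := (\1_F x.1 * testf y_ s x.2)%R.
have ch : caratheodory h.
  split=> [y|b]; first apply: measurable_funM.
  - exact: measurable_indic.
  - exact: (measurable_cst (testf y_ s y)).
  by move=> y; apply: cvgM; [exact: cvg_cst|exact: testf_continuous].
have h01 x : (0 <= h x <= 1)%R.
  rewrite /h indicE; case: (_ \in _); rewrite ?mul1r ?mul0r ?lexx ?ler01//.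
  by rewrite testf_ge0 testf_le1.
have mh := caratheodory_measurable y_dense ch.
rewrite -[LHS]fineK; last exact: (integral_unit_fin_num _ mh).
rewrite -[RHS]fineK; last first.
  by apply: (integral_unit_fin_num _ (measurableT_comp mh mpair)) => p; exact: h01.
congr EFin; apply: (@cvg_unique _ _ (fine (\int[pi]_x (h x)%:E) @[i --> U])) => //.
  exact: cvg_cst.
exact: (limit_law_cvg y_dense mxi xiP ch h01).
Qed.

End randomization.

(** * Integrals and disintegrations *)

(* No measurability is required, as the integral of a nonnegative function is
   the supremum of the integrals of the simple functions below it. *)
Lemma le_integral_pointwise d (T : measurableType d) (R : realType)
    (mu : set T -> \bar R) (f g : T -> \bar R) :
  (forall x, f x <= g x) -> \int[mu]_x f x <= \int[mu]_x g x.
Proof.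
move=> fg; rewrite /integral !patch_setT; apply: leeB.
  apply: le_ereal_sup => _ [h hf <-]; exists h => // x.
  by apply: le_trans (hf x) _; rewrite !funeposE; exact: le_max2.
apply: le_ereal_sup => _ [h hf <-]; exists h => // x.
by apply: le_trans (hf x) _; rewrite !funenegE; apply: le_max2 => //; rewrite leeN2.
Qed.

(** The integral of [f] may be infinite. Its negative part is bounded, hence has a finite integral,
    and subtraction is done only at the end. *)
Lemma integral_shift d (T : measurableType d) (R : realType) (P : probability T R)
    (f : T -> R) (m : R) : measurable_fun [set: T] f -> (forall x, (m <= f x)%R) ->
  \int[P]_x (f x)%:E = \int[P]_x (f x - m)%:E + m%:E.
Proof.
move=> mf fm; pose pos (a : R) : R := Num.max a 0%R.
have max_parts (a : R) : (a = pos a - pos (- a))%R.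
  have [a0|a0] := leP 0%R a; rewrite /pos.
    by rewrite (max_l a0) (@max_r _ _ (- a)%R 0%R) ?subr0// oppr_le0.
  by rewrite (max_r (ltW a0)) (@max_l _ _ (- a)%R 0%R) ?sub0r ?opprK// oppr_ge0 ltW.
pose fp x := pos (f x); pose fn x := pos (- f x)%R.
have mfp : measurable_fun setT fp by exact: measurable_maxr.
have mfn : measurable_fun setT fn.
  by apply: measurable_maxr => //; exact: measurableT_comp.
pose mp := pos m; pose mn := pos (- m)%R.
have fp0 x : (0 <= fp x)%R by rewrite le_max lexx orbT.
have fn0 x : (0 <= fn x)%R by rewrite le_max lexx orbT.
have mp0 : (0 <= mp)%R by rewrite le_max lexx orbT.
have mn0 : (0 <= mn)%R by rewrite le_max lexx orbT.
have fpn x : (f x = fp x - fn x)%R.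
  exact: max_parts.
have mpn : (m = mp - mn)%R.
  exact: max_parts.
have fnm x : (fn x <= mn)%R.
  by rewrite /fn /mn /pos ge_max !le_max lexx orbT andbT lerN2 fm.
have mE (g : T -> R) : measurable_fun setT g -> measurable_fun setT (fun x => (g x)%:E).
  by move=> ?; exact/measurable_EFinP.
have -> : \int[P]_x (f x)%:E = \int[P]_x (fp x)%:E - \int[P]_x (fn x)%:E.
  rewrite integralE; congr (_ - _).
  - by apply: eq_integral => x _; rewrite funeposE -EFin_max.
  - by apply: eq_integral => x _; rewrite funenegE -EFinN -EFin_max.
(* This integrates the pointwise identity between sums of nonnegative functions obtained by
   splitting [f] and [m] into positive and negative parts. *)
have key : \int[P]_x (f x - m)%:E + \int[P]_x (fn x)%:E + mp%:E =
    \int[P]_x (fp x)%:E + mn%:E.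
  rewrite -(integral_probability_cst P mp) -(integral_probability_cst P mn).
  have mfm : measurable_fun setT (fun x => (f x - m)%R) by exact: measurable_funB.
  have D2 (u v : T -> R) : measurable_fun setT u -> measurable_fun setT v ->
      (forall x, 0 <= u x)%R -> (forall x, 0 <= v x)%R ->
      \int[P]_x (u x)%:E + \int[P]_x (v x)%:E = \int[P]_x (u x + v x)%:E.
    move=> mu mv u0 v0; rewrite -ge0_integralD//; try exact: mE.
    - by move=> x _; rewrite lee_fin.
    - by move=> x _; rewrite lee_fin.
  have fm0 x : (0 <= f x - m)%R by rewrite subr_ge0.
  rewrite !D2//; last 2 first.
  - exact: measurable_funD.
  - by move=> x; rewrite addr_ge0.
  apply: eq_integral => x _; congr EFin.
  by have := fpn x; lra.
have fnfin : \int[P]_x (fn x)%:E \is a fin_num.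
  rewrite ge0_fin_numE; last by apply: integral_ge0 => x _; rewrite lee_fin.
  apply: (@le_lt_trans _ _ (\int[P]_x mn%:E)).
    by apply: le_integral_pointwise => x; rewrite lee_fin.
  by rewrite integral_probability_cst ltry.
move: key fnfin; case: (\int[P]_x (fn x)%:E) => // b key _.
move: key; case: (\int[P]_x (f x - m)%:E) => [a| |];
  case: (\int[P]_x (fp x)%:E) => [e| |] //=.
by rewrite -!EFinD => -[h]; congr EFin; lra.
Qed.

Section pker_probability.
Context d d' (Z : measurableType d) (X : measurableType d') (R : realType).
Variable k : R.-pker Z ~> X.

Definition pker_probability (z : Z) : set X -> \bar R := k z.

HB.instance Definition _ z := Measure.on (pker_probability z).

Lemma pker_probability_setT z : pker_probability z setT = 1.
Proof. exact: prob_kernel. Qed.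

HB.instance Definition _ z :=
  Measure_isProbability.Build _ _ _ (pker_probability z) (pker_probability_setT z).

End pker_probability.

Section disintegration_integral.
Context (R : realType) (X Z : completeMetricType R).
Context (x_ : nat -> X) (x_dense : dense_seq x_).
Context dW (W : measurableType dW) (Q : probability W R) (r : W -> R).
Hypothesis r_uniform : uniform_variable Q r.
Variables (rho : probability (borel X * borel Z)%type R).
Variables (nu : probability (borel Z) R) (k : R.-pker (borel Z) ~> (borel X)).
Hypothesis hrho : disintegration rho nu k.

Lemma measurable_kernel_integral (f : borel X * borel Z -> \bar R) :
  measurable_fun setT f -> (forall p, 0 <= f p) ->
  measurable_fun [set: borel Z] (fun z => \int[k z]_x f (x, z)).
Proof.
move=> mf f0.
apply: (measurable_fun_integral_finite_kernel (fun p => f (p.2, p.1)) k) => //.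
by apply: measurableT_comp mf _; exact: measurable_fun_pair measurable_snd measurable_fst.
Qed.

(* Sampling [x = xi (z, w)] reduces the formula to Tonelli's theorem. *)
Lemma disintegration_integral (f : borel X * borel Z -> \bar R) :
  measurable_fun setT f -> (forall p, 0 <= f p) ->
  \int[rho]_p f p = \int[nu]_z \int[k z]_x f (x, z).
Proof.
move=> mf f0.
have mswap : measurable_fun setT (fun p : borel X * borel Z => (p.2, p.1)).
  exact: measurable_fun_pair measurable_snd measurable_fst.
have marg F : measurable F -> law rho mswap (F `*` setT) = nu F.
  move=> mF; rewrite -hrho.1//; congr (rho _).
  by apply/seteqP; split=> p /= => [[]|].
have [xi [mxi xiP]] := randomization x_dense r_uniform marg.
have msec z : measurable_fun setT (fun w => xi (z, w)).
  by apply: measurableT_comp mxi _; exact: pair1_measurable.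
have kE : {ae nu, forall z, forall A, measurable A -> k z A = law Q (msec z) A}.
  apply: (ae_eq_kernel x_dense).
  - by move=> z; exact: prob_kernel.
  - by move=> z; exact: probability_setT.
  - by move=> A mA; exact: measurable_kernel.
  - move=> A mA; rewrite (_ : (fun z => _) = Q \o xsection (xi @^-1` A)).
      apply: measurable_fun_xsection; rewrite -[X in measurable X]setTI.
      exact: mxi.
    apply/funext => z /=; rewrite lawE; congr (Q _).
    by apply/seteqP; split=> w; rewrite /xsection/= inE.
  - move=> A C mA mC; rewrite -hrho.2//.
    transitivity (law rho mswap (C `*` A)).
      by congr (rho _); apply/seteqP; split=> p /= [].
    rewrite xiP; last exact: measurableX.
    rewrite [RHS]integral_mkcond /=/product_measure1; apply: eq_integral => z _.
    rewrite patchE; case: ifPn => zC /=.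
      congr (Q _); apply/seteqP; split=> w; rewrite /xsection/= inE/=; first by case.
      by rewrite inE in zC.
    rewrite (_ : xsection _ _ = set0) ?measure0//; apply/seteqP; split=> // w.
    by rewrite /xsection/= inE/= => -[zC' _]; move/negP: zC; rewrite inE.
have mxi2 : measurable_fun setT (fun p : borel Z * W => (xi p, p.1)).
  exact: measurable_fun_pair mxi measurable_fst.
have mfxi : measurable_fun setT (fun p : borel Z * W => f (xi p, p.1)).
  exact: measurableT_comp mf mxi2.
transitivity (\int[nu \x Q]_p f (xi p, p.1)).
  have mxi1 : measurable_fun setT (fun p : borel Z * W => (p.1, xi p)).
    exact: measurable_fun_pair measurable_fst mxi.
  transitivity (\int[law rho mswap]_p f (p.2, p.1)).
    rewrite integral_law//=; first by apply: eq_integral => -[].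
    by apply: measurableT_comp mf _; exact: measurable_fun_pair measurable_snd measurable_fst.
  transitivity (\int[law (nu \x Q) mxi1]_p f (p.2, p.1)).
    by apply: eq_measure_integral => A mA _; exact: xiP.
  rewrite integral_law//=.
  by apply: measurableT_comp mf _; exact: measurable_fun_pair measurable_snd measurable_fst.
rewrite fubini_tonelli1//.
apply: ge0_ae_eq_integral => //.
- exact: measurable_fun_fubini_tonelli_F.
- exact: measurable_kernel_integral.
- by move=> z _; apply: integral_ge0.
- by move=> z _; apply: integral_ge0.
apply: filterS kE => z kz _; rewrite /fubini_F/=.
rewrite -(integral_law Q (msec z) (g := fun x => f (x, z)))//.
  by apply: eq_measure_integral => A mA _; rewrite kz.
by apply: measurableT_comp mf _; exact: pair2_measurable.
Qed.

End disintegration_integral.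

(** * Randomized plans *)

Section plans.
Context (R : realType) (X Y Z : completeMetricType R).
Context (x_ : nat -> X) (x_dense : dense_seq x_) (y_ : nat -> Y) (y_dense : dense_seq y_).
Context dW (W : measurableType dW) (Q : probability W R) (r : W -> R).
Hypothesis r_uniform : uniform_variable Q r.
Variables (rho : probability (borel X * borel Z)%type R).
Variables (nu : probability (borel Z) R) (k : R.-pker (borel Z) ~> (borel X)).
Hypothesis hrho : disintegration rho nu k.
Variables (c : X * Y -> R) (c_cont : continuous c) (m : R).
Hypothesis c_ge : forall p, (m <= c p)%R.

(* A transport map randomized by the noise [w]; the target for the fiber over
   almost every [z] is [mu]. *)
Definition plan (mu : probability (borel Y) R)
    (xi : borel X * borel Z * W -> borel Y) : Prop :=
  measurable_fun [set: borel X * borel Z * W] xi /\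
  forall A C, measurable A -> measurable C ->
    (rho \x Q) [set p | A (xi p) /\ C p.1.2] = mu A * nu C.

(** The shift by [m] makes the integrand nonnegative, as required by Tonelli and by the
    semicontinuity of [limit_law]; [m] is added back when comparing with [joint_cost]. *)
Definition plan_cost (xi : borel X * borel Z * W -> borel Y) : \bar R :=
  \int[rho \x Q]_p (c (p.1.1, xi p) - m)%:E.

Lemma continuous_pair1 (T1 T2 : topologicalType) (f : T1 * T2 -> R) a :
  continuous f -> continuous (fun b => f (a, b)).
Proof.
move=> cf b; have h : (a, b') @[b' --> b] --> (a, b).
  by apply: cvg_pair; [exact: cvg_cst|exact: cvg_id].
exact: (cvg_comp _ _ h (cf (a, b))).
Qed.

Lemma continuous_pair2 (T1 T2 : topologicalType) (f : T1 * T2 -> R) b :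
  continuous f -> continuous (fun a => f (a, b)).
Proof.
move=> cf a; have h : (a', b) @[a' --> a] --> (a, b).
  by apply: cvg_pair; [exact: cvg_id|exact: cvg_cst].
exact: (cvg_comp _ _ h (cf (a, b))).
Qed.

(** Continuity refers to the product topology and measurability to the product sigma-algebra. The
    Caratheodory criterion bridges them using continuity in each variable and a dense sequence of
    [Y]. *)
Lemma cost_measurable :
  measurable_fun [set: borel X * borel Y] (fun p => (c p - m)%R).
Proof.
apply: (caratheodory_measurable y_dense); split => [y|x].
  apply: measurable_funB => //; apply: continuous_borel_measurable.
  exact: continuous_pair2.
by move=> y; apply: cvgB; [exact: continuous_pair1|exact: cvg_cst].
Qed.

Lemma cost_ge0 p : 0 <= (c p - m)%:E.
Proof. by rewrite lee_fin subr_ge0. Qed.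

Lemma measurable_cost d (T : measurableType d) (f : T -> borel X) (g : T -> borel Y) :
  measurable_fun [set: T] f -> measurable_fun [set: T] g ->
  measurable_fun [set: T] (fun t => (c (f t, g t) - m)%:E).
Proof.
move=> mf mg; apply/measurable_EFinP.
by apply: (measurableT_comp cost_measurable); exact: measurable_fun_pair.
Qed.

Lemma integral_cost d (T : measurableType d) (P : probability T R)
    (f : T -> borel X) (g : T -> borel Y) :
  measurable_fun [set: T] f -> measurable_fun [set: T] g ->
  \int[P]_t (c (f t, g t))%:E = \int[P]_t (c (f t, g t) - m)%:E + m%:E.
Proof.
move=> mf mg; apply: integral_shift => //.
have := measurable_cost mf mg => /measurable_EFinP h.
rewrite (_ : (fun t => _) = (fun t => (c (f t, g t) - m) + m)%R).
  by apply: measurable_funD.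
by apply/funext => t; rewrite subrK.
Qed.

Lemma plan_of_coupling (P : probability (borel X * borel Y * borel Z)%type R) :
  barycentric_coupling rho P ->
  exists mu xi, plan mu xi /\ joint_cost c P = plan_cost xi + m%:E.
Proof.
move=> [Pxz Pyz].
have mx : measurable_fun setT (fun p : borel X * borel Y * borel Z => p.1.1).
  exact: measurableT_comp measurable_fst measurable_fst.
have my : measurable_fun setT (fun p : borel X * borel Y * borel Z => p.1.2).
  exact: measurableT_comp measurable_snd measurable_fst.
have mz : measurable_fun setT (fun p : borel X * borel Y * borel Z => p.2).
  exact: measurable_snd.
have mxz : measurable_fun setT (fun p : borel X * borel Y * borel Z => (p.1.1, p.2)).
  exact: measurable_fun_pair.
have mg : measurable_fun setT
    (fun p : borel X * borel Y * borel Z => ((p.1.1, p.2), p.1.2)).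
  exact: measurable_fun_pair.
have marg F : measurable F -> law P mg (F `*` setT) = rho F.
  move=> mF; rewrite -Pxz//; congr (P _).
  by apply/seteqP; split=> p /= => [[]|].
have [xi [mxi xiP]] := randomization y_dense r_uniform marg.
exists (law P my), xi; split.
  split=> // A C mA mC.
  have mzC : measurable (setT `*` C : set (borel X * borel Z)) by exact: measurableX.
  rewrite -hrho.1//.
  transitivity (law P mg ((setT `*` C) `*` A)).
    rewrite xiP; last exact: measurableX.
    by congr ((rho \x Q) _); apply/seteqP; split=> p /= => [[? ?]|[[_ ?] ?]].
  transitivity (pushforward P (fun p => (p.1.2, p.2)) (A `*` C)).
    by congr (P _); apply/seteqP; split=> p /= => [[[_ ?] ?]|[? ?]].
  rewrite Pyz; last exact: measurableX.
  transitivity ((law P my \x law P mz) (A `*` C)) => //.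
  rewrite product_measure1E//; congr (_ * _).
  transitivity (pushforward P (fun p => (p.1.1, p.2)) (setT `*` C)).
    by congr (P _); apply/seteqP; split=> p /= => [?|[_ ?]].
  rewrite Pxz//; congr (rho _).
  by apply/seteqP; split=> p /= => [[_ ?]|?].
rewrite /joint_cost.
transitivity (\int[P]_p (c (p.1.1, p.1.2))%:E).
  by apply: eq_integral => -[[]].
rewrite integral_cost//; congr (_ + _).
pose F (q : borel X * borel Z * borel Y) := (c (q.1.1, q.2) - m)%:E.
have mF : measurable_fun setT F.
  apply: measurable_cost; last exact: measurable_snd.
  exact: measurableT_comp measurable_fst measurable_fst.
have F0 q : 0 <= F q by exact: cost_ge0.
have mxi1 : measurable_fun setT (fun p : borel X * borel Z * W => (p.1, xi p)).
  exact: measurable_fun_pair measurable_fst mxi.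
transitivity (\int[law P mg]_q F q); first by rewrite integral_law.
transitivity (\int[law (rho \x Q) mxi1]_q F q); last by rewrite integral_law.
by apply: eq_measure_integral => A mA _; exact: xiP.
Qed.

(** The source [T] is arbitrary because two are used: [X * Z * W] for plans, and [Z * Y * W] for the
    couplings glued in the lower bound. *)
Lemma barycentric_coupling_law dT (T : measurableType dT) (P : probability T R)
    (f : T -> borel X) (g : T -> borel Y) (h : T -> borel Z) (mu : probability (borel Y) R) :
  measurable_fun [set: T] f -> measurable_fun [set: T] g -> measurable_fun [set: T] h ->
  (forall A, measurable A -> P ((fun t => (f t, h t)) @^-1` A) = rho A) ->
  (forall A C, measurable A -> measurable C ->
     P [set t | A (g t) /\ C (h t)] = mu A * nu C) ->
  exists P' : probability (borel X * borel Y * borel Z)%type R,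
    barycentric_coupling rho P' /\
    joint_cost c P' = \int[P]_t (c (f t, g t) - m)%:E + m%:E.
Proof.
move=> mf mg mh fhE ghE.
have mfgh : measurable_fun setT (fun t => ((f t, g t), h t)).
  by apply: measurable_fun_pair => //; exact: measurable_fun_pair.
have mx : measurable_fun setT (fun p : borel X * borel Y * borel Z => p.1.1).
  exact: measurableT_comp measurable_fst measurable_fst.
have my : measurable_fun setT (fun p : borel X * borel Y * borel Z => p.1.2).
  exact: measurableT_comp measurable_snd measurable_fst.
have mz : measurable_fun setT (fun p : borel X * borel Y * borel Z => p.2).
  exact: measurable_snd.
pose P' := law P mfgh; exists P'; split.
  split=> [A mA|A mA]; first by rewrite -fhE.
  have Py B : measurable B -> law P' my B = mu B.
    move=> mB; have := ghE B setT mB measurableT.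
    rewrite [X in _ = _ * X -> _](_ : _ = 1); last exact: probability_setT.
    rewrite mule1 => <-; congr (P _).
    by apply/seteqP; split=> p /= => [?|[]].
  have Pz B : measurable B -> law P' mz B = nu B.
    move=> mB; have := ghE setT B measurableT mB.
    rewrite [X in _ = X * _ -> _](_ : _ = 1); last exact: probability_setT.
    rewrite mul1e => <-; congr (P _).
    by apply/seteqP; split=> p /= => [?|[]].
  have myz : measurable_fun setT (fun p : borel X * borel Y * borel Z => (p.1.2, p.2)).
    exact: measurable_fun_pair.
  transitivity (law P' myz A) => //.
  transitivity ((law P' my \x law P' mz) A) => //.
  apply/esym; apply: product_measure_unique => // B C mB mC.
  transitivity (mu B * nu C); last by rewrite -Py// -Pz.
  by rewrite -ghE.
rewrite /joint_cost.
transitivity (\int[P']_p (c (p.1.1, p.1.2))%:E).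
  by apply: eq_integral => -[[]].
rewrite integral_cost//; congr (_ + _); rewrite integral_law//.
  exact: measurable_cost.
by move=> p; exact: cost_ge0.
Qed.

Lemma coupling_of_plan mu xi : plan mu xi ->
  exists P : probability (borel X * borel Y * borel Z)%type R,
    barycentric_coupling rho P /\ joint_cost c P = plan_cost xi + m%:E.
Proof.
move=> [mxi xiP]; apply: (barycentric_coupling_law (P := (rho \x Q)%E) _ mxi _ _ xiP).
- exact: measurableT_comp measurable_fst measurable_fst.
- exact: measurableT_comp measurable_snd measurable_fst.
move=> A mA; transitivity ((rho \x Q) (A `*` setT)).
  by congr ((rho \x Q) _); apply/seteqP; split=> -[[x z] w] /= => [?|[]].
exact: product_probability_setT.
Qed.

Section plan_section.
Variables (mu : probability (borel Y) R) (xi : borel X * borel Z * W -> borel Y).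
Hypothesis xi_plan : plan mu xi.

Let mxi_section z : measurable_fun [set: borel X * W]
  (fun p : borel X * W => xi ((p.1, z), p.2)).
Proof.
apply: measurableT_comp xi_plan.1 _.
by apply: measurable_fun_pair => //; exact: measurable_fun_pair.
Qed.

Lemma measurable_section z : measurable_fun [set: borel X * W]
  (fun p : borel X * W => (p.1, xi ((p.1, z), p.2))).
Proof. exact: measurable_fun_pair. Qed.

Definition plan_section (z : borel Z) : probability (borel X * borel Y)%type R :=
  law (pker_probability k z \x Q) (measurable_section z).

Definition section_cost (z : borel Z) : \bar R :=
  \int[k z]_x \int[Q]_w (c (x, xi ((x, z), w)) - m)%:E.

Let G (p : borel X * borel Z) : \bar R := \int[Q]_w (c (p.1, xi (p, w)) - m)%:E.

Let mf : measurable_fun setT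
  (fun p : borel X * borel Z * W => (c (p.1.1, xi p) - m)%:E).
Proof.
apply: measurable_cost; last exact: xi_plan.1.
exact: measurableT_comp measurable_fst measurable_fst.
Qed.

Let mG : measurable_fun [set: borel X * borel Z] G.
Proof.
apply: (measurable_fun_fubini_tonelli_F
  (fun p : borel X * borel Z * W => (c (p.1.1, xi p) - m)%:E)) => //.
by move=> p; exact: cost_ge0.
Qed.

Let G_ge0 p : 0 <= G p.
Proof. by apply: integral_ge0 => w _; exact: cost_ge0. Qed.

Lemma section_cost_ge0 z : 0 <= section_cost z.
Proof. by apply: integral_ge0 => x _; exact: (G_ge0 (x, z)). Qed.

Lemma measurable_section_cost : measurable_fun [set: borel Z] section_cost.
Proof. by apply: (measurable_kernel_integral k mG) => p; exact: G_ge0. Qed.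

Lemma integral_section_cost : \int[nu]_z section_cost z = plan_cost xi.
Proof.
rewrite /plan_cost fubini_tonelli1//; last by move=> p; exact: cost_ge0.
by rewrite (disintegration_integral x_dense r_uniform hrho).
Qed.

Lemma transport_cost_section z :
  transport_cost c (plan_section z) = section_cost z + m%:E.
Proof.
rewrite /transport_cost.
transitivity (\int[plan_section z]_p (c (p.1, p.2))%:E).
  by apply: eq_integral => -[].
rewrite integral_cost//; congr (_ + _).
rewrite integral_law//; last 2 first.
- exact: measurable_cost.
- by move=> p; exact: cost_ge0.
rewrite fubini_tonelli1//=; last by move=> p; exact: cost_ge0.
exact: (measurable_cost (f := fst) (g := fun p => xi ((p.1, z), p.2))).
Qed.

(** The [X]-marginal is right at every [z], the noise being independent. The [Y]-marginal is only
    known after integration over sets of [z], hence almost everywhere by [ae_eq_kernel]. *)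
Lemma coupling_section : {ae nu, forall z, coupling (k z) mu (plan_section z)}.
Proof.
have my : measurable_fun setT (@snd (borel X) (borel Y)) by exact: measurable_snd.
have Ey A : measurable A -> measurable [set p : borel X * borel Z * W | A (xi p)].
  by move=> mA; rewrite -[X in measurable X]setTI; exact: xi_plan.1.
have secE A z : measurable A -> law (plan_section z) my A =
    \int[k z]_x Q (xsection [set p : borel X * borel Z * W | A (xi p)] (x, z)).
  move=> mA; apply: eq_integral => x _ /=; congr (Q _).
have mQ A : measurable A -> measurable_fun setT
    (fun p => Q (xsection [set p : borel X * borel Z * W | A (xi p)] p)).
  by move=> mA; apply: measurable_fun_xsection; exact: Ey.
have h : {ae nu, forall z, forall A, measurable A -> law (plan_section z) my A = mu A}.
  apply: (ae_eq_kernel y_dense (k := fun z => law (plan_section z) my) (k' := fun=> mu)).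
  - by move=> z; exact: probability_setT.
  - by move=> z; exact: probability_setT.
  - move=> A mA; rewrite (_ : (fun z => _) = fun z =>
        \int[k z]_x Q (xsection [set p : borel X * borel Z * W | A (xi p)] (x, z))); last first.
      by apply/funext => z; exact: secE.
    by apply: (measurable_kernel_integral k (mQ A mA)) => p; exact: measure_ge0.
  - by move=> A mA; exact: measurable_cst.
  - move=> A C mA mC.
    rewrite integral_cst// -xi_plan.2//.
    pose F (p : borel X * borel Z) : \bar R :=
      Q (xsection [set p : borel X * borel Z * W | A (xi p)] p) * (\1_C p.2)%:E.
    have mF : measurable_fun setT F.
      apply: emeasurable_funM; first exact: mQ.
      by apply/measurable_EFinP; apply: measurableT_comp measurable_snd; exact: measurable_indic.
    have F0 p : 0 <= F p by rewrite mule_ge0// lee_fin.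
    transitivity (\int[rho]_p F p).
      rewrite (disintegration_integral x_dense r_uniform hrho)// integral_mkcond.
      apply: eq_integral => z _; rewrite patchE /F/= indicE; case: ifPn => zC.
        transitivity (\int[k z]_x
            Q (xsection [set p : borel X * borel Z * W | A (xi p)] (x, z))).
          exact: secE.
        by apply: eq_integral => x _; rewrite mule1.
      by rewrite integral0_eq// => x _; rewrite mule0.
    apply: eq_integral => p _; rewrite /F indicE/=; case: (boolP (p.2 \in C)) => pC.
      rewrite mule1; congr (Q _); rewrite inE in pC.
      by apply/seteqP; split=> w; rewrite /xsection/= !inE/= => // -[].
    rewrite mule0 (_ : xsection _ _ = set0) ?measure0//.
    apply/seteqP; split=> // w; rewrite /xsection/= inE/= => -[_ Cp].
    by move/negP: pC; rewrite inE.
apply: filterS h => z hz; split=> A mA; last exact: hz.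
transitivity ((pker_probability k z \x Q) (A `*` setT)).
  by congr ((_ \x _) _); apply/seteqP; split=> -[x w] /= => [?|[]].
exact: product_probability_setT.
Qed.

End plan_section.

End plans.

(** * Existence of a minimal plan *)

Section compactness.
Context (R : realType) (Y : completeMetricType R) (y_ : nat -> Y).
Context (y_dense : dense_seq y_).

Lemma ultra_bigcup (I : Type) (F : set_system I) (A : nat -> set I) N :
  UltraFilter F -> F (\bigcup_(k in `I_N) A k) -> exists2 k, (k < N)%N & F (A k).
Proof.
move=> UF; elim: N => [|N IH] FA.
  have F0 : F set0 by apply: filterS FA => i [].
  by have := @filter_not_empty _ F _; case.
have [AN|AN] := in_ultra_setVsetC (A N) UF; first by exists N.
have [|k kN Ak] := IH; last by exists k => //; exact: ltnW.
apply: filterS (filterI FA AN) => i [[k /= kN Ak] nAN]; exists k => //=.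
by move: kN; rewrite ltnS leq_eqVlt => /predU1P[kN|//]; exfalso; apply: nAN; rewrite -kN.
Qed.

Lemma compact_ball_cover (A : set Y) n : compact A ->
  exists N, A `<=` [set y | exists2 k, (k < N)%N & (mdist (y_ k) y < rad n)%R].
Proof.
move=> cA; apply: contrapT => /forallNP h.
have {h} h N : exists y, A y /\
    forall k, (k < N)%N -> ~ (mdist (y_ k) y < rad n)%R.
  have /existsNP[y /not_implyP[Ay hy]] := h N.
  by exists y; split=> // k kN yk; apply: hy; exists k.
have [u hu] := boolp.choice h.
have [|p [Ap pu]] := cA (u @ \oo) _.
  by exists 0%N => // N _; have [] := hu N.
have [k kp] := y_dense p (rad_gt0 R n).
have far_k : (u @ \oo) (~` ball (y_ k) (rad n)).
  by exists k.+1 => // N /= kN; rewrite ballEmdist => ?; exact: ((hu N).2 k kN).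
have near_k : nbhs p (ball (y_ k) (rad n)).
  by apply: open_nbhs_nbhs; split; [exact: open_mball|rewrite ballEmdist].
by have [y [h1 h2]] := pu _ _ far_k near_k.
Qed.

Lemma totally_bounded_compact (C : nat -> nat) (K : set Y) : closed K ->
  (forall n, K `<=` \bigcup_(k in `I_(C n)) [set y | (mdist (y_ k) y <= rad n)%R]) ->
  compact K.
Proof.
move=> clK hK; rewrite compact_ultra => F UF FK.
have : cvg F.
  apply: cauchy_cvg; apply: cauchy_exP => e e0.
  have [n /(_ n (leqnn n)) ne] := rad_small e0.
  have FC : F (\bigcup_(k in `I_(C n)) [set y | (mdist (y_ k) y <= rad n)%R]).
    by apply: filterS FK; exact: hK.
  have [k _ Fk] := ultra_bigcup UF FC.
  exists (y_ k); apply: filterS Fk => y /= yk; rewrite ballEmdist/=.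
  exact: le_lt_trans yk ne.
move/cvg_ex => [p Fp]; exists p; split=> //.
apply: clK => V pV; have FV : F V by exact: Fp.
exact: filter_ex (filterI FK FV).
Qed.

(** Ulam's theorem: at scale [n] finitely many closed balls miss at most [e / 2 ^ n.+1] of the mass,
    and the intersection over [n] is closed and totally bounded. *)
Lemma probability_compact_tight (P : probability (borel Y) R) (e : R) : (0 < e)%R ->
  exists K : set Y, [/\ compact K, measurable (K : set (borel Y)) & (1 - e)%:E <= P K].
Proof.
move=> e0; have en n : (0 < e / (2 ^ n.+1)%:R)%R by rewrite divr_gt0// ltr0n expn_gt0.
have [C hC] := boolp.choice (fun n => probability_tight y_dense P n (en n)).
pose B n k : set Y := [set y | (mdist (y_ k) y <= rad n)%R].
pose D n : set Y := \bigcup_(k in `I_(C n)) B n k.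
pose K : set Y := \bigcap_n D n.
have clB n k : closed (B n k).
  rewrite (_ : B n k = mdist (y_ k) @^-1` [set` `]-oo, rad n]%R]).
    apply: closed_comp => [y _|]; [exact: mdist_continuous|exact: interval_closed].
  by apply/seteqP; split=> y /=; rewrite in_itv.
have clD n : closed (D n).
  by apply: closed_bigcup => // k _; exact: clB.
have mD n : measurable (D n : set (borel Y)).
  rewrite -[D n]setCK; apply: measurableC; apply: open_borel_measurable.
  exact: closed_openC.
exists K; split.
- by apply: (@totally_bounded_compact C); [apply: closed_bigI => n _|move=> n y; apply].
- exact: bigcapT_measurable.
have mK : measurable (K : set (borel Y)) by exact: bigcapT_measurable.
have PD n : P (~` D n) <= (e / (2 ^ n.+1)%:R)%:E.
  rewrite probability_setC_le//; apply: (le_trans (hC n)); apply: le_measure; rewrite ?inE//.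
    exact: measurable_near_first.
  by move=> y [k kN yk]; exists k => //; exact: ltW.
rewrite -probability_setC_le// /K setC_bigcap.
apply: (le_trans (measure_sigma_subadditive _ _ _ (@subset_refl _ _))).
- by move=> n; exact: measurableC.
- by apply: bigcupT_measurable => n; exact: measurableC.
apply: (@le_trans _ _ (\sum_(n <oo) (e / (2 ^ n.+1)%:R)%:E)).
  by apply: lee_nneseries => [n _ _|n _]; [exact: measure_ge0|exact: PD].
exact: epsilon_trick0 (ltW e0).
Qed.

End compactness.

(** Coercivity is stated along sequences. If no radius worked, points at distance more than [n] with
    cost below [L] would form a sequence that contradicts it. *)
Lemma coercive_bound (R : realType) (X Y : completeMetricType R) (c : X * Y -> R) :
  locally_uniformly_coercive c -> exists y0 : Y, forall (K : set X) (L : R), compact K ->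
  exists r : R, forall x y, K x -> (r < mdist y y0)%R -> (L <= c (x, y))%R.
Proof.
move=> [y0 hc]; exists y0 => K L cK; apply: contrapT => /forallNP h.
have {h} h (n : nat) : exists xy : X * Y,
    [/\ K xy.1, (n%:R < mdist xy.2 y0)%R & (c xy < L)%R].
  have /existsNP[x /existsNP[y /not_implyP[Kx /not_implyP[ny Lc]]]] := h n%:R.
  by exists (x, y); split=> //; rewrite ltNge; exact/negP.
have [u hu] := boolp.choice h.
have := hc K cK (fun n => (u n).2).
have dist_oo : mdist (u n).2 y0 @[n --> \oo] --> (+oo)%R.
  apply/cvgryPge => A; exists (Num.truncn A).+1 => // n /= An.
  have [_ un _] := hu n; apply: le_trans (ltW un).
  by rewrite (le_trans (ltW (truncnS_gt A)))// ler_nat.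
move=> /(_ dist_oo) /cvgeyPge/(_ L) [N _ /(_ N (leqnn N))] /=.
have [KN _ cL] := hu N; apply/negP; rewrite -ltNge.
apply: (@le_lt_trans _ _ (c (u N))%:E); last by rewrite lte_fin.
by apply: ereal_inf_lbound; exists (u N).1 => //; case: (u N).
Qed.

Section product_law.
Context d dB (T : measurableType d) (B : measurableType dB) (R : realType).
Context (Y : completeMetricType R) (y_ : nat -> Y) (y_dense : dense_seq y_).

Lemma caratheodory_indic_testf F s : measurable F ->
  caratheodory (fun q : B * borel Y => (\1_F q.1 * testf y_ s q.2)%R).
Proof.
move=> mF; split => [y|x].
  by apply: measurable_funM => //=; exact: measurable_indic.
move=> y; apply: cvgM; first exact: cvg_cst.
exact: testf_continuous.
Qed.

Lemma indic_testf01 (F : set B) s (q : B * borel Y) :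
  (0 <= \1_F q.1 * testf y_ s q.2 <= 1)%R.
Proof.
rewrite mulr_ge0 ?testf_ge0//= mulr_ile1 ?testf_ge0 ?testf_le1//.
Qed.

Variables (P : probability T R) (b : T -> B) (eta : T -> borel Y).
Hypotheses (mb : measurable_fun [set: T] b) (meta : measurable_fun [set: T] eta).
Variables (a : probability B R) (mu : probability (borel Y) R).

Let mtest F s : measurable F ->
  measurable_fun [set: B * borel Y] (fun q => (\1_F q.1 * testf y_ s q.2)%:E).
Proof.
move=> mF; apply/measurable_EFinP; apply: measurable_funM.
  by apply: measurableT_comp measurable_fst; exact: measurable_indic.
by apply: measurableT_comp measurable_snd; exact: measurable_testf.
Qed.

Let test_ge0 F s (q : B * borel Y) : 0 <= (\1_F q.1 * testf y_ s q.2)%:E.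
Proof. by rewrite lee_fin mulr_ge0// testf_ge0. Qed.

Lemma integral_product_testf F s : measurable F ->
  \int[a \x mu]_q (\1_F q.1 * testf y_ s q.2)%:E = a F * \int[mu]_y (testf y_ s y)%:E.
Proof.
move=> mF; rewrite fubini_tonelli1//; last exact: mtest.
transitivity (\int[a]_x ((\int[mu]_y (testf y_ s y)%:E) * (\1_F x)%:E)).
  apply: eq_integral => x _ /=; rewrite /fubini_F/=.
  under eq_integral do rewrite EFinM.
  rewrite ge0_integralZl_EFin//; first by rewrite muleC.
  - by move=> y _; rewrite lee_fin testf_ge0.
  - by apply/measurable_EFinP; exact: measurable_testf.
rewrite ge0_integralZl//.
- by rewrite integral_indic// setIT muleC.
- by apply/measurable_EFinP; exact: measurable_indic.
- by apply: integral_ge0 => y _; rewrite lee_fin testf_ge0.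
Qed.

Lemma testf_product_law :
  (forall A C, measurable A -> measurable C ->
     P [set t | A (eta t) /\ C (b t)] = mu A * a C) ->
  forall F s, measurable F ->
    \int[P]_t (\1_F (b t) * testf y_ s (eta t))%:E = a F * \int[mu]_y (testf y_ s y)%:E.
Proof.
move=> h F s mF; rewrite -integral_product_testf//.
have mbe : measurable_fun setT (fun t => (b t, eta t)) by exact: measurable_fun_pair.
transitivity (\int[law P mbe]_q (\1_F q.1 * testf y_ s q.2)%:E).
  by rewrite integral_law//; exact: mtest.
apply: eq_measure_integral => A mA _; apply: rectangle_measure_unique => //.
  by rewrite [X in X < _](_ : _ = 1) ?ltry//; exact: probability_setT.
move=> C D mC mD; transitivity (a C * mu D); last first.
  by apply/esym; exact: product_measure1E.
rewrite [RHS]muleC -h//.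
by congr (P _); apply/seteqP; split=> t /= [].
Qed.

(** With [testf_product_law], independence is expressed by bounded Caratheodory functions, for which
    integrals converge along the ultrafilter. *)
Lemma product_law_testf :
  (forall F s, measurable F ->
    \int[P]_t (\1_F (b t) * testf y_ s (eta t))%:E = a F * \int[mu]_y (testf y_ s y)%:E) ->
  forall A, measurable A -> P ((fun t => (b t, eta t)) @^-1` A) = (a \x mu) A.
Proof.
move=> h A mA.
rewrite (joint_law_unique y_dense (P' := (a \x mu)%E) (b' := fst) (eta' := snd))//.
by move=> F s mF; rewrite h// integral_product_testf.
Qed.

End product_law.

Lemma markov_bound d (T : measurableType d) (R : realType) (P : probability T R)
    (f : T -> R) (L v : R) : measurable_fun [set: T] f -> (forall t, (0 <= f t)%R) ->
  (0 < L)%R -> \int[P]_t (f t)%:E <= v%:E -> P [set t | (L <= f t)%R] <= (v / L)%:E.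
Proof.
move=> mf f0 L0 fv; set A := [set t | _].
have mA : measurable A.
  rewrite (_ : A = f @^-1` [set` `[L, +oo[%R]); last first.
    by apply/seteqP; split=> t; rewrite /A/= in_itv/= andbT.
  by rewrite -[X in measurable X]setTI; exact: mf.
have : L%:E * P A <= v%:E.
  apply: le_trans fv; rewrite -integral_cst//.
  apply: (@le_trans _ _ (\int[P]_(t in A) (f t)%:E)).
    apply: ge0_le_integral => //; first by move=> t _; rewrite lee_fin ltW.
    by move/measurable_EFinP : mf => /measurable_funTS.
  apply: ge0_subset_integral => //; first exact/measurable_EFinP.
  by move=> t _; rewrite lee_fin.
rewrite -[P A]fineK ?fin_num_measure// -EFinM !lee_fin => h.
by rewrite ler_pdivlMr// mulrC.
Qed.

Lemma rad_le1 (R : realType) n : (rad n <= 1 :> R)%R.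
Proof. by rewrite /rad invf_le1 ?ltr0n// ler1n. Qed.

Lemma fine_cvg_mul (R : realType) (I : Type) (U : set_system I) {PU : ProperFilter U}
    (u v : I -> \bar R) (a l l' : R) :
  fine (u i) @[i --> U] --> l -> fine (v i) @[i --> U] --> l' ->
  (forall i, u i = a%:E * v i) -> (forall i, v i \is a fin_num) -> l = (a * l')%R.
Proof.
move=> ul vl uv vf.
have h : fine (u i) @[i --> U] --> (a * l')%R.
  rewrite (_ : (fun i => _) = fun i => (a * fine (v i))%R).
    by apply: cvgM vl; exact: cvg_cst.
  by apply/funext => i; rewrite uv -[X in _ * X]fineK.
exact: (cvg_unique _ ul h).
Qed.

Section minimal_plan.
Context (R : realType) (X Y Z : completeMetricType R).
Context (x_ : nat -> X) (x_dense : dense_seq x_) (y_ : nat -> Y) (y_dense : dense_seq y_).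
Context dW (W : measurableType dW) (Q : probability W R) (r : W -> R).
Hypothesis r_uniform : uniform_variable Q r.
Variables (rho : probability (borel X * borel Z)%type R).
Variables (nu : probability (borel Z) R) (k : R.-pker (borel Z) ~> (borel X)).
Hypothesis hrho : disintegration rho nu k.
Variables (c : X * Y -> R) (c_cont : continuous c) (m : R).
Hypothesis c_ge : forall p, (m <= c p)%R.

Local Notation plan := (plan Q rho nu).
Local Notation plan_cost := (plan_cost Q rho c m).

(** It serves as the minimal plan when every plan has infinite cost. *)
Lemma constant_plan : exists mu (xi : borel X * borel Z * W -> borel Y), plan mu xi.
Proof.
have mcst : measurable_fun setT (fun _ : borel Z => y_ 0%N : borel Y) by [].
exists (law nu mcst), (fun=> y_ 0%N); split=> // A C mA mC.
have [Ay|nAy] := pselect (A (y_ 0%N)).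
  rewrite (_ : [set p | _] = (setT `*` C) `*` setT); last first.
    by apply/seteqP; split=> p /= => [[]|[[]]].
  rewrite product_probability_setT; last exact: measurableX.
  rewrite (_ : law nu mcst A = 1) ?mul1e; last first.
    transitivity (nu setT); last exact: probability_setT.
    by congr (nu _); apply/seteqP; split.
  rewrite -hrho.1//; congr (rho _).
  by apply/seteqP; split=> p /= => [[]|].
rewrite (_ : [set p | _] = set0) ?measure0; last by apply/seteqP; split=> // p [].
rewrite (_ : law nu mcst A = 0) ?mul0e//.
transitivity (nu set0); last exact: measure0.
by congr (nu _); apply/seteqP; split.
Qed.

Lemma plan_cost_ge0 xi : 0 <= plan_cost xi.
Proof. by apply: integral_ge0 => p _; exact: cost_ge0. Qed.

Lemma caratheodory_cost : caratheodory
  (fun q : (borel X * borel Z) * borel Y => c (q.1.1, q.2) - m)%R.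
Proof.
split => [y|b].
  apply: measurable_funB => //.
  apply: (measurableT_comp (f := (fun x => c (x, y)) : borel X -> R)) measurable_fst.
  by apply: continuous_borel_measurable; exact: continuous_pair2.
by move=> y; apply: cvgB; [exact: continuous_pair1|exact: cvg_cst].
Qed.

Hypotheses (coercive : locally_uniformly_coercive c) (HB_Y : heine_borel Y).

(** Off two events of probability at most [e / 2], namely [x] outside a compact set and a large cost
    by Markov, coercivity confines [xi i] to a fixed closed ball of [Y]. That ball is compact by
    Heine-Borel, so finitely many small balls cover it. *)
Lemma bounded_cost_tight (xi : nat -> borel X * borel Z * W -> borel Y) (v : R) :
  (forall i, measurable_fun [set: borel X * borel Z * W] (xi i)) ->
  (forall i, plan_cost (xi i) <= v%:E) ->
  forall n (e : R), (0 < e)%R -> exists N, forall i, (1 - e)%:E <=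
    (rho \x Q) [set p | exists2 k, (k < N)%N & (mdist (y_ k) (xi i p) < rad n)%R].
Proof.
move=> mxi xiv n e e0.
have v0 : (0 <= v)%R by rewrite -lee_fin (le_trans (plan_cost_ge0 (xi 0%N))).
have e20 : (0 < e / 2)%R by rewrite divr_gt0.
have mx : measurable_fun setT (fun p : borel X * borel Z => p.1) by exact: measurable_fst.
have [K [cK mK PK]] := probability_compact_tight x_dense (law rho mx) e20.
(* This makes the Markov bound [v / L] at most [e / 2]; the added 1 keeps [L] positive when [v] is
   0. *)
pose L := ((v + 1) / (e / 2))%R.
have L0 : (0 < L)%R by rewrite divr_gt0// ltr_wpDl.
have [y0 hc] := coercive_bound coercive.
have [s hs] := hc K (L + m)%R cK.
have cA : compact [set y : Y | (mdist y0 y <= s)%R].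
  apply: HB_Y; last by exists y0, s.
  rewrite (_ : [set y | _] = mdist y0 @^-1` [set` `]-oo, s]%R]).
    by apply: closed_comp => [y _|]; [exact: mdist_continuous|exact: interval_closed].
  by apply/seteqP; split=> y /=; rewrite in_itv.
have [N hN] := compact_ball_cover y_dense n cA; exists N => i.
set E := [set p | _].
have mE : measurable E.
  by have := mxi i measurableT _ (measurable_near_first y_ N (rad n)); rewrite setTI.
pose f p := (c (p.1.1, xi i p) - m)%R.
have mf : measurable_fun setT f.
  apply/measurable_EFinP; apply: (measurable_cost y_dense c_cont) => //.
  exact: measurableT_comp measurable_fst measurable_fst.
have f0 p : (0 <= f p)%R by rewrite subr_ge0.
have mfL := markov_bound mf f0 L0 (xiv i).
pose D := [set p : borel X * borel Z * W | (~` K) p.1.1].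
have mD : measurable D.
  rewrite (_ : D = ((~` K) `*` setT) `*` setT); last first.
    by apply/seteqP; split=> p /= => [|[[]]].
  by apply: measurableX => //; apply: measurableX => //; exact: measurableC.
have mG : measurable [set p | (L <= f p)%R].
  rewrite (_ : [set p | _] = f @^-1` [set` `[L, +oo[%R]); last first.
    by apply/seteqP; split=> t /=; rewrite in_itv/= andbT.
  by rewrite -[X in measurable X]setTI; exact: mf.
have PD : (rho \x Q) D <= (e / 2)%:E.
  rewrite (_ : (rho \x Q) D = law rho mx (~` K)).
    by rewrite probability_setC_le.
  transitivity (rho ((~` K) `*` setT)).
    rewrite -(product_probability_setT rho Q); last first.
      by apply: measurableX => //; exact: measurableC.
    by congr ((_ \x _) _); apply/seteqP; split=> p /= => [|[[]]].
  by congr (rho _); apply/seteqP; split=> p /= => [[]|].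
have vL : (v / L <= e / 2)%R.
  rewrite ler_pdivrMr// /L mulrCA divff ?gt_eqF// mulr1; lra.
have sub : ~` E `<=` D `|` [set p | (L <= f p)%R].
  move=> p nEp; have [Kp|nKp] := pselect (K p.1.1); last by left.
  right => /=; rewrite /f lerBrDr; apply: hs => //.
  rewrite ltNge; apply/negP => ps; apply: nEp; apply: hN => /=.
  by rewrite metric_sym.
rewrite -(probability_setC_le (rho \x Q)%E)//.
apply: (@le_trans _ _ ((rho \x Q) (D `|` [set p | (L <= f p)%R]))).
  by apply: le_measure; rewrite ?inE//; [exact: measurableC|exact: measurableU].
apply: (le_trans (measureU2 _ _ _)) => //.
rewrite (splitr e) EFinD; apply: leeD => //.
by apply: (le_trans mfL); rewrite lee_fin.
Qed.

Lemma minimal_plan_exists : exists mu (xi : borel X * borel Z * W -> borel Y), plan mu xi /\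
  forall mu' xi', plan mu' xi' -> plan_cost xi <= plan_cost xi'.
Proof.
pose S := [set v | exists mu xi, plan mu xi /\ plan_cost xi = v].
pose v := ereal_inf S.
have v0 : 0 <= v by apply: le_ereal_inf_tmp => _ [mu [xi [_ <-]]]; exact: plan_cost_ge0.
have vP mu' xi' : plan mu' xi' -> v <= plan_cost xi'.
  by move=> h; apply: ereal_inf_lbound; exists mu', xi'.
have [voo|vfin] := eqVneq v +oo.
  have [mu [xi xiP]] := constant_plan.
  exists mu, xi; split=> // mu' xi' /vP; rewrite voo leye_eq => /eqP ->.
  exact: leey.
have vf : v \is a fin_num by rewrite ge0_fin_numE// ltey.
have near n : exists muxi : probability (borel Y) R * (borel X * borel Z * W -> borel Y),
    plan muxi.1 muxi.2 /\ plan_cost muxi.2 <= (fine v + rad n)%:E.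
  have [_ [mu [xi [h <-]]] hv] := lb_ereal_inf_adherent (rad_gt0 R n) vf.
  by exists (mu, xi); split=> //; rewrite EFinD fineK// ltW.
have [u hu] := boolp.choice near.
pose xi n := (u n).2.
have mxi n : measurable_fun setT (xi n) by exact: (hu n).1.1.
have mg n : measurable_fun setT (fun p : borel X * borel Z * W => (p.1, xi n p)).
  exact: measurable_fun_pair measurable_fst (mxi n).
pose pi n := law (rho \x Q) (mg n).
have [U [UU hU]] := @ultraFilterLemma nat \oo _.
have marg i F : measurable F -> pi i (F `*` setT) = rho F.
  move=> mF; transitivity ((rho \x Q) (F `*` setT)).
    by congr ((_ \x _) _); apply/seteqP; split=> p /= => [[]|[]].
  exact: product_probability_setT.
have tight n e : (0 < e)%R -> exists N, \forall i \near U, (1 - e)%:E <=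
    pi i [set x | exists2 k, (k < N)%N & (mdist (y_ k) x.2 < rad n)%R].
  move=> e0; have [|N hN] := bounded_cost_tight (v := fine v + 1) mxi _ n e0.
    move=> i; apply: (le_trans (hu i).2); rewrite lee_fin lerD2l.
    exact: rad_le1.
  by exists N; apply: nearW => i; exact: hN.
have [zeta [mzeta zetaP]] := limit_law y_dense r_uniform (UU := UU) marg tight.
exists (law (rho \x Q) mzeta), zeta; split; last first.
  move=> mu' xi' /vP; apply: le_trans; apply/lee_addgt0Pr => e e0.
  rewrite -[v]fineK// -EFinD; apply: (zetaP _ caratheodory_cost).
    by move=> q; rewrite subr_ge0.
  have [N hN] := rad_small e0; apply: hU; exists N => // i /= Ni.
  rewrite integral_law.
  - by apply: (le_trans (hu i).2); rewrite lee_fin lerD2l ltW// hN.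
  - apply: (measurable_cost y_dense c_cont); last exact: measurable_snd.
    exact: measurableT_comp measurable_fst measurable_fst.
  - by move=> q; rewrite lee_fin subr_ge0.
split=> // A C mA mC.
pose b (p : borel X * borel Z * W) := p.1.2.
have mb : measurable_fun setT b by exact: measurableT_comp measurable_snd measurable_fst.
transitivity ((nu \x law (rho \x Q) mzeta) (C `*` A)); last first.
  by rewrite muleC; exact: product_measure1E.
rewrite -(product_law_testf y_dense mb mzeta (P := (rho \x Q)%E)).
- by congr ((_ \x _) _); apply/seteqP; split=> p /= => [[]|[]].
- move=> F s mF.
  have mFX : measurable (setT `*` F : set (borel X * borel Z)) by exact: measurableX.
  have cF := caratheodory_indic_testf y_ s mFX.
  have mTX : measurable (setT `*` setT : set (borel X * borel Z)) by exact: measurableX.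
  have cT := caratheodory_indic_testf y_ s mTX.
  have F01 q := indic_testf01 y_ (setT `*` F : set (borel X * borel Z)) s q.
  have T01 q := indic_testf01 y_ (setT `*` setT : set (borel X * borel Z)) s q.
  have limF := limit_law_cvg y_dense (UU := UU) mzeta zetaP cF F01.
  have limT := limit_law_cvg y_dense (UU := UU) mzeta zetaP cT T01.
  have indE (G : set (borel Z)) (eta : borel X * borel Z * W -> borel Y) :
      \int[rho \x Q]_p (\1_(setT `*` G : set (borel X * borel Z)) (p.1, eta p).1 *
                         testf y_ s (p.1, eta p).2)%:E =
      \int[rho \x Q]_p (\1_G (b p) * testf y_ s (eta p))%:E.
    apply: eq_integral => p _; rewrite !indicE; congr ((nat_of_bool _)%:R * _)%:E.
    by apply/idP/idP; rewrite !inE; [case|split].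
  have toE G (mG : measurable G) (eta : borel X * borel Z * W -> borel Y)
      (me : measurable_fun setT (fun p : borel X * borel Z * W => (p.1, eta p))) :
      \int[law (rho \x Q) me]_q
        (\1_(setT `*` G : set (borel X * borel Z)) q.1 * testf y_ s q.2)%:E =
      \int[rho \x Q]_p (\1_G (b p) * testf y_ s (eta p))%:E.
    rewrite integral_law.
    + exact: indE.
    + apply/measurable_EFinP; apply: (caratheodory_measurable y_dense).
      by apply: caratheodory_indic_testf; exact: measurableX.
    + by move=> q; rewrite lee_fin; have /andP[] := indic_testf01 y_ (setT `*` G) s q.
  have unit01 G (mG : measurable G) (eta : borel X * borel Z * W -> borel Y) :
      measurable_fun setT eta ->
      \int[rho \x Q]_p (\1_G (b p) * testf y_ s (eta p))%:E \is a fin_num.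
    move=> meta; apply: integral_unit_fin_num.
      apply: measurable_funM; first by apply: measurableT_comp mb; exact: measurable_indic.
      by apply: measurableT_comp meta; exact: measurable_testf.
    by move=> p; exact: (indic_testf01 y_ G s (b p, eta p)).
  have prodE i G (mG : measurable G) : \int[rho \x Q]_p (\1_G (b p) * testf y_ s (xi i p))%:E =
      nu G * \int[(u i).1]_y (testf y_ s y)%:E.
    exact: (testf_product_law y_ (P := (rho \x Q)%E) mb (mxi i) (hu i).1.2 s mG).
  have nuT : nu setT = 1 by exact: probability_setT.
  (* The second marginals vary along the minimizing sequence. Their test integrals are eliminated by
     comparing with the full set, for which [nu] has mass 1, so that the factor [nu F] alone
     survives in the limit. *)
  have h : fine (\int[rho \x Q]_p (\1_F (b p) * testf y_ s (zeta p))%:E) =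
      (fine (nu F) * fine (\int[rho \x Q]_p (\1_setT (b p) * testf y_ s (zeta p))%:E))%R.
    rewrite -!indE.
    apply: (fine_cvg_mul limF limT) => i.
      by rewrite !toE// !prodE// nuT mul1e fineK// fin_num_measure.
    by rewrite toE//; exact: unit01.
  rewrite -[LHS]fineK; last exact: unit01.
  rewrite h EFinM !fineK ?fin_num_measure//; last exact: unit01.
  congr (_ * _); rewrite integral_law//.
  + by apply: eq_integral => p _; rewrite indicT mul1r.
  + by apply/measurable_EFinP; exact: measurable_testf.
  + by move=> y; rewrite lee_fin testf_ge0.
- exact: measurableX.
Qed.

End minimal_plan.

(** * Measurable lower bound for the fiberwise transport cost *)

(** One test function bounds from above the mass lying far from finitely many points, so control of
    test integrals by those of a fixed law transfers the tightness of that law. *)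
Lemma tight_of_testf d (B : measurableType d) (R : realType) (Y : completeMetricType R)
    (y_ : nat -> Y) (I : Type) (U : set_system I) {FU : Filter U}
    (pi : I -> probability (B * borel Y)%type R) (P : probability (borel Y) R) :
  dense_seq y_ ->
  (forall s (e : R), (0 < e)%R -> \forall i \near U,
     \int[pi i]_q (testf y_ s q.2)%:E <= \int[P]_y (testf y_ s y)%:E + e%:E) ->
  forall n (e : R), (0 < e)%R -> exists N, \forall i \near U, (1 - e)%:E <=
    pi i [set x | exists2 k, (k < N)%N & (mdist (y_ k) x.2 < rad n)%R].
Proof.
move=> y_dense h n e e0; have e20 : (0 < e / 2)%R by rewrite divr_gt0.
(* [rad (n + n.+1)] is half of [rad n]: each factor of the test function climbs from 0 to 1 between
   these two radii. *)
have [N hN] := probability_tight y_dense P (n + n.+1) e20; exists N.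
pose s := [seq (k, n.+1.*2, 1%N) | k <- iota 0 N].
have gaugeE k y : gauge y_ (k, n.+1.*2, 1%N) y =
    ((n + n.+1).+1%:R * mdist (y_ k) y - 1)%R.
  by rewrite /gauge/= -addnn addSn.
have near_measurable j := measurable_near_first y_ N (rad j : R).
have s_near y : (exists2 k, (k < N)%N & (mdist (y_ k) y < rad (n + n.+1))%R) ->
    testf y_ s y = 0%R.
  move=> [k kN yk]; rewrite /testf big_map; apply/eqP; rewrite prodf_seq_eq0.
  apply/hasP; exists k; first by rewrite mem_iota.
  rewrite /= gaugeE max_l ?min_r// subr_le0.
  by rewrite -ler_pdivlMl ?ltr0n// mulr1 ltW.
have s_far y : ~ (exists2 k, (k < N)%N & (mdist (y_ k) y < rad n)%R) ->
    testf y_ s y = 1%R.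
  move=> ny; rewrite /testf big_map big_seq big1// => k; rewrite mem_iota/= => kN.
  rewrite gaugeE min_l// le_max; apply/orP; right.
  have : (rad n <= mdist (y_ k) y)%R.
    by rewrite leNgt; apply/negP => yk; apply: ny; exists k.
  rewrite -(@ler_pM2l _ (n.+1)%:R)// /rad mulfV// => h1.
  by rewrite -addSn natrD mulrDl; lra.
apply: filterS (h s _ e20) => i hi.
pose E := [set x : B * borel Y | exists2 k, (k < N)%N & (mdist (y_ k) x.2 < rad n)%R].
have mE : measurable E.
  rewrite (_ : E = snd @^-1` [set y | exists2 k, (k < N)%N & (mdist (y_ k) y < rad n)%R])//.
  by rewrite -[X in measurable X]setTI; exact: measurable_snd.
have mts : measurable_fun setT (fun y : borel Y => (testf y_ s y)%:E).
  by apply/measurable_EFinP; exact: measurable_testf.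
have PE : \int[P]_y (testf y_ s y)%:E <= (e / 2)%:E.
  pose D : set (borel Y) :=
    [set y | exists2 k, (k < N)%N & (mdist (y_ k) y < rad (n + n.+1))%R].
  apply: (@le_trans _ _ (\int[P]_y (\1_(~` D) y)%:E)).
    apply: ge0_le_integral => //.
    - by move=> y _; rewrite lee_fin testf_ge0.
    - apply/measurable_EFinP; apply: measurable_indic; apply: measurableC.
      exact: near_measurable.
    move=> y _; rewrite lee_fin indicE; case: (boolP (y \in _)) => yD.
      exact: testf_le1.
    rewrite s_near//; apply: contrapT => nD; move/negP : yD; apply.
    by rewrite inE.
  rewrite integral_indic//; last by apply: measurableC; exact: near_measurable.
  have mD : measurable D by exact: near_measurable.
  by rewrite [leLHS](_ : _ = P (~` D)) ?probability_setC_le// setIT.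
rewrite -probability_setC_le//.
apply: (@le_trans _ _ (\int[pi i]_q (testf y_ s q.2)%:E)).
  rewrite -[X in pi i X]setIT -integral_indic//; last exact: measurableC.
  apply: ge0_le_integral => //.
  - by apply/measurable_EFinP; apply: measurable_indic; exact: measurableC.
  - exact: measurableT_comp mts measurable_snd.
  move=> q _; rewrite lee_fin indicE; case: (boolP (q \in _)) => qE.
    by rewrite s_far//; move: qE; rewrite inE.
  by rewrite testf_ge0.
apply: (le_trans hi); rewrite [leRHS](_ : _ = (e / 2)%:E + (e / 2)%:E); first exact: leeD.
by rewrite -EFinD -splitr.
Qed.

Lemma measurable_countable_patch d d' (T : measurableType d) (T' : measurableType d')
    (a : T -> nat) (f : nat -> T -> T') :
  (forall i, measurable (a @^-1` [set i])) ->
  (forall i, measurable_fun [set: T] (f i)) ->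
  measurable_fun [set: T] (fun t => f (a t) t).
Proof.
move=> ma mf _ A mA; rewrite setTI.
rewrite (_ : _ @^-1` A = \bigcup_i (a @^-1` [set i] `&` f i @^-1` A)).
  apply: bigcupT_measurable => i; apply: measurableI => //.
  by rewrite -[X in measurable X]setTI; exact: mf.
by apply/seteqP; split=> [t At|t [i _ [/= <-]]]; first by exists (a t).
Qed.

(** A cell is the vector of integer parts of [v j z * n.+1] for [j < n], coded by a single natural
    number; equal integer parts leave a gap of at most [rad n]. *)
Lemma measurable_cells d (Z : measurableType d) (R : realType) (v : nat -> Z -> R) n :
  (forall j, measurable_fun [set: Z] (v j)) -> (forall j z, (0 <= v j z)%R) ->
  exists a : Z -> nat, (forall i, measurable (a @^-1` [set i])) /\
    forall z z' j, a z = a z' -> (j < n)%N -> (v j z <= v j z' + rad n)%R.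
Proof.
move=> mv v0; suff aux K N : exists a : Z -> nat, (forall i, measurable (a @^-1` [set i])) /\
    forall z z' j, a z = a z' -> (j < N)%N ->
      Num.truncn (v j z * K%:R) = Num.truncn (v j z' * K%:R).
  have [a [ma ha]] := aux n.+1 n; exists a; split=> // z z' j azz' jn.
  have n0 : (0 < n.+1%:R :> R)%R by rewrite ltr0n.
  have := truncnS_gt (v j z * n.+1%:R)%R; rewrite (ha _ _ _ azz' jn) => h.
  have h' : ((Num.truncn (v j z' * n.+1%:R)) %:R <= v j z' * n.+1%:R)%R.
    by rewrite truncn_le// mulr_ge0.
  rewrite -(ler_pM2r n0) mulrDl /rad mulVf ?gt_eqF//.
  by rewrite (le_trans (ltW h))// -natr1 lerD2r.
elim: N => [|N [a [ma ha]]]; first exists (fun=> 0%N).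
  split=> // i; rewrite -[X in measurable X]setTI.
  by apply: (@measurable_cst _ _ Z nat setT 0%N).
pose t z := Num.truncn (v N z * K%:R).
have mt q : measurable (t @^-1` [set q]).
  rewrite (_ : _ @^-1` _ =
      (fun z => v N z * K%:R)%R @^-1` [set` `[q%:R, q.+1%:R[%R]); last first.
    apply/seteqP; split=> z /=; rewrite in_itv/= => h.
      by rewrite -h truncn_le ?truncnS_gt// mulr_ge0.
    by apply/eqP; rewrite truncn_eq// mulr_ge0.
  rewrite -[X in measurable X]setTI.
  by have : measurable_fun setT (fun z => v N z * K%:R)%R by [apply: measurable_funM]; apply.
exists (fun z => pickle (a z, t z)); split => [i|z z' j /(pcan_inj pickleK)[azz' tz]].
  rewrite (_ : _ @^-1` _ = \bigcup_p \bigcup_q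
      if pickle (p, q) == i then a @^-1` [set p] `&` t @^-1` [set q] else set0).
    apply: bigcupT_measurable => p; apply: bigcupT_measurable => q.
    by case: ifP => // _; exact: measurableI.
  apply/seteqP; split=> [z /= <-|z [p _ [q _]]].
    by exists (a z) => //; exists (t z); rewrite ?eqxx.
  by case: ifP => // /eqP <- /= [-> ->].
by rewrite ltnS leq_eqVlt => /predU1P[->//|]; exact: ha.
Qed.

Section glue.
Context (R : realType) (X Y Z : completeMetricType R).
Context (x_ : nat -> X) (x_dense : dense_seq x_).
Context dW (W : measurableType dW) (Q : probability W R) (r : W -> R).
Hypothesis r_uniform : uniform_variable Q r.
Variables (nu : probability (borel Z) R) (mu : probability (borel Y) R).

(** All the [pi i] share the second marginal [mu], so [y] can be drawn independently of [z]; then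
    [x] is drawn from the coupling attached to the cell of [z], through the randomization of [pi i]
    over [y]. *)
Lemma glue_couplings (pi : nat -> probability (borel X * borel Y)%type R) (a : Z -> nat) :
  (forall i, same_measure (pushforward (pi i) snd) mu) ->
  (forall i, measurable (a @^-1` [set i] : set (borel Z))) ->
  exists Pi : probability (borel Z * borel Y * borel X)%type R,
    (forall F, measurable F -> Pi (F `*` setT) = (nu \x mu) F) /\
    forall G : borel Z * borel Y * borel X -> \bar R, measurable_fun setT G ->
      (forall q, 0 <= G q) ->
      \int[Pi]_q G q = \int[nu]_z \int[pi (a z)]_p G ((z, p.2), p.1).
Proof.
move=> pi2 ma.
have mswap : measurable_fun setT (fun p : borel X * borel Y => (p.2, p.1)).
  exact: measurable_fun_pair measurable_snd measurable_fst.
have marg i F : measurable F -> law (pi i) mswap (F `*` setT) = mu F.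
  move=> mF; rewrite -(pi2 i)//; congr (pi i _).
  by apply/seteqP; split=> p /= => [[]|].
have [zeta hz] := boolp.choice (fun i => randomization x_dense r_uniform (marg i)).
pose g (q : borel Z * borel Y * W) := zeta (a q.1.1) (q.1.2, q.2).
have mg : measurable_fun setT g.
  pose f i (q : borel Z * borel Y * W) := zeta i (q.1.2, q.2).
  apply: (@measurable_countable_patch _ _ (borel Z * borel Y * W)%type (borel X)
    (fun q => a q.1.1) f) => i.
    rewrite (_ : _ @^-1` _ = ((a @^-1` [set i]) `*` setT) `*` setT); last first.
      by apply/seteqP; split=> q /= => [|[[]]].
    by do 2 apply: measurableX => //.
  apply: measurableT_comp (hz i).1 _; apply: measurable_fun_pair => //.
  exact: measurableT_comp measurable_snd measurable_fst.
have mh : measurable_fun setT (fun q : borel Z * borel Y * W => (q.1, g q)).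
  exact: measurable_fun_pair measurable_fst mg.
exists (law ((nu \x mu) \x Q) mh); split.
  move=> F mF; transitivity (((nu \x mu) \x Q) (F `*` setT)).
    by congr ((_ \x _) _); apply/seteqP; split=> q /= => [[]|[]].
  exact: (product_probability_setT (nu \x mu)%E).
move=> G mG G0; rewrite integral_law//.
have mG1 : measurable_fun setT (fun q : borel Z * borel Y * W => G (q.1, g q)).
  exact: measurableT_comp mG mh.
rewrite fubini_tonelli1//.
rewrite fubini_tonelli1//; last 2 first.
- by apply: measurable_fun_fubini_tonelli_F.
- by move=> q; apply: integral_ge0 => w _.
apply: eq_integral => z _; rewrite /fubini_F/=.
have mGz : measurable_fun setT (fun q : borel Y * borel X => G ((z, q.1), q.2)).
  apply: measurableT_comp mG _; apply: measurable_fun_pair; last exact: measurable_snd.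
  exact: measurable_fun_pair.
have mzeta : measurable_fun setT (fun q : borel Y * W => (q.1, zeta (a z) q)).
  exact: measurable_fun_pair measurable_fst (hz _).1.
transitivity (\int[mu \x Q]_q G ((z, q.1), zeta (a z) q)).
  rewrite fubini_tonelli1//.
  exact: measurableT_comp mGz mzeta.
transitivity (\int[law (mu \x Q) mzeta]_q G ((z, q.1), q.2)).
  by rewrite integral_law.
transitivity (\int[law (pi (a z)) mswap]_q G ((z, q.1), q.2)); last by rewrite integral_law.
by apply: eq_measure_integral => A mA _; apply/esym; exact: (hz (a z)).2.
Qed.

End glue.

Section lower_bound.
Context (R : realType) (X Y Z : completeMetricType R).
Context (x_ : nat -> X) (x_dense : dense_seq x_) (y_ : nat -> Y) (y_dense : dense_seq y_).
Context dW (W : measurableType dW) (Q : probability W R) (r : W -> R).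
Hypothesis r_uniform : uniform_variable Q r.
Variables (rho : probability (borel X * borel Z)%type R).
Variables (nu : probability (borel Z) R) (k : R.-pker (borel Z) ~> (borel X)).
Hypothesis hrho : disintegration rho nu k.
Variables (c : X * Y -> R) (c_cont : continuous c) (m : R).
Hypothesis c_ge : forall p, (m <= c p)%R.
Variable mu : probability (borel Y) R.

Let cost0 (pi : probability (borel X * borel Y)%type R) : \bar R :=
  \int[pi]_p (c (p.1, p.2) - m)%:E.

Let cost0_ge0 pi : 0 <= cost0 pi.
Proof. by apply: integral_ge0 => p _; exact: cost_ge0. Qed.

Lemma transport_cost_shift pi : transport_cost c pi = cost0 pi + m%:E.
Proof.
rewrite /transport_cost -(integral_cost y_dense c_cont c_ge pi measurable_fst measurable_snd).
by apply: eq_integral => -[].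
Qed.

Lemma product_coupling z : coupling (k z) mu (pker_probability k z \x mu)%E.
Proof.
split=> A mA.
  transitivity ((pker_probability k z \x mu) (A `*` setT)).
    by congr ((_ \x _) _); apply/seteqP; split=> p /= => [?|[]].
  exact: (product_probability_setT (pker_probability k z)).
transitivity ((pker_probability k z \x mu) (setT `*` A)).
  by congr ((_ \x _) _); apply/seteqP; split=> p /= => [?|[]].
transitivity (pker_probability k z setT * mu A); first exact: product_measure1E.
by rewrite [X in X * _](_ : _ = 1) ?mul1e//; exact: probability_setT.
Qed.

(** The infimum is taken over the couplings of all fibers of a cell at once. The chosen coupling is
    thus cheaper, up to [e], than any coupling over any [z] of the cell, but its first marginal is
    [k z'] for some unspecified [z'] of the cell. *)
Lemma near_optimal_couplings (a : Z -> nat) (e : R) : (0 < e)%R ->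
  exists pi : nat -> probability (borel X * borel Y)%type R,
    (forall i, same_measure (pushforward (pi i) snd) mu) /\
    forall z, (exists z', a z' = a z /\ coupling (k z') mu (pi (a z))) /\
      forall pi', coupling (k z) mu pi' -> cost0 (pi (a z)) <= cost0 pi' + e%:E.
Proof.
move=> e0; suff h i : exists pi : probability (borel X * borel Y)%type R,
    same_measure (pushforward pi snd) mu /\
    forall z, a z = i -> (exists z', a z' = i /\ coupling (k z') mu pi) /\
      forall pi', coupling (k z) mu pi' -> cost0 pi <= cost0 pi' + e%:E.
  have [pi hpi] := boolp.choice h; exists pi; split=> [i|z].
    exact: (hpi i).1.
  exact: (hpi (a z)).2.
have [[z0 z0i]|nz] := pselect (exists z, a z = i); last first.
  exists (pker_probability k point \x mu)%E; split; first exact: (product_coupling point).2.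
  by move=> z zi; exfalso; apply: nz; exists z.
pose S := [set w | exists z pi, [/\ a z = i, coupling (k z) mu pi & cost0 pi = w]].
suff [pi [z [zi cpi hpi]]] : exists pi z, [/\ a z = i, coupling (k z) mu pi &
    forall w, S w -> cost0 pi <= w + e%:E].
  exists pi; split; first exact: cpi.2.
  move=> z' z'i; split; first by exists z.
  by move=> pi' cpi'; apply: hpi; exists z', pi'.
have S0 : 0 <= ereal_inf S.
  by apply: le_ereal_inf_tmp => _ [z [pi [_ _ <-]]]; exact: cost0_ge0.
have [Soo|Sfin] := eqVneq (ereal_inf S) +oo.
  exists (pker_probability k z0 \x mu)%E, z0; split=> //; first exact: product_coupling.
  move=> w Sw; have : ereal_inf S <= w by exact: ereal_inf_lbound.
  by rewrite Soo leye_eq => /eqP ->; rewrite addye// leey.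
have Sf : ereal_inf S \is a fin_num by rewrite ge0_fin_numE// ltey.
have [_ [z [pi [zi cpi <-]]] hw] := lb_ereal_inf_adherent e0 Sf.
exists pi, z; split=> // w Sw; apply: (le_trans (ltW hw)).
by rewrite leeD2r//; exact: ereal_inf_lbound.
Qed.

Let s_ j : seq (nat * nat * nat) := odflt [::] (unpickle j).

(** Countably many coordinates that determine the measure [k z]; cells on which the first [n] of
    them are nearly constant cut [Z]. *)
Let v j z : R := fine (\int[k z]_x (testf x_ (s_ j) x)%:E).

Let mtest s : measurable_fun [set: borel X] (fun x : borel X => (testf x_ s x)%:E).
Proof. by apply/measurable_EFinP; exact: measurable_testf. Qed.

Let test_ge0 s x : 0 <= (testf x_ s x)%:E.
Proof. by rewrite lee_fin testf_ge0. Qed.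

Let test01 s x : (0 <= testf x_ s x <= 1)%R.
Proof. by rewrite testf_ge0 testf_le1. Qed.

Let vE j z : (v j z)%:E = \int[k z]_x (testf x_ (s_ j) x)%:E.
Proof.
rewrite fineK//; apply: (integral_unit_fin_num (pker_probability k z)) => //.
exact: measurable_testf.
Qed.

Let v_ge0 j z : (0 <= v j z)%R.
Proof. by rewrite -lee_fin vE; apply: integral_ge0 => x _. Qed.

Let mv j : measurable_fun [set: borel Z] (v j).
Proof.
apply/measurable_EFinP; rewrite (_ : EFin \o v j = fun z => \int[k z]_x (testf x_ (s_ j) x)%:E).
  apply: (measurable_kernel_integral k (f := fun p => (testf x_ (s_ j) p.1)%:E)) => //.
  exact: measurableT_comp (mtest _) measurable_fst.
by apply/funext => z; exact: vE.
Qed.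

(** Gluing near-optimal couplings over the cells trades exactness of the [X]-marginal, off by at
    most [rad n] on the first [n] test functions, for a cost [h] that is constant on cells, hence
    measurable in [z]. *)
Lemma approximate_coupling n :
  exists (h : borel Z -> \bar R) (Pi : probability (borel Z * borel Y * borel X)%type R),
  [/\ measurable_fun setT h, (forall z, 0 <= h z),
      (forall z pi, coupling (k z) mu pi -> h z <= cost0 pi + (rad n)%:E),
      (forall F, measurable F -> Pi (F `*` setT) = (nu \x mu) F) &
      \int[Pi]_q (c (q.2, q.1.2) - m)%:E = \int[nu]_z h z /\
      forall F j, measurable F -> (j < n)%N ->
      (`|fine (\int[Pi]_q (\1_F q.1.1 * testf x_ (s_ j) q.2)%:E) -
         fine (\int[rho]_p (\1_F p.2 * testf x_ (s_ j) p.1)%:E)| <= rad n)%R].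
Proof.
have [a [ma ha]] := measurable_cells n mv v_ge0.
have [pi [pi2 hpi]] := near_optimal_couplings a (rad_gt0 R n).
have [Pi [Pi_marg Pi_int]] := glue_couplings x_dense r_uniform nu pi2 ma.
pose h z := cost0 (pi (a z)).
exists h, Pi; split=> //.
- apply: (@measurable_countable_patch _ _ (borel Z) _ a (fun i _ => cost0 (pi i)) ma).
  by move=> i; exact: measurable_cst.
- by move=> z; exact: cost0_ge0.
- by move=> z pi' cpi; exact: (hpi z).2.
split.
  rewrite Pi_int//.
    apply: (measurable_cost y_dense c_cont).
      exact: measurable_snd.
    exact: measurableT_comp measurable_snd measurable_fst.
  by move=> q; exact: cost_ge0.
move=> F j mF jn.
pose tau z : R := fine (\int[pi (a z)]_p (testf x_ (s_ j) p.1)%:E).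
have tauE z : (tau z)%:E = \int[pi (a z)]_p (testf x_ (s_ j) p.1)%:E.
  rewrite fineK//; apply: integral_unit_fin_num => //.
  by apply: measurableT_comp measurable_fst; exact: measurable_testf.
have tau_v z : (`|tau z - v j z| <= rad n)%R.
  have [[z' [azz' cz']] _] := hpi z.
  have -> : tau z = v j z'.
    apply: EFin_inj; rewrite tauE vE.
    have m1 : measurable_fun setT (@fst (borel X) (borel Y)) by exact: measurable_fst.
    transitivity (\int[law (pi (a z)) m1]_x (testf x_ (s_ j) x)%:E).
      by rewrite integral_law.
    by apply: eq_measure_integral => A mA _; exact: cz'.1.
  by rewrite ler_distl lerBlDr !ha.
have mtau : measurable_fun setT tau.
  apply: (@measurable_countable_patch _ _ (borel Z) _ a
    (fun i _ => fine (\int[pi i]_p (testf x_ (s_ j) p.1)%:E)) ma).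
  by move=> i; exact: measurable_cst.
have tau_ge0 z : (0 <= tau z)%R.
  by rewrite -lee_fin tauE; apply: integral_ge0 => p _.
have Pi_tau : \int[Pi]_q (\1_F q.1.1 * testf x_ (s_ j) q.2)%:E =
    \int[nu]_z (\1_F z * tau z)%:E.
  rewrite Pi_int.
  - apply: eq_integral => z _ /=; rewrite EFinM tauE -ge0_integralZl_EFin//.
    exact: measurableT_comp (mtest _) measurable_fst.
  - apply/measurable_EFinP; apply: measurable_funM.
      apply: measurableT_comp (measurableT_comp measurable_fst measurable_fst).
      exact: measurable_indic.
    by apply: measurableT_comp measurable_snd; exact: measurable_testf.
  - by move=> q; rewrite lee_fin mulr_ge0// testf_ge0.
have rho_v : \int[rho]_p (\1_F p.2 * testf x_ (s_ j) p.1)%:E =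
    \int[nu]_z (\1_F z * v j z)%:E.
  rewrite (disintegration_integral x_dense r_uniform hrho).
  - apply: eq_integral => z _ /=; rewrite EFinM vE -ge0_integralZl_EFin//.
  - apply/measurable_EFinP; apply: measurable_funM.
      by apply: measurableT_comp measurable_snd; exact: measurable_indic.
    by apply: measurableT_comp measurable_fst; exact: measurable_testf.
  - by move=> q; rewrite lee_fin mulr_ge0// testf_ge0.
rewrite Pi_tau rho_v.
have ind01 z : (0 <= (\1_F z : R) <= 1)%R.
  by rewrite indicE; case: (_ \in _); rewrite /= ?ler01 lexx.
have mind : measurable_fun setT (\1_F : borel Z -> R) by exact: measurable_indic.
have le1 (f g : borel Z -> R) : measurable_fun setT f -> measurable_fun setT g ->
    (forall z, 0 <= f z <= 1)%R -> (forall z, 0 <= g z <= 1)%R ->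
    (forall z, `|f z - g z| <= rad n)%R ->
    (fine (\int[nu]_z (\1_F z * f z)%:E) <= fine (\int[nu]_z (\1_F z * g z)%:E) + rad n)%R.
  move=> mf mg f01 g01 fg.
  have fin (f' : borel Z -> R) : measurable_fun setT f' -> (forall z, 0 <= f' z <= 1)%R ->
      \int[nu]_z (\1_F z * f' z)%:E \is a fin_num.
    move=> mf' f'01; apply: integral_unit_fin_num; first exact: measurable_funM.
    move=> z; have /andP[? ?] := f'01 z; have /andP[? ?] := ind01 z.
    by rewrite mulr_ge0// mulr_ile1.
  rewrite -lee_fin EFinD !fineK ?fin//.
  rewrite (_ : _ + _ = \int[nu]_z (\1_F z * g z + rad n)%:E).
    apply: le_integral_pointwise => z; rewrite lee_fin.
    have := fg z; rewrite ler_distl indicE => /andP[_ fgz].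
    by case: (z \in F); rewrite /= ?mul1r// !mul0r add0r ltW// rad_gt0.
  rewrite [RHS](integral_shift nu (m := rad n)).
  - by congr (_ + _); apply: eq_integral => z _; rewrite addrK.
  - by apply: measurable_funD => //; exact: measurable_funM.
  - move=> z; rewrite lerDr mulr_ge0//.
    by case/andP: (g01 z).
have v01 z : (0 <= v j z <= 1)%R.
  rewrite v_ge0/= -lee_fin vE -(integral_probability_cst (pker_probability k z)).
  by apply: le_integral_pointwise => x; rewrite lee_fin testf_le1.
have tau01 z : (0 <= tau z <= 1)%R.
  rewrite tau_ge0/= -lee_fin tauE -(integral_probability_cst (pi (a z))).
  by apply: le_integral_pointwise => x; rewrite lee_fin testf_le1.
rewrite ler_distl lerBlDr; apply/andP; split; apply: le1 => //.
by move=> z; rewrite distrC.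
Qed.

(** The minorant [h] replaces [Ic c (k z) mu], whose measurability in [z] is not established. A
    limit of the approximate couplings has the exact marginals, so it yields a plan, of cost at
    least [w] and at most the integral of [h]. *)
Lemma transport_lower_bound (w : \bar R) :
  (forall mu' xi', plan Q rho nu mu' xi' -> w <= plan_cost Q rho c m xi') ->
  exists h : borel Z -> \bar R, [/\ measurable_fun setT h, (forall z, 0 <= h z),
    (forall z, h z + m%:E <= Ic c (k z) mu) & w <= \int[nu]_z h z].
Proof.
move=> w_le.
have [h /boolp.choice[Pi hPi]] := boolp.choice approximate_coupling.
(* [esups] at 0 is the supremum over all [n]. Subtracting [rad n] puts each term below the shifted
   cost of every coupling of [k z] and [mu]. *)
pose h0 z := esups (fun n => maxe 0 (h n z - (rad n)%:E)) 0%N.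
have h0P n z : maxe 0 (h n z - (rad n)%:E) <= h0 z.
  by apply: ereal_sup_ubound; exists n.
have h_h0 n z : h n z <= h0 z + (rad n)%:E.
  rewrite -leeBlDr//; apply: le_trans (h0P n z); rewrite le_max lexx orbT//.
have h0_ge0 z : 0 <= h0 z by apply: le_trans (h0P 0%N z); rewrite le_max lexx.
have mh0 : measurable_fun setT h0.
  apply: measurable_fun_esups => n; apply: measurable_maxe => //.
  by apply: emeasurable_funB => //; case: (hPi n).
exists h0; split=> //.
  move=> z; apply: le_ereal_inf_tmp => _ [pi cpi <-].
  rewrite transport_cost_shift leeD2r//; apply: ge_ereal_sup => _ [n _ <-].
  rewrite ge_max; apply/andP; split; first exact: cost0_ge0.
  rewrite leeBlDr//.
  by have [_ _ hle _ _] := hPi n; exact: hle.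
have [->|h0oo] := eqVneq (\int[nu]_z h0 z) +oo; first exact: leey.
have h0fin : \int[nu]_z h0 z \is a fin_num.
  by rewrite ge0_fin_numE ?ltey//; exact: integral_ge0.
have [U [UU hU]] := @ultraFilterLemma nat \oo _.
have late (N : nat) : \forall n \near U, (N <= n)%N by apply: hU; exists N.
have marg n F : measurable F -> Pi n (F `*` setT) = (nu \x mu) F.
  by case: (hPi n) => _ _ _ + _; apply.
have lim_test F j : measurable F ->
    fine (\int[Pi n]_q (\1_F q.1.1 * testf x_ (s_ j) q.2)%:E) @[n --> U] -->
    fine (\int[rho]_p (\1_F p.2 * testf x_ (s_ j) p.1)%:E).
  move=> mF; apply/cvgrPdist_le => e e0; have [N hN] := rad_small e0.
  apply: filterS2 (late N) (late j.+1) => n Nn jn.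
  have [_ _ _ _ [_ /(_ F j mF jn) h1]] := hPi n.
  by rewrite distrC (le_trans h1)// ltW// hN.
have s_pickle s : s_ (pickle s) = s by rewrite /s_ pickleK.
have mx : measurable_fun setT (fun p : borel X * borel Z => p.1) by exact: measurable_fst.
(* The [X]-components are tight because their test integrals converge to those of the [X]-marginal
   of [rho]. *)
have tight : forall n (e : R), (0 < e)%R -> exists N, \forall i \near U, (1 - e)%:E <=
    Pi i [set q | exists2 k, (k < N)%N & (mdist (x_ k) q.2 < rad n)%R].
  apply: (tight_of_testf (P := law rho mx)) => // s e e0.
  have := lim_test setT (pickle s) measurableT => /cvgrPdist_le/(_ e e0).
  apply: filterS => i; rewrite s_pickle ler_distl => /andP[+ _].
  have int1 d (T : measurableType d) (P : probability T R) (b : T -> borel Z)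
      (f : T -> borel X) :
      \int[P]_t (\1_setT (b t) * testf x_ s (f t))%:E = \int[P]_t (testf x_ s (f t))%:E.
    by apply: eq_integral => t _; rewrite indicT mul1r.
  have fin d (T : measurableType d) (P : probability T R) (f : T -> borel X) :
      measurable_fun setT f -> \int[P]_t (testf x_ s (f t))%:E \is a fin_num.
    move=> mf; apply: integral_unit_fin_num => //.
    by apply: measurableT_comp mf; exact: measurable_testf.
  have lawE : \int[law rho mx]_y (testf x_ s y)%:E = \int[rho]_p (testf x_ s p.1)%:E.
    by rewrite integral_law.
  rewrite !int1 lawE => h1.
  rewrite -[leLHS]fineK; last by apply: fin; exact: measurable_snd.
  rewrite -[X in _ <= X + _]fineK; last exact: fin.
  by rewrite -EFinD lee_fin; move: h1; rewrite lerBlDr.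
have [xi [mxi xiP]] := limit_law x_dense r_uniform (UU := UU) marg tight.
pose PQ : probability _ R := (((nu \x mu)%E : probability _ R) \x Q)%E.
have mz : measurable_fun setT (fun q : borel Z * borel Y * W => q.1.1).
  exact: measurableT_comp measurable_fst measurable_fst.
have my : measurable_fun setT (fun q : borel Z * borel Y * W => q.1.2).
  exact: measurableT_comp measurable_snd measurable_fst.
have zxE A : measurable A ->
    PQ ((fun q => (q.1.1, xi q)) @^-1` A) = rho ((fun p => (p.2, p.1)) @^-1` A).
  apply: (joint_law_unique x_dense) => // F s mF.
  have mFZ : measurable (F `*` setT : set (borel Z * borel Y)) by exact: measurableX.
  have cF := caratheodory_indic_testf x_ s mFZ.
  have F01 q := indic_testf01 x_ (F `*` setT : set (borel Z * borel Y)) s q.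
  have limF := limit_law_cvg x_dense (UU := UU) mxi xiP cF F01.
  have lim' := lim_test F (pickle s) mF; rewrite s_pickle in lim'.
  have indE d (T : measurableType d) (P : probability T R) (b : T -> borel Z * borel Y)
      (f : T -> borel X) : \int[P]_t (\1_(F `*` setT) (b t) * testf x_ s (f t))%:E =
      \int[P]_t (\1_F (b t).1 * testf x_ s (f t))%:E.
    apply: eq_integral => t _; rewrite !indicE; congr ((nat_of_bool _)%:R * _)%:E.
    by apply/idP/idP; rewrite !inE; [case|split].
  have fin d (T : measurableType d) (P : probability T R) (b : T -> borel Z)
      (f : T -> borel X) : measurable_fun setT b -> measurable_fun setT f ->
      \int[P]_t (\1_F (b t) * testf x_ s (f t))%:E \is a fin_num.
    move=> mb mf; apply: integral_unit_fin_num.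
      apply: measurable_funM; first by apply: measurableT_comp mb; exact: measurable_indic.
      by apply: measurableT_comp mf; exact: measurable_testf.
    by move=> t; exact: (indic_testf01 x_ F s (b t, f t)).
  rewrite -[LHS]fineK; last exact: fin.
  rewrite -[RHS]fineK; last by apply: fin => //; exact: measurable_snd.
  congr EFin; apply: (cvg_unique _ _ lim') => //.
  rewrite /= -(indE _ _ PQ (fun q => q.1) xi).
  rewrite [X in X @ _](_ : _ = fun i =>
    fine (\int[Pi i]_x (\1_(F `*` setT) x.1 * testf x_ s x.2)%:E))//.
  by apply/funext => i; rewrite indE.
have PQ_rect B C : measurable B -> measurable C ->
    PQ [set q | B q.1.2 /\ C q.1.1] = mu B * nu C.
  move=> mB mC; transitivity (PQ ((C `*` B) `*` setT)).
    by congr (PQ _); apply/seteqP; split=> q /= => [[]|[[]]].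
  transitivity ((nu \x mu)%E (C `*` B)).
    by apply: (product_probability_setT (nu \x mu)%E); exact: measurableX.
  by rewrite muleC; exact: product_measure1E.
have xzE A : measurable A -> PQ ((fun q => (xi q, q.1.1)) @^-1` A) = rho A.
  have mswap : measurable_fun setT (fun p : borel Z * borel X => (p.2, p.1)).
    exact: measurable_fun_pair measurable_snd measurable_fst.
  move=> mA; have mA' : measurable ((fun p : borel Z * borel X => (p.2, p.1)) @^-1` A).
    by rewrite -[X in measurable X]setTI; exact: mswap.
  transitivity (PQ ((fun q => (q.1.1, xi q)) @^-1` ((fun p => (p.2, p.1)) @^-1` A))).
    by [].
  by rewrite zxE//; congr (rho _); apply/seteqP; split=> -[].
(* The limit samples [x] from [(z, y, w)], whereas a plan samples [y] from [(x, z, w)]; passing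
   through the joint law on [X * Y * Z] exchanges the roles. *)
have [P [P_bary P_cost]] :=
  barycentric_coupling_law y_dense c_cont c_ge mxi my mz xzE PQ_rect.
have [mu' [xi' [plan' cost']]] := plan_of_coupling y_dense r_uniform hrho c_cont c_ge P_bary.
apply: (le_trans (w_le _ _ plan')).
have -> : plan_cost Q rho c m xi' = \int[PQ]_q (c (xi q, q.1.2) - m)%:E.
  by move: P_cost; rewrite cost' => /(congr1 (fun e => e - m%:E)); rewrite !addeK.
apply/lee_addgt0Pr => e e0; rewrite -[X in X + _]fineK// -EFinD.
apply: (xiP (fun q => c (q.2, q.1.2) - m)%R).
- split=> [x|b].
    apply: measurable_funB => //.
    apply: (measurableT_comp (f := (fun y => c (x, y)) : borel Y -> R)).
      by apply: continuous_borel_measurable; exact: continuous_pair1.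
    exact: measurable_snd.
  by move=> x; apply: cvgB; [exact: continuous_pair2|exact: cvg_cst].
- by move=> q; rewrite subr_ge0.
have [N hN] := rad_small e0; apply: filterS (late N) => n Nn.
have [mhn hn0 _ _ [-> _]] := hPi n.
apply: (@le_trans _ _ (\int[nu]_z (h0 z + (rad n)%:E))).
  exact: le_integral_pointwise.
rewrite ge0_integralD//; last by move=> z _; rewrite lee_fin ltW// rad_gt0.
rewrite integral_probability_cst EFinD fineK// leeD2l// lee_fin ltW// hN//.
Qed.

End lower_bound.

(** * Freezing the noise *)

Lemma ae_eq_of_integral_le d (T : measurableType d) (R : realType) (P : probability T R)
    (f g : T -> \bar R) :
  measurable_fun [set: T] f -> measurable_fun [set: T] g ->
  (forall t, 0 <= f t) -> (forall t, 0 <= g t) -> {ae P, forall t, f t <= g t} ->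
  \int[P]_t g t <= \int[P]_t f t -> \int[P]_t g t < +oo -> {ae P, forall t, f t = g t}.
Proof.
move=> mf mg f0 g0 fg gf goo.
have int_fg : \int[P]_t f t <= \int[P]_t g t.
  by apply: ae_ge0_le_integral => //; apply: filterS fg => t ft _.
have fgE : \int[P]_t f t = \int[P]_t g t by apply/eqP; rewrite eq_le int_fg gf.
have intg : P.-integrable setT g.
  by apply/integrableP; split=> //; under eq_integral do rewrite gee0_abs//.
have intf : P.-integrable setT f.
  by apply/integrableP; split=> //; under eq_integral do rewrite gee0_abs//; rewrite fgE.
have gfin : \int[P]_t g t \is a fin_num by rewrite ge0_fin_numE//; exact: integral_ge0.
have aef := integrable_ae measurableT intf.
have aeg := integrable_ae measurableT intg.
have mgf : measurable_fun setT (g \- f) by exact: emeasurable_funB.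
have : \int[P]_t `|(g \- f) t| = 0.
  transitivity (\int[P]_t (g \- f) t); last by rewrite integralB// fgE subee.
  apply: ae_eq_integral => //; first exact: measurableT_comp.
  apply: filterS2 fg aef => t ft /(_ Logic.I) ff _.
  by rewrite gee0_abs//= sube_ge0// ff.
move/(ae_eq_integral_abs P measurableT mgf).1.
apply: filterS3 aef aeg => t /(_ Logic.I) ff /(_ Logic.I) gf' /(_ Logic.I) /=.
rewrite -(fineK ff) -(fineK gf') -EFinB => -[/eqP].
by rewrite subr_eq0 => /eqP ->.
Qed.

Lemma measurable_mdist_fun d (T : measurableType d) (R : realType) (Y : completeMetricType R)
    (y_ : nat -> Y) (f g : T -> borel Y) : dense_seq y_ ->
  measurable_fun [set: T] f -> measurable_fun [set: T] g ->
  measurable_fun [set: T] (fun t => (mdist (f t : Y) (g t))%:E).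
Proof.
move=> y_dense mf mg.
have cd : caratheodory (fun p : borel Y * borel Y => mdist (p.1 : Y) p.2).
  split=> [y|y]; last exact: mdist_continuous.
  rewrite (_ : (fun b => _) = mdist (y : Y)); first exact: measurable_mdist.
  by apply/funext => b; rewrite (@metric_sym).
apply/measurable_EFinP.
exact: (measurableT_comp (caratheodory_measurable y_dense cd) (measurable_fun_pair mf mg)).
Qed.

Section monge_plan.
Context (R : realType) (X Y Z : completeMetricType R).
Context (x_ : nat -> X) (x_dense : dense_seq x_) (y_ : nat -> Y) (y_dense : dense_seq y_).
Context dW (W : measurableType dW) (Q : probability W R) (r : W -> R).
Hypothesis r_uniform : uniform_variable Q r.
Variables (rho : probability (borel X * borel Z)%type R).
Variables (nu : probability (borel Z) R) (k : R.-pker (borel Z) ~> (borel X)).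
Hypothesis hrho : disintegration rho nu k.
Variables (c : X * Y -> R) (c_cont : continuous c) (m : R).
Hypothesis c_ge : forall p, (m <= c p)%R.
Variables (mu : probability (borel Y) R) (xi : borel X * borel Z * W -> borel Y).
Hypothesis xi_plan : plan Q rho nu mu xi.

(** Almost everywhere [h z + m] is below [Ic], itself below the cost of the section, while the
    integral of [h] is at least that of the section cost, which is finite. All three therefore agree
    at almost every [z]. *)
Lemma plan_section_optimal :
  (forall mu' xi', plan Q rho nu mu' xi' ->
     plan_cost Q rho c m xi <= plan_cost Q rho c m xi') ->
  plan_cost Q rho c m xi < +oo ->
  {ae nu, forall z, optimal_coupling c (k z) mu (plan_section k xi_plan z)}.
Proof.
move=> xi_min xi_fin.
have [h [mh h0 hIc xih]] :=
  transport_lower_bound x_dense y_dense r_uniform hrho c_cont c_ge mu xi_min.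
pose g := section_cost Q k c m xi.
have intg : \int[nu]_z g z = plan_cost Q rho c m xi.
  exact: (integral_section_cost x_dense y_dense r_uniform hrho c_cont c_ge xi_plan).
have coup := coupling_section x_dense y_dense r_uniform hrho xi_plan.
have costE z := transport_cost_section y_dense k c_cont c_ge xi_plan z.
have Ic_le z : coupling (k z) mu (plan_section k xi_plan z) ->
    Ic c (k z) mu <= g z + m%:E.
  by move=> cz; rewrite -costE; apply: ereal_inf_lbound; exists (plan_section k xi_plan z).
have hg : {ae nu, forall z, h z = g z}.
  apply: ae_eq_of_integral_le => //.
  - exact: (measurable_section_cost y_dense k c_cont c_ge xi_plan).
  - by move=> z; exact: section_cost_ge0.
  - by apply: filterS coup => z /Ic_le hz; have := le_trans (hIc z) hz; rewrite leeD2rE.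
  - by rewrite intg.
  - by rewrite intg.
apply: filterS2 coup hg => z cz hgz; split=> //.
by apply/eqP; rewrite eq_le costE Ic_le// andbT -/(g z) -hgz hIc.
Qed.

Lemma deterministic_plan :
  {ae nu, forall z, optimal_coupling c (k z) mu (plan_section k xi_plan z)} ->
  {ae nu, forall z, unique_monge_coupling c (k z) mu} ->
  exists T : borel X * borel Z -> borel Y, measurable_fun [set: borel X * borel Z] T /\
    {ae rho \x Q, forall p, xi p = T p.1}.
Proof.
move=> opt uniq.
(* By the triangle inequality through [T x], the mean of [D (x, z) w w'] over
   two independent noises vanishes; Tonelli then provides a noise [w0] with
   [xi (p, w) = xi (p, w0)] almost surely. *)
pose D (p : borel X * borel Z) w w' : \bar R := (mdist (xi (p, w) : Y) (xi (p, w')))%:E.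
have D0 p w w' : 0 <= D p w w' by rewrite lee_fin mdist_ge0.
have mxi := xi_plan.1.
have mD : measurable_fun setT (fun q : borel X * borel Z * W * W => D q.1.1 q.1.2 q.2).
  apply: (measurable_mdist_fun y_dense).
    apply: measurableT_comp mxi _; rewrite (_ : (fun q => _) = fst); first exact: measurable_fst.
    by apply/funext => -[[]].
  apply: measurableT_comp mxi _; apply: measurable_fun_pair; last exact: measurable_snd.
  exact: measurableT_comp measurable_fst measurable_fst.
have D_sec : {ae nu, forall z, \int[k z]_x \int[Q]_w \int[Q]_w' D (x, z) w w' = 0}.
  apply: filterS2 opt uniq => z oz [pi [_ pi_uniq [T [mT _ piT]]]].
  have mxiz : measurable_fun setT (fun p : borel X * W => xi ((p.1, z), p.2)).
    apply: measurableT_comp mxi _.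
    by apply: measurable_fun_pair => //; exact: measurable_fun_pair.
  pose f x w : \bar R := (mdist (T x : Y) (xi ((x, z), w)))%:E.
  have f0 x w : 0 <= f x w by rewrite lee_fin mdist_ge0.
  have mf : measurable_fun setT (fun p : borel X * W => f p.1 p.2).
    apply: (measurable_mdist_fun y_dense) => //.
    exact: measurableT_comp mT measurable_fst.
  have mfx x : measurable_fun setT (f x).
    exact: (measurableT_comp mf (measurable_pair1 x)).
  (* By uniqueness the section at [z] is the law of [(x, T x)], along which [G] vanishes. *)
  have If0 : \int[k z]_x \int[Q]_w f x w = 0.
    transitivity (\int[pker_probability k z \x Q]_p f p.1 p.2).
      by rewrite fubini_tonelli1.
    pose G (q : borel X * borel Y) : \bar R := (mdist (T q.1 : Y) q.2)%:E.
    have mG : measurable_fun setT G.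
      apply: (measurable_mdist_fun y_dense); last exact: measurable_snd.
      exact: measurableT_comp mT measurable_fst.
    transitivity (\int[plan_section k xi_plan z]_q G q).
      by rewrite integral_law// => q; rewrite lee_fin mdist_ge0.
    have mg : measurable_fun setT (fun x : borel X => (x, T x)) by exact: measurable_fun_pair.
    transitivity (\int[law (pker_probability k z) mg]_q G q).
      apply: eq_measure_integral => A mA _.
      by transitivity (pi A); [exact: pi_uniq|exact: piT].
    rewrite integral_law//; last by move=> q; rewrite lee_fin mdist_ge0.
    by rewrite integral0_eq// => x _; rewrite /G/= mdistxx.
  pose C x := \int[Q]_w f x w.
  have mC : measurable_fun setT C.
    exact: (measurable_fun_fubini_tonelli_F (fun p : borel X * W => f p.1 p.2)).
  have C0 x : 0 <= C x by exact: integral_ge0.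
  apply/eqP; rewrite eq_le; apply/andP; split; last first.
    by apply: integral_ge0 => x _; apply: integral_ge0 => w _; exact: integral_ge0.
  apply: (@le_trans _ _ (\int[k z]_x (C x + C x))); last first.
    by rewrite ge0_integralD// /C If0 adde0.
  apply: le_integral_pointwise => x.
  apply: (@le_trans _ _ (\int[Q]_w (f x w + C x))); last first.
    rewrite ge0_integralD// leeD2l// integral_cst// [X in _ * X](_ : _ = 1) ?mule1//.
    exact: probability_setT.
  apply: le_integral_pointwise => w.
  apply: (@le_trans _ _ (\int[Q]_w' (f x w + f x w'))).
    apply: le_integral_pointwise => w'; rewrite /D /f -EFinD lee_fin.
    by rewrite (@metric_sym _ _ (T x : Y) (xi (x, z, w))); exact: metric_triangle.
  rewrite ge0_integralD// leeD2r// integral_cst// [X in _ * X](_ : _ = 1) ?mule1//.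
  exact: probability_setT.
pose PQ : probability _ R := (rho \x Q)%E.
pose H p : \bar R := \int[Q]_w \int[Q]_w' D p w w'.
have mDw : measurable_fun setT (fun p : borel X * borel Z * W => \int[Q]_w' D p.1 p.2 w').
  apply: (measurable_fun_fubini_tonelli_F
    (fun q : borel X * borel Z * W * W => D q.1.1 q.1.2 q.2)) => // q.
have mH : measurable_fun setT H.
  apply: (measurable_fun_fubini_tonelli_F
    (fun p : borel X * borel Z * W => \int[Q]_w' D p.1 p.2 w')) => // q.
  by apply: integral_ge0 => w _.
have H0 p : 0 <= H p.
  by apply: integral_ge0 => w _; apply: integral_ge0 => w' _.
have ID : \int[PQ \x Q]_q D q.1.1 q.1.2 q.2 = 0.
  rewrite fubini_tonelli1//.
  transitivity (\int[rho]_p H p).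
    rewrite [LHS]fubini_tonelli1//.
    by move=> p; apply: integral_ge0 => w _.
  rewrite (disintegration_integral x_dense r_uniform hrho)//.
  transitivity (\int[nu]_z cst 0%E z); last by rewrite integral0.
  apply: ge0_ae_eq_integral => //.
  - exact: (measurable_kernel_integral k mH).
  - by move=> z _; apply: integral_ge0 => x _.
  - by apply: filterS D_sec => z Dz _.
have : {ae Q, forall w', \int[PQ]_p D p.1 p.2 w' = 0}.
  have mG : measurable_fun setT (fun w' => \int[PQ]_p D p.1 p.2 w').
    exact: (measurable_fun_fubini_tonelli_G (m1 := PQ)
      (fun q : borel X * borel Z * W * W => D q.1.1 q.1.2 q.2)).
  move: ID; rewrite fubini_tonelli2// => ID.
  have : \int[Q]_w' `|\int[PQ]_p D p.1 p.2 w'| = 0.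
    rewrite -[RHS]ID; apply: eq_integral => w' _; rewrite gee0_abs//.
    by apply: integral_ge0 => p _.
  by move/(ae_eq_integral_abs Q measurableT mG).1; apply: filterS => w' /(_ Logic.I).
have Q0 : 0 < Q setT by rewrite [ltRHS](_ : _ = 1) ?lte01//; exact: probability_setT.
move=> /(@filter_ex _ _ (ae_properfilter_algebraOfSetsType Q0))[w0 hw0].
exists (fun p => xi (p, w0)); split.
  by apply: measurableT_comp mxi _; exact: measurable_fun_pair.
have mD0 : measurable_fun setT (fun p : borel X * borel Z * W => D p.1 p.2 w0).
  exact: (measurableT_comp mD (measurable_pair2 w0)).
have : \int[PQ]_p `|D p.1 p.2 w0| = 0.
  by rewrite -[RHS]hw0; apply: eq_integral => p _; rewrite gee0_abs.
move/(ae_eq_integral_abs PQ measurableT mD0).1; apply: filterS => -[p w] /(_ Logic.I) [] /= /eqP.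
by move/eqP/mdist_positivity.
Qed.

Lemma monge_plan :
  (forall mu' xi', plan Q rho nu mu' xi' ->
     plan_cost Q rho c m xi <= plan_cost Q rho c m xi') ->
  plan_cost Q rho c m xi < +oo ->
  {ae nu, forall z, unique_monge_coupling c (k z) mu} ->
  exists T : borel X * borel Z -> borel Y, [/\ measurable_fun [set: borel X * borel Z] T,
    plan Q rho nu mu (fun p => T p.1) &
    plan_cost Q rho c m (fun p => T p.1) = plan_cost Q rho c m xi].
Proof.
move=> xi_min xi_fin uniq.
have [T [mT xiT]] := deterministic_plan (plan_section_optimal xi_min xi_fin) uniq.
have mT1 : measurable_fun setT (fun p : borel X * borel Z * W => T p.1).
  exact: measurableT_comp mT measurable_fst.
have mx : measurable_fun setT (fun p : borel X * borel Z * W => p.1.1).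
  exact: measurableT_comp measurable_fst measurable_fst.
have mz : measurable_fun setT (fun p : borel X * borel Z * W => p.1.2).
  exact: measurableT_comp measurable_snd measurable_fst.
exists T; split=> //; last first.
  apply: ae_eq_integral => //.
  - exact: (measurable_cost y_dense c_cont m mx mT1).
  - exact: (measurable_cost y_dense c_cont m mx xi_plan.1).
  - by apply: filterS xiT => p -> _.
split=> // A C mA mC; rewrite -xi_plan.2//.
have mAC (eta : borel X * borel Z * W -> borel Y) : measurable_fun setT eta ->
    measurable [set p | A (eta p) /\ C p.1.2].
  move=> meta; apply: measurableI.
    by rewrite -[X in measurable X]setTI; exact: meta.
  by rewrite -[X in measurable X]setTI; exact: mz.
have PE (eta : borel X * borel Z * W -> borel Y) : measurable_fun setT eta ->
    (rho \x Q) [set p | A (eta p) /\ C p.1.2] =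
    \int[rho \x Q]_p (\1_[set p | A (eta p) /\ C p.1.2] p)%:E.
  by move=> meta; rewrite integral_indic ?setIT//; exact: mAC.
rewrite !PE//; last exact: xi_plan.1.
apply: ge0_ae_eq_integral => //.
- by apply/measurable_EFinP; apply: measurable_indic; exact: mAC.
- by apply/measurable_EFinP; apply: measurable_indic; apply: mAC; exact: xi_plan.1.
apply: filterS xiT => p xip _; rewrite !indicE; congr ((nat_of_bool _)%:R)%:E.
by apply/idP/idP; rewrite !inE/= xip.
Qed.

End monge_plan.

(** * The penalized Monge problem *)

Lemma bounded_integrable d (T : measurableType d) (R : realType) (P : probability T R)
    (f : T -> R) (M : R) : measurable_fun [set: T] f -> (forall t, (`|f t| <= M)%R) ->
  P.-integrable [set: T] (EFin \o f).
Proof.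
move=> mf fM; apply: measurable_bounded_integrable => //.
  by rewrite [ltLHS](_ : _ = 1) ?ltry//; exact: probability_setT.
exists M; split; first exact: num_real.
by move=> K MK t _; exact: le_trans (fM t) (ltW MK).
Qed.

(** The integral of [f] may be infinite, so linearity is applied to the nonnegative functions
    [f - m] and [M - g]. *)
Lemma integral_sub_bounded d (T : measurableType d) (R : realType) (P : probability T R)
    (f g : T -> R) (m M : R) : measurable_fun [set: T] f -> (forall t, (m <= f t)%R) ->
  measurable_fun [set: T] g -> (forall t, (`|g t| <= M)%R) ->
  \int[P]_t (f t - g t)%:E = \int[P]_t (f t)%:E - \int[P]_t (g t)%:E.
Proof.
move=> mf fm mg gM.
have gM' t : (g t <= M)%R by exact: le_trans (ler_norm _) (gM t).
have ig := bounded_integrable P mg gM.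
have igfin : \int[P]_t (g t)%:E \is a fin_num by exact: integrable_fin_num.
have mfm : measurable_fun setT (fun t => f t - m)%R by apply: measurable_funB.
have mMg : measurable_fun setT (fun t => M - g t)%R by apply: measurable_funB.
have -> : \int[P]_t (f t - g t)%:E =
    \int[P]_t (f t - m)%:E + \int[P]_t (M - g t)%:E + (m - M)%:E.
  rewrite (integral_shift P (m := m - M)); last 2 first.
  - exact: measurable_funB.
  - by move=> t; apply: lerB.
  congr (_ + _); rewrite -ge0_integralD//.
  - by apply: eq_integral => t _; rewrite -EFinD; congr EFin; lra.
  - by move=> t _; rewrite lee_fin subr_ge0.
  - exact/measurable_EFinP.
  - by move=> t _; rewrite lee_fin subr_ge0.
  - exact/measurable_EFinP.
rewrite (integral_shift P mf fm).
have -> : \int[P]_t (M - g t)%:E = M%:E - \int[P]_t (g t)%:E.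
  under eq_integral do rewrite EFinB.
  rewrite (integralB_EFin (f1 := cst M))// ?integral_probability_cst//.
  exact: (bounded_integrable P (M := `|M|)).
rewrite -(fineK igfin).
case: (\int[P]_t (f t - m)%:E) => [A| |] //=.
rewrite -!EFinD; congr EFin; lra.
Qed.

Section monge_functional.
Context (R : realType) (X Y Z : completeMetricType R).
Context (y_ : nat -> Y) (y_dense : dense_seq y_) (z_ : nat -> Z) (z_dense : dense_seq z_).
Variables (rho : probability (borel X * borel Z)%type R) (nu : probability (borel Z) R).
Hypothesis rho_snd : same_measure (pushforward rho snd) nu.
Variables (c : X * Y -> R) (c_cont : continuous c) (m : R).
Hypothesis c_ge : forall p, (m <= c p)%R.
Variables (T : borel X * borel Z -> borel Y).
Hypothesis mT : measurable_fun [set: borel X * borel Z] T.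

Let mc : measurable_fun [set: borel X * borel Z] (fun p => c (p.1, T p)).
Proof.
have := measurable_cost y_dense c_cont m measurable_fst mT => /measurable_EFinP h.
rewrite (_ : (fun p => _) = (fun p => (c (p.1, T p) - m) + m)%R).
  by apply: measurable_funD.
by apply/funext => p; rewrite subrK.
Qed.

Let bounded_normP (S : completeMetricType R) (f : S -> R) :
  bounded_continuous f -> exists M : R, forall s, (`|f s| <= M)%R.
Proof.
move=> [_ [M [_ hM]]]; exists (M + 1)%R => s.
by apply: (hM (M + 1)%R _ s Logic.I); rewrite ltrDl.
Qed.

Let mpsi (psiY : Y -> R) (psiZ : Z -> R) :
  bounded_continuous psiY -> bounded_continuous psiZ ->
  measurable_fun [set: borel X * borel Z] (fun p => psiY (T p) * psiZ p.2)%R.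
Proof.
move=> [cY _] [cZ _]; apply: measurable_funM.
  exact: (measurableT_comp (f := psiY : borel Y -> R) (continuous_borel_measurable cY)).
exact: (measurableT_comp (f := psiZ : borel Z -> R) (continuous_borel_measurable cZ)
  measurable_snd).
Qed.

Let psi_bounded (psiY : Y -> R) (psiZ : Z -> R) :
  bounded_continuous psiY -> bounded_continuous psiZ ->
  exists M : R, forall p : borel X * borel Z, (`|psiY (T p) * psiZ p.2| <= M)%R.
Proof.
move=> /bounded_normP[M hM] /bounded_normP[N hN]; exists (M * N)%R => p.
by rewrite normrM ler_pM.
Qed.

Lemma integral_cost_psi (psiY : Y -> R) (psiZ : Z -> R) :
  bounded_continuous psiY -> bounded_continuous psiZ ->
  \int[rho]_p (c (p.1, T p) - psiY (T p) * psiZ p.2)%:E =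
  \int[rho]_p (c (p.1, T p))%:E - \int[rho]_p (psiY (T p) * psiZ p.2)%:E.
Proof.
move=> bY bZ; have [M hM] := psi_bounded bY bZ.
exact: (integral_sub_bounded rho mc (fun p => c_ge _) (mpsi bY bZ) hM).
Qed.

Lemma monge_functional_ge :
  \int[rho]_p (c (p.1, T p))%:E <= monge_functional c rho nu T.
Proof.
apply: ereal_sup_ubound; exists (fun=> 0%R), (fun=> 0%R).
have b0 (S : completeMetricType R) : bounded_continuous ((fun=> 0%R) : S -> R).
  split; first by move=> s; exact: cvg_cst.
  by exists 0%R; split=> // K K0 s _; rewrite normr0 ltW.
split=> //; first by rewrite integral0.
by apply: eq_integral => p _; rewrite mul0r subr0.
Qed.

(** For a product law the penalty factors, and its factor in [z] is the vanishing integral of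
    [psiZ]. *)
Lemma monge_functional_product (mu : probability (borel Y) R) :
  (forall A C, measurable A -> measurable C -> rho [set p | A (T p) /\ C p.2] = mu A * nu C) ->
  monge_functional c rho nu T = \int[rho]_p (c (p.1, T p))%:E.
Proof.
move=> muP; apply/eqP; rewrite eq_le monge_functional_ge andbT.
apply: ge_ereal_sup => _ [psiY [psiZ [bY bZ Z0 ->]]].
rewrite integral_cost_psi// [X in _ - X](_ : _ = 0) ?sube0//.
have mzT : measurable_fun setT (fun p : borel X * borel Z => (p.2, T p)).
  by apply: measurable_fun_pair => //; exact: measurable_snd.
have [M hM] := bounded_normP bY; have [N hN] := bounded_normP bZ.
have mY : measurable_fun setT (psiY : borel Y -> R).
  by apply: continuous_borel_measurable; exact: bY.1.
have mZ : measurable_fun setT (psiZ : borel Z -> R).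
  by apply: continuous_borel_measurable; exact: bZ.1.
pose f (q : borel Z * borel Y) : R := (psiZ q.1 * psiY q.2)%R.
have mf : measurable_fun setT f.
  apply: measurable_funM; first exact: measurableT_comp mZ measurable_fst.
  exact: measurableT_comp mY measurable_snd.
have fM q : (`|f q| <= N * M)%R by rewrite normrM ler_pM.
have mef : measurable_fun setT (EFin \o f) by exact/measurable_EFinP.
transitivity (\int[pushforward rho (fun p => (p.2, T p))]_q (EFin \o f) q).
  rewrite (integral_pushforward mzT mef)//.
    by apply: eq_integral => p _; rewrite /f/= mulrC.
  rewrite preimage_setT; apply: (bounded_integrable rho (f := f \o (fun p => (p.2, T p)))
    (M := N * M)).
    exact: measurableT_comp mf mzT.
  by move=> p; exact: fM.
transitivity (\int[nu \x mu]_q (EFin \o f) q).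
  apply: eq_measure_integral => A mA _.
  apply: (@rectangle_measure_unique _ _ _ _ _ (law rho mzT) (nu \x mu)%E) => //.
    by rewrite [X in X < _](_ : _ = 1) ?ltry//; exact: probability_setT.
  move=> C B mC mB; transitivity (nu C * mu B); last by apply/esym; exact: product_measure1E.
  rewrite muleC -muP//; congr (rho _).
  by apply/seteqP; split=> p /= [].
pose NM : probability _ R := (nu \x mu)%E.
have ifN : (nu \x mu)%E.-integrable setT (EFin \o f) by exact: (bounded_integrable NM mf fM).
rewrite -integral12_prod_meas1//.
transitivity (\int[nu]_z ((\int[mu]_y (psiY y)%:E) * (psiZ z)%:E)).
  apply: eq_integral => z _; rewrite /fubini_F/= /f/=.
  under eq_integral do rewrite EFinM.
  rewrite integralZl//; first by rewrite muleC.
  exact: (bounded_integrable mu mY hM).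
have iY := bounded_integrable mu mY hM.
have Yfin : \int[mu]_y (psiY y)%:E \is a fin_num by exact: integrable_fin_num.
rewrite -(fineK Yfin) integralZl//; last exact: (bounded_integrable nu mZ hN).
by rewrite Z0 mule0.
Qed.

Lemma monge_functional_finite : monge_functional c rho nu T < +oo ->
  forall A C, measurable A -> measurable C ->
  rho [set p | A (T p) /\ C p.2] = law rho mT A * nu C.
Proof.
move=> Foo.
have b_scaled (S : completeMetricType R) (s_ : nat -> S) s (u v : R) :
    bounded_continuous (fun y => u * testf s_ s y - v)%R.
  split=> [y|].
    by apply: cvgB; [apply: cvgM; [exact: cvg_cst|exact: testf_continuous]|exact: cvg_cst].
  exists (`|u| + `|v|)%R; split=> [|K uvK y _]; first exact: num_real.
  apply: le_trans (ltW uvK); apply: (le_trans (ler_normB _ _)); rewrite lerD2r normrM.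
  by rewrite (ger0_norm (testf_ge0 _ _ _)) ler_piMr// testf_le1.
have c_fin : \int[rho]_p (c (p.1, T p))%:E \is a fin_num.
  have h := le_lt_trans monge_functional_ge Foo.
  rewrite (integral_shift rho mc (fun p => c_ge _)).
  rewrite (integral_shift rho mc (fun p => c_ge _)) in h.
  rewrite fin_numD andbT ge0_fin_numE; last first.
    by apply: integral_ge0 => p _; rewrite lee_fin subr_ge0.
  by move: h; rewrite !ltey; apply: contraNN => /eqP ->.
have Ffin : monge_functional c rho nu T \is a fin_num.
  rewrite fin_numE; apply/andP; split; last by rewrite lt_eqF.
  by rewrite gt_eqF// (lt_le_trans _ monge_functional_ge)// ltNye_eq c_fin.
(* Subtracting its mean [a] makes the test function of [z] admissible. With the test function of [y]
   scaled by any real [u], the functional bounds an affine function of [u] from above, so the slope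
   vanishes. *)
have orth s t : let a := fine (\int[nu]_z (testf z_ t z)%:E) in
    \int[rho]_p (testf y_ s (T p) * (testf z_ t p.2 - a))%:E = 0.
  move=> a; have afin : \int[nu]_z (testf z_ t z)%:E \is a fin_num.
    apply: integral_unit_fin_num; first exact: measurable_testf.
    by move=> z; rewrite testf_ge0 testf_le1.
  set K := \int[rho]_p _.
  have bY u : bounded_continuous (fun y => u * testf y_ s y)%R.
    by have := b_scaled _ y_ s u 0%R; under eq_fun do rewrite subr0.
  have bZ : bounded_continuous (fun z => testf z_ t z - a)%R.
    by have := b_scaled _ z_ t 1%R a; under eq_fun do rewrite mul1r.
  have Z0 : \int[nu]_z (testf z_ t z - a)%:E = 0.
    under eq_integral do rewrite EFinB.
    rewrite (integralB_EFin (f2 := cst a))//.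
    - by rewrite integral_probability_cst /a fineK// subee.
    - apply: (bounded_integrable nu (M := 1)); first exact: measurable_testf.
      by move=> z; rewrite (ger0_norm (testf_ge0 _ _ _)) testf_le1.
    - exact: (bounded_integrable nu (M := `|a|)).
  have bY1 : bounded_continuous (testf y_ s : Y -> R).
    by have := bY 1%R; under eq_fun do rewrite mul1r.
  have [M hM] := psi_bounded bY1 bZ.
  have iK := bounded_integrable rho (mpsi bY1 bZ) hM.
  have Kfin : K \is a fin_num by exact: integrable_fin_num.
  have le_F u : \int[rho]_p (c (p.1, T p))%:E - u%:E * K <= monge_functional c rho nu T.
    apply: ereal_sup_ubound; exists (fun y => u * testf y_ s y)%R,
      (fun z => testf z_ t z - a)%R.
    split=> //; rewrite (integral_cost_psi (bY u) bZ); congr (_ - _).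
    rewrite -integralZl//; apply: eq_integral => p _.
    by rewrite /= -EFinM mulrA.
  apply/eqP; rewrite -(fineK Kfin); apply/eqP; congr EFin; apply: contrapT => K0.
  have /eqP K0' := K0.
  pose C0 := fine (\int[rho]_p (c (p.1, T p))%:E).
  pose F0 := fine (monge_functional c rho nu T).
  have le_F0 u : (C0 - u * fine K <= F0)%R by rewrite -lee_fin EFinB EFinM !fineK.
  (* At this [u] the left side would equal [F0 + 1]. *)
  by have := le_F0 ((C0 - F0 - 1) / fine K)%R; rewrite divfK//; lra.
have mtY s : measurable_fun setT (fun p => testf y_ s (T p)).
  by apply: measurableT_comp mT; exact: measurable_testf.
have tY01 s p : (0 <= testf y_ s (T p) <= 1)%R by rewrite testf_ge0 testf_le1.
have mtZ t : measurable_fun setT (fun p : borel X * borel Z => testf z_ t p.2).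
  by apply: measurableT_comp measurable_snd; exact: measurable_testf.
have test_eq F s : measurable F -> \int[rho]_p (\1_F p.2 * testf y_ s (T p))%:E =
    nu F * \int[law rho mT]_y (testf y_ s y)%:E.
  move=> mF; have Yfin := integral_unit_fin_num rho (mtY s) (tY01 s).
  pose b := fine (\int[rho]_p (testf y_ s (T p))%:E).
  have b0 : (0 <= b)%R.
    by apply: fine_ge0; apply: integral_ge0 => p _; rewrite lee_fin testf_ge0.
  have key t : \int[rho]_p (testf y_ s (T p) * testf z_ t p.2)%:E =
      \int[nu]_z (b * testf z_ t z)%:E.
    have Zfin : \int[nu]_z (testf z_ t z)%:E \is a fin_num.
      apply: integral_unit_fin_num; first exact: measurable_testf.
      by move=> z; rewrite testf_ge0 testf_le1.
    set a := fine (\int[nu]_z (testf z_ t z)%:E).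
    have -> : \int[nu]_z (b * testf z_ t z)%:E = (a * b)%:E.
      under eq_integral do rewrite EFinM.
      rewrite ge0_integralZl_EFin//.
      - by rewrite (mulrC a) EFinM; congr (_ * _); rewrite /a fineK.
      - by move=> z _; rewrite lee_fin testf_ge0.
      - by apply/measurable_EFinP; exact: measurable_testf.
    have YZ01 p : (`|testf y_ s (T p) * testf z_ t p.2| <= 1)%R.
      by rewrite ger0_norm ?mulr_ge0 ?testf_ge0// mulr_ile1 ?testf_ge0 ?testf_le1.
    have aY p : (`|a * testf y_ s (T p)| <= `|a|)%R.
      by rewrite normrM (ger0_norm (testf_ge0 _ _ _)) ler_piMr// testf_le1.
    have iYZ := bounded_integrable rho (measurable_funM (mtY s) (mtZ t)) YZ01.
    have iaY := bounded_integrable rho (measurable_funM (measurable_cst a) (mtY s)) aY.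
    have YZfin : \int[rho]_p (testf y_ s (T p) * testf z_ t p.2)%:E \is a fin_num.
      exact: integrable_fin_num.
    have := orth s t; rewrite -/a /=.
    under eq_integral do rewrite mulrBr [X in (_ - X)%R]mulrC EFinB.
    rewrite integralB_EFin//.
    under [X in _ - X]eq_integral do rewrite EFinM.
    have Y1 p : (`|testf y_ s (T p)| <= 1)%R by rewrite (ger0_norm (testf_ge0 _ _ _)) testf_le1.
    rewrite (integralZl measurableT (bounded_integrable rho (mtY s) Y1)).
    rewrite -{1}(fineK YZfin) -{1}(fineK Yfin) -EFinM -EFinB => -[] /eqP.
    by rewrite subr_eq0 => /eqP h; rewrite -[LHS]fineK// h.
  (* Two measures on [Z] are compared: the image of [rho] weighted by the test function of [T p],
     and [nu] weighted by the constant [b]. Agreement on test functions of [z] extends to every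
     measurable [F]. *)
  have w := testf_weighted_unique z_dense (mtY s) (tY01 s) measurable_snd
    (measurable_cst b) (fun=> b0) (@measurable_id _ _ setT) key mF.
  transitivity (weighted rho (fun p => testf y_ s (T p)) snd F).
    rewrite /weighted [RHS]integral_mkcond; apply: eq_integral => p _; rewrite patchE.
    have -> : (p \in snd @^-1` F) = (p.2 \in F) by apply/idP/idP; rewrite !inE.
    by rewrite indicE; case: (p.2 \in F); rewrite ?mul1r ?mul0r.
  rewrite w /weighted/= preimage_id integral_cst// muleC; congr (_ * _).
  rewrite integral_law//; first by rewrite fineK.
  - by apply/measurable_EFinP; exact: measurable_testf.
  - by move=> y; rewrite lee_fin testf_ge0.
move=> A C mA mC.
transitivity (rho ((fun p => (p.2, T p)) @^-1` (C `*` A))).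
  by congr (rho _); apply/seteqP; split=> p /= [].
rewrite (product_law_testf y_dense measurable_snd mT test_eq); last exact: measurableX.
by rewrite [RHS]muleC; exact: product_measure1E.
Qed.

End monge_functional.

(** Here [f] is extended-valued, unlike in [integral_shift]. When its integral is infinite, that of
    the positive part of the sum stays infinite while the negative part is bounded by the absolute
    value of [m]. *)
Lemma integral_add_cst d (T : measurableType d) (R : realType) (P : probability T R)
    (f : T -> \bar R) (m : R) : measurable_fun [set: T] f -> (forall t, 0 <= f t) ->
  \int[P]_t (f t + m%:E) = \int[P]_t f t + m%:E.
Proof.
move=> mf f0; have mcst (a : R) : measurable_fun [set: T] (cst a%:E) by exact: measurable_cst.
have icst (a : R) : P.-integrable setT (cst a%:E).
  exact: (bounded_integrable P (M := `|a|) (measurable_cst a)).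
have [foo|ffin] := eqVneq (\int[P]_t f t) +oo; last first.
  have intf : P.-integrable setT f.
    by apply/integrableP; split=> //; under eq_integral do rewrite gee0_abs//; rewrite ltey.
  by rewrite (integralD measurableT intf (icst m)) integral_probability_cst.
rewrite foo; set g := fun t => f t + m%:E.
have mg : measurable_fun setT g by exact: emeasurable_funD.
have fin_neg : \int[P]_t g^\- t < +oo.
  apply: (@le_lt_trans _ _ (\int[P]_t (`|m|)%:E)); last by rewrite integral_probability_cst ltry.
  apply: le_integral_pointwise => t; rewrite funenegE ge_max lee_fin normr_ge0 andbT /g.
  rewrite oppeD ?fin_num_adde_defl// -EFinN.
  apply: (@le_trans _ _ (- m)%:E); last by rewrite lee_fin -normrN ler_norm.
  by rewrite geeDr// leeNl oppe0.
have pos_oo : \int[P]_t g^\+ t = +oo.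
  have : \int[P]_t f t <= \int[P]_t (g^\+ t + (`|m|)%:E).
    apply: le_integral_pointwise => t; apply: (@le_trans _ _ (g t + (`|m|)%:E)); last first.
      by rewrite leeD2r// funeposE le_max lexx.
    by rewrite /g -addeA -EFinD leeDl// lee_fin -lerBlDl sub0r -normrN ler_norm.
  rewrite foo ge0_integralD// ?integral_probability_cst; last exact: measurable_funepos.
  by rewrite leye_eq; case: (\int[P]_t g^\+ t).
rewrite integralE pos_oo; move: fin_neg.
have : 0 <= \int[P]_t g^\- t by exact: integral_ge0.
by case: (\int[P]_t g^\- t).
Qed.

Section total_cost.
Context (R : realType) (X Y Z : completeMetricType R).
Context (x_ : nat -> X) (x_dense : dense_seq x_) (y_ : nat -> Y) (y_dense : dense_seq y_).
Context dW (W : measurableType dW) (Q : probability W R) (r : W -> R).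
Hypothesis r_uniform : uniform_variable Q r.
Variables (rho : probability (borel X * borel Z)%type R).
Variables (nu : probability (borel Z) R) (k : R.-pker (borel Z) ~> (borel X)).
Hypothesis hrho : disintegration rho nu k.
Variables (c : X * Y -> R) (c_cont : continuous c) (m : R).
Hypothesis c_ge : forall p, (m <= c p)%R.

Lemma total_transport_cost_le_plan mu xi : plan Q rho nu mu xi ->
  total_transport_cost c nu k mu <= plan_cost Q rho c m xi + m%:E.
Proof.
move=> xi_plan.
have [N [mN N0 subN]] := coupling_section x_dense y_dense r_uniform hrho xi_plan.
pose g := section_cost Q k c m xi.
have g0 z : 0 <= g z by exact: section_cost_ge0.
have mg : measurable_fun setT g by exact: (measurable_section_cost y_dense k c_cont c_ge xi_plan).
(* [Ic c (k z) mu] need not be measurable in [z], so the bound on it has to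
   hold everywhere: it is infinite on the null set. *)
pose g' z := if z \in (N : set (borel Z)) then +oo else g z.
have mg' : measurable_fun setT (g' : borel Z -> \bar R).
  apply: measurable_fun_ifT => //.
  by apply: (measurable_fun_bool true); rewrite setTI preimage_mem_true.
have g'0 z : 0 <= g' z by rewrite /g'; case: ifP.
rewrite -(integral_section_cost x_dense y_dense r_uniform hrho c_cont c_ge xi_plan).
have -> : \int[nu]_z section_cost Q k c m xi z = \int[nu]_z g' z.
  apply: ge0_ae_eq_integral => //; exists N; split=> // z /= nz.
  by apply: contrapT => Nz; apply: nz => _; rewrite /g' memNset.
rewrite -integral_add_cst//; apply: le_integral_pointwise => z.
rewrite /g'; case: (boolP (z \in _)) => [_|]; first by rewrite leey.
rewrite notin_setE => Nz; have cz : coupling (k z) mu (plan_section k xi_plan z).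
  by apply: contrapT => ncz; apply: Nz; exact: subN.
rewrite /g -(transport_cost_section y_dense k c_cont c_ge xi_plan z).
by apply: ereal_inf_lbound; exists (plan_section k xi_plan z).
Qed.

(** The minorant [h] is below [Ic] at every [z], so the integrals compare without measurability of
    [Ic]. *)
Lemma total_transport_cost_ge (w : \bar R) mu :
  (forall mu' xi', plan Q rho nu mu' xi' -> w <= plan_cost Q rho c m xi') ->
  w + m%:E <= total_transport_cost c nu k mu.
Proof.
move=> w_le.
have [h [mh h0 hIc wh]] :=
  transport_lower_bound x_dense y_dense r_uniform hrho c_cont c_ge mu w_le.
apply: (@le_trans _ _ (\int[nu]_z (h z + m%:E))); last exact: le_integral_pointwise.
by rewrite integral_add_cst// leeD2r.
Qed.

Variables (T : borel X * borel Z -> borel Y).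
Hypothesis mT : measurable_fun [set: borel X * borel Z] T.

Lemma map_planE mu : plan Q rho nu mu (fun p => T p.1) <->
  forall A C, measurable A -> measurable C -> rho [set p | A (T p) /\ C p.2] = mu A * nu C.
Proof.
have E A C : measurable A -> measurable C ->
    (rho \x Q) [set p | A (T p.1) /\ C p.1.2] = rho [set p | A (T p) /\ C p.2].
  move=> mA mC; rewrite (_ : [set p | _] = [set p | A (T p) /\ C p.2] `*` setT); last first.
    by apply/seteqP; split=> p /= => [|[]].
  apply: product_probability_setT; apply: measurableI.
    by rewrite -[X in measurable X]setTI; exact: mT.
  by rewrite -[X in measurable X]setTI; exact: measurable_snd.
split=> [[_ h] A C mA mC|h]; first by rewrite -E// h.
split=> [|A C mA mC]; first exact: measurableT_comp mT measurable_fst.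
by rewrite E// h.
Qed.

Lemma map_plan_cost :
  \int[rho]_p (c (p.1, T p))%:E = plan_cost Q rho c m (fun p => T p.1) + m%:E.
Proof.
rewrite (integral_cost y_dense c_cont c_ge rho measurable_fst mT); congr (_ + _).
have mc := measurable_cost y_dense c_cont m measurable_fst mT.
rewrite /plan_cost fubini_tonelli1//.
- apply: eq_integral => p _; rewrite /fubini_F/= integral_cst// [X in _ * X](_ : _ = 1) ?mule1//.
  exact: probability_setT.
- exact: (measurableT_comp mc measurable_fst).
- by move=> p; exact: cost_ge0.
Qed.

End total_cost.

Theorem theorem2 (R : realType) (X Y Z : completeMetricType R)
    (sepX : separable X) (sepY : separable Y) (sepZ : separable Z)
    (rho : probability (borel X * borel Z)%type R)
    (nu : probability (borel Z) R)
    (k : R.-pker (borel Z) ~> (borel X))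
    (hrho : disintegration rho nu k)
    (c : X * Y -> R)
    (c_cont : continuous c)
    (c_bounded_below : exists m : R, forall p : X * Y, (m <= c p)%R)
    (coercive : locally_uniformly_coercive c)
    (HB_Y : heine_borel Y)
    (unique_monge : forall mu : probability (borel Y) R,
       {ae nu, forall z, unique_monge_coupling c (k z) mu}) :
  (exists v : \bar R,
     [/\ is_min (range (total_transport_cost c nu k)) v,
         is_min (joint_cost c @` barycentric_coupling (Y := Y) rho) v
       & is_min (monge_functional c rho nu @`
                   measurable_fun [set: borel X * borel Z]) v]) /\
  (forall T : borel X * borel Z -> borel Y,
     measurable_fun [set: borel X * borel Z] T ->
     (forall T' : borel X * borel Z -> borel Y,
        measurable_fun [set: borel X * borel Z] T' ->
        monge_functional c rho nu T <= monge_functional c rho nu T') ->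
     monge_functional c rho nu T < +oo ->
     exists mu : probability (borel Y) R,
       barycenter c nu k mu /\ transport_map rho nu mu T).
Proof.
have [x_ x_dense] := separable_dense_seq sepX.
have [y_ y_dense] := separable_dense_seq sepY.
have [z_ z_dense] := separable_dense_seq sepZ.
have [dW [W [Q [r r_uniform]]]] := exists_uniform_variable R.
have [m c_ge] := c_bounded_below.
have [mu [xi [xi_plan xi_min]]] :=
  minimal_plan_exists x_dense y_dense r_uniform hrho c_cont c_ge coercive HB_Y.
pose v := plan_cost Q rho c m xi + m%:E.
have total_ge mu' : v <= total_transport_cost c nu k mu'.
  exact: (total_transport_cost_ge x_dense y_dense r_uniform hrho c_cont c_ge mu' xi_min).
have total_le mu' xi' (h : plan Q rho nu mu' xi') :
    total_transport_cost c nu k mu' <= plan_cost Q rho c m xi' + m%:E.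
  exact: (total_transport_cost_le_plan x_dense y_dense r_uniform hrho c_cont c_ge h).
have finite_plan T (mT : measurable_fun setT T) : monge_functional c rho nu T < +oo ->
    plan Q rho nu (law rho mT) (fun p => T p.1).
  move=> Foo; apply/(map_planE _ _ _ mT).
  exact: (monge_functional_finite y_dense z_dense c_cont c_ge mT Foo).
have map_costE T (mT : measurable_fun setT T) := map_plan_cost y_dense Q rho c_cont c_ge mT.
(* A finite value makes [T] a plan, and its cost, hence the functional above it, is at least the
   minimal one. *)
have monge_ge T : measurable_fun setT T -> v <= monge_functional c rho nu T.
  move=> mT; have [->|Foo] := eqVneq (monge_functional c rho nu T) +oo; first exact: leey.
  apply: le_trans (monge_functional_ge rho nu c T).
  by rewrite map_costE// leeD2r//; apply: xi_min (finite_plan T mT _); rewrite ltey.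
have [T0 mT0 T0v] : exists2 T0, measurable_fun setT T0 & monge_functional c rho nu T0 = v.
  (* If the minimal cost is infinite, so is the functional at every map, and a constant map attains
     it. *)
  have [xioo|xifin] := eqVneq (plan_cost Q rho c m xi) +oo.
    exists (fun=> y_ 0%N); first exact: measurable_cst.
    by have := monge_ge _ (measurable_cst (y_ 0%N : borel Y)); rewrite /v xioo leye_eq => /eqP.
  have xilt : plan_cost Q rho c m xi < +oo by rewrite ltey.
  have [T [mT T_plan T_cost]] := monge_plan x_dense y_dense r_uniform hrho c_cont c_ge
    xi_plan xi_min xilt (unique_monge mu).
  exists T => //.
  rewrite (monge_functional_product y_dense c_cont c_ge mT ((map_planE _ _ _ mT _).1 T_plan)).
  by rewrite map_costE// T_cost.
split.
  exists v; split.
  - split; first by exists mu => //; apply/eqP; rewrite eq_le total_ge total_le.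
    by move=> _ [mu' _ <-].
  - split.
      have [P [P_bary P_cost]] := coupling_of_plan y_dense c_cont c_ge xi_plan.
      by exists P.
    move=> _ [P P_bary <-].
    have [mu' [xi' [h ->]]] := plan_of_coupling y_dense r_uniform hrho c_cont c_ge P_bary.
    by rewrite leeD2r//; exact: xi_min h.
  - split; first by exists T0.
    by move=> _ [T mT <-]; exact: monge_ge.
move=> T mT T_min T_fin; have T_plan := finite_plan T mT T_fin.
exists (law rho mT); split.
  move=> mu'; apply: le_trans (total_ge mu').
  apply: (le_trans (total_le _ _ T_plan)); rewrite -map_costE// -T0v.
  by apply: le_trans (T_min _ mT0); exact: monge_functional_ge.
split=> // A mA.
have mTz : measurable_fun setT (fun p : borel X * borel Z => (T p, p.2)).
  by apply: measurable_fun_pair => //; exact: measurable_snd.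
apply: (@rectangle_measure_unique _ _ _ _ _ (law rho mTz) (law rho mT \x nu)%E) => //.
  by rewrite [X in X < _](_ : _ = 1) ?ltry//; exact: probability_setT.
move=> B C mB mC; transitivity (law rho mT B * nu C); last by apply/esym; exact: product_measure1E.
by rewrite -((map_planE _ _ _ mT _).1 T_plan).
Qed.
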